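(* Let $d\ge1$ and, for each $n\ge1$, let $F_n=(F_{n,1},\dots,F_{n,d})$ be a random vector such that $F_{n,i}\in\mathrm{Ker}(\mathbf L+2\,\mathbf{Id})$ for every $i\in\{1,\dots,d\}$ (each component belongs to the second Wiener chaos) and whose covariance matrix is the identity, $\mathrm{Cov}(F_n)=\mathbf{Id}_d$. Assume that for every $i\in\{1,\dots,d\}$ one has $\kappa_4(F_{n,i})\to0$ as $n\to\infty$. Then for every $q\ge1$ there exist $C_q>0$ and $n_q\ge1$ such that for all $n\ge n_q$ and all $\xi=(\xi_1,\dots,\xi_d)\in\mathbb R^d\setminus\{0\}$, $$\left|\mathbb E\left(e^{\mathrm{i}\sum_{k=1}^d\xi_kF_{n,k}}\right)\right|\le\frac{C_q}{\left(\xi_1^2+\cdots+\xi_d^2\right)^{q/2}}.$$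
   Context: Let $(X_i)_{i\ge1}$ be an i.i.d. sequence of standard Gaussian random variables on a probability space $(\Omega,\mathcal F,\mathbb P)$ with $\mathcal F=\sigma(X_i; i\ge 1)$. The Ornstein–Uhlenbeck operator $\mathbf L$ is (the closure in $L^2$ of) the operator acting on smooth functions of finitely many $X_i$ by $$\mathbf L[f(X_1,\dots,X_d)]=\Delta f(X_1,\dots,X_d)-\sum_{i=1}^d X_i\,\partial_i f(X_1,\dots,X_d).$$ For an integer $k\ge1$, the $k$-th Wiener chaos is $\mathrm{Ker}(\mathbf L+k\,\mathbf{Id})\subset L^2(\Omega,\mathcal F,\mathbb P)$, equivalently the closed linear span in $L^2$ of the products $\prod_i H_{k_i}(X_i)$ with $\sum_i k_i=k$, where $H_m$ is the $m$-th Hermite polynomial. Elements of these chaoses are centered. For $F$ in such a chaos with $\mathbb E(F^2)=1$, the fourth cumulant is $\kappa_4(F)=\mathbb E(F^4)-3$. In the exponent, $\mathrm i$ denotes the imaginary unit. *)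

(* Defs.v *)
From HB Require Import structures.
From mathcomp Require Import all_boot all_order all_algebra finmap.
From mathcomp Require Import all_classical all_reals all_analysis.
From mathcomp Require Import complex.

Set Implicit Arguments.
Unset Strict Implicit.
Unset Printing Implicit Defensive.

Import Order.TTheory GRing.Theory Num.Theory.
Import numFieldNormedType.Exports.

Local Open Scope classical_set_scope.
Local Open Scope ring_scope.

Section smooth_functions.
Context {R : realType} {m : nat}.
Implicit Type f : 'rV[R]_m -> R.

Definition partial (i : 'I_m) f : 'rV[R]_m -> R := 'D_(delta_mx 0 i) f.

(* [derive] is total, hence the derivability requirement at every order. *)
Definition smooth f : Prop :=
  forall s : seq 'I_m, let g := foldr partial f s in
    continuous g /\ forall (i : 'I_m) x, derivable g x (delta_mx 0 i).

(* \Delta f(x) - \sum_i x_i \partial_i f(x) *)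
Definition ou_diff f (x : 'rV[R]_m) : R :=
  \sum_(i < m) partial i (partial i f) x - \sum_(i < m) x 0 i * partial i f x.

End smooth_functions.

Section probability.
Context d (T : measurableType d) (R : realType) (P : probability T R).

Definition mutually_independent (X : nat -> {RV P >-> R}) : Prop :=
  forall (J : {fset nat}) (B : nat -> set R), (forall i, measurable (B i)) ->
    P (\bigcap_(i in [set` J]) X i @^-1` B i) =
      (\prod_(i <- J) P (X i @^-1` B i))%E.

(* Equality as measures: both sides are arbitrary off the measurable sets. *)
Definition standard_gaussian (Y : {RV P >-> R}) : Prop :=
  forall A : set R, measurable A -> distribution P Y A = normal_prob 0 1 A.

Definition L2_cvg (u : nat -> T -> R) (v : T -> R) : Prop :=
  ('N[P]_2%:E[EFin \o (u n \- v)%R] @[n --> \oo] --> 0)%E.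

Section ornstein_uhlenbeck.
Variable X : nat -> {RV P >-> R}.

Definition sample (m : nat) (w : T) : 'rV[R]_m := \row_(i < m) X i w.

(* Graph of the operator on smooth functions of finitely many X_i. No growth is
   imposed on the derivatives: the domain consists of all smooth f for which
   both f(X) and its image lie in L^2. *)
Definition ou_smooth_graph (F G : T -> R) : Prop :=
  F \in Lfun P 2%:E /\ G \in Lfun P 2%:E /\
  exists m (f : 'rV[R]_m -> R), [/\ smooth f,
    F = f \o sample m & G = ou_diff f \o sample m].

(* F is in the domain of the closure L and L F = G, as elements of L^2: the
   graph of the closure is the L^2 x L^2-closure of the graph above. *)
Definition ou_graph (F G : T -> R) : Prop :=
  F \in Lfun P 2%:E /\ G \in Lfun P 2%:E /\
  exists u v : nat -> T -> R, [/\ forall n, ou_smooth_graph (u n) (v n),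
    L2_cvg u F & L2_cvg v G].

(* Ker(L + k Id) *)
Definition wiener_chaos (k : nat) (F : T -> R) : Prop :=
  exists2 G, ou_graph F G & {ae P, forall w, G w + k%:R * F w = 0}.

End ornstein_uhlenbeck.

(* Fourth cumulant of a centered variable of unit variance. *)
Definition kappa4 (F : T -> R) : \bar R :=
  ('E_P[(fun w => F w ^+ 4)%R] - 3%:E)%E.

(* e^z = e^(Re z) (cos (Im z) + i sin (Im z)) *)
Definition expC (z : R[i]) : R[i] :=
  Complex (expR (complex.Re z) * cos (complex.Im z))
          (expR (complex.Re z) * sin (complex.Im z)).

(* Only meaningful when the real and imaginary parts of Z are integrable. *)
Definition expectationC (Z : T -> R[i]) : R[i] :=
  Complex (fine 'E_P[(fun w => complex.Re (Z w))])
          (fine 'E_P[(fun w => complex.Im (Z w))]).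

End probability.

(* Main.v *)
(* For a symmetric matrix A, let Q be the quadratic form X^T A X and put
   h(t) = |E e^(itQ)|^2. Gaussian integration by parts along the resolvent
   D_t = (1 + 4 t^2 A^2)^(-1) gives h' = - 4 t tr(A^2 D_t) h. If |v A|^2 <= M |v|^2
   then tr(A^2) <= (1 + 4 t^2 M) tr(A^2 D_t), so h(t) (1 + 4 t^2 M)^p is
   nonincreasing as soon as 2 p M <= tr(A^2): the characteristic function decays
   polynomially, with an exponent governed by the ratio of the squared
   Hilbert-Schmidt and operator norms.

   The fourth cumulant of Q - tr A is 48 tr(A^4) and |v A|^2 <= tr(A^4)^(1/2) |v|^2,
   so vanishing fourth cumulants make the operator norm of \sum_k xi_k A_k small
   compared with |xi|, whereas the covariance keeps its Hilbert-Schmidt norm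
   comparable with |xi|.

   A general element F of the second chaos is reduced to this case by projecting
   it on the quadratic polynomials in X_0, ..., X_(m-1). The symmetry of L, tested
   against monomials, shows that the remainder is orthogonal to all polynomials
   in these variables; polynomials being dense in L^2, the projections converge
   to F, and by Jensen they do not increase the fourth moment. *)

Require Import Defs.
From HB Require Import structures.
From mathcomp Require Import all_boot all_order all_algebra finmap.
From mathcomp Require Import all_classical all_reals all_analysis.
From mathcomp Require Import measurable_realfun.
From mathcomp Require Import complex.
From mathcomp Require Import ring lra.

Set Implicit Arguments.
Unset Strict Implicit.
Unset Printing Implicit Defensive.

Import Order.TTheory GRing.Theory Num.Theory.
Import numFieldNormedType.Exports.

Local Open Scope classical_set_scope.
Local Open Scope ring_scope.

(** * Expectations *)

(** In the eigenvalues lambda_j of A one has h(t) = \prod_j (1 + 4 t^2 lambda_j^2)^(-1/2), which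
    would need a diagonalisation and the rotation invariance of the Gaussian law. The resolvent
    produces the logarithmic derivative of this product, - 4 t \sum_j lambda_j^2 / (1 + 4 t^2
    lambda_j^2), by matrix identities and integration by parts alone. The chaos is only known as the
    kernel of a closure whose core carries no growth condition on derivatives, so [L] can be used
    only by moving it onto polynomial test functions. The bound survives the passage from the
    projections to F because M depends on xi and p but not on the number of variables, and because
    cos and sin are Lipschitz, so that L^2 convergence suffices. Density of the polynomials starts
    from Gaussian bumps: by exponential integrability they preserve the closure of the polynomials,
    powers of them yield intervals, and monotone class arguments yield every event of the generated
    sigma-algebra. Any integer p > q serves for the exponent q, since |phi|^2 (1 + |xi|^2 / (4 p))^p
    <= 1 makes phi decay like |xi|^(-p). *)

Section expectation_calculus.
Context d (T : measurableType d) (R : realType) (P : probability T R).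
Implicit Types (f g h : T -> R).

Definition L1 f := P.-integrable setT (EFin \o f).

Definition Ex f : R := \int[P]_w f w.

Lemma L1_measurable f : L1 f -> measurable_fun setT f.
Proof. by move=> /integrableP[/measurable_EFinP]. Qed.

Lemma L1_le f g : measurable_fun setT f -> (forall w, `|f w| <= g w) ->
  L1 g -> L1 f.
Proof.
move=> mf fg; apply: le_integrable => //; first exact/measurable_EFinP.
by move=> w _ /=; rewrite lee_fin (le_trans (fg w))// ler_norm.
Qed.

Lemma eq_L1 f g : f =1 g -> L1 f -> L1 g.
Proof. by move=> /funext ->. Qed.

Lemma L1_cst c : L1 (fun=> c).
Proof. exact: finite_measure_integrable_cst. Qed.

Lemma L1D f g : L1 f -> L1 g -> L1 (fun w => f w + g w).
Proof. by move=> If Ig; exact (integrableD measurableT If Ig). Qed.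

Lemma L1Z c f : L1 f -> L1 (fun w => c * f w).
Proof. by move=> If; exact (integrableZl measurableT c If). Qed.

Lemma L1B f g : L1 f -> L1 g -> L1 (fun w => f w - g w).
Proof. by move=> If Ig; exact (integrableB measurableT If Ig). Qed.

Lemma L1_sum I (s : seq I) (Q : pred I) (F : I -> T -> R) :
  (forall i, Q i -> L1 (F i)) -> L1 (fun w => \sum_(i <- s | Q i) F i w).
Proof.
move=> IF; elim: s => [|i s IHs].
  by apply: eq_L1 (L1_cst 0) => w; rewrite big_nil.
have [Qi|Qi] := boolP (Q i); last by apply: eq_L1 IHs => w; rewrite big_cons (negbTE Qi).
by apply: eq_L1 (L1D (IF i Qi) IHs) => w; rewrite big_cons Qi.
Qed.

Lemma L1_norm f : L1 f -> L1 (fun w => `|f w|).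
Proof. by move=> If; exact (integrable_abse If). Qed.

Lemma eq_Ex f g : f =1 g -> Ex f = Ex g.
Proof. by move=> fg; congr Ex; apply/funext. Qed.

Lemma Ex_cst c : Ex (fun=> c) = c.
Proof.
rewrite /Ex Rintegral_cst// -[RHS]mulr1; congr (_ * _).
by rewrite -[RHS]/(fine 1%E); congr fine; exact: probability_setT.
Qed.

Lemma ExD f g : L1 f -> L1 g -> Ex (fun w => f w + g w) = Ex f + Ex g.
Proof. by move=> If Ig; rewrite /Ex RintegralD. Qed.

Lemma ExB f g : L1 f -> L1 g -> Ex (fun w => f w - g w) = Ex f - Ex g.
Proof. by move=> If Ig; rewrite /Ex RintegralB. Qed.

Lemma ExZ c f : L1 f -> Ex (fun w => c * f w) = c * Ex f.
Proof. by move=> If; rewrite /Ex RintegralZl. Qed.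

Lemma ExN f : L1 f -> Ex (fun w => - f w) = - Ex f.
Proof.
by move=> If; rewrite -mulN1r -ExZ//; apply: eq_Ex => w; rewrite mulN1r.
Qed.

Lemma Ex_sum I (s : seq I) (Q : pred I) (F : I -> T -> R) :
  (forall i, Q i -> L1 (F i)) ->
  Ex (fun w => \sum_(i <- s | Q i) F i w) = \sum_(i <- s | Q i) Ex (F i).
Proof.
move=> IF; elim: s => [|i s IHs].
  by rewrite big_nil -[RHS]Ex_cst; apply: eq_Ex => w; rewrite big_nil.
rewrite big_cons; have [Qi|Qi] := boolP (Q i); last first.
  by rewrite -IHs; apply: eq_Ex => w; rewrite big_cons (negbTE Qi).
rewrite -IHs -ExD; [|exact: IF|exact: L1_sum].
by apply: eq_Ex => w; rewrite big_cons Qi.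
Qed.

Lemma Ex_ge0 f : (forall w, 0 <= f w) -> 0 <= Ex f.
Proof. by move=> f0; apply: Rintegral_ge0. Qed.

Lemma le_Ex f g : L1 f -> L1 g -> (forall w, f w <= g w) -> Ex f <= Ex g.
Proof. by move=> If Ig fg; apply: le_Rintegral. Qed.

Lemma normr_Ex f : L1 f -> `|Ex f| <= Ex (fun w => `|f w|).
Proof. by move=> If; exact: le_normr_Rintegral. Qed.

Lemma EFin_Ex f : L1 f -> (\int[P]_w (f w)%:E)%E = (Ex f)%:E.
Proof. by move=> If; rewrite /Ex /Rintegral fineK//; exact: integrable_fin_num. Qed.

Lemma Ex_cvg (u : nat -> T -> R) f h : (forall n, measurable_fun setT (u n)) ->
  (forall w, u n w @[n --> \oo] --> f w) -> (forall n w, `|u n w| <= h w) ->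
  L1 h -> L1 f /\ Ex (u n) @[n --> \oo] --> Ex f.
Proof.
move=> mu uf uh Ih.
have mf : measurable_fun setT f by apply: (measurable_fun_cvg mu) => w _; exact: uf.
have Iu n : L1 (u n) by apply: (L1_le (mu n) (uh n) Ih).
have [||||/=|If _ cuf] :=
  @dominated_convergence _ _ _ P setT measurableT (fun n => EFin \o u n) (EFin \o f)
    (EFin \o h).
- by move=> n; exact/measurable_EFinP.
- exact/measurable_EFinP.
- by apply/nearW => w _; apply/cvg_EFin; [exact: nearW|exact: uf].
- exact: Ih.
- by apply/nearW => w n _; rewrite lee_fin.
split=> //.
have : (\int[P]_x (u n x)%:E)%E @[n --> \oo] --> (Ex f)%:E.
  by rewrite -(EFin_Ex If); exact: cuf.
exact: fine_cvg.
Qed.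

Definition L2 f := measurable_fun setT f /\ L1 (fun w => f w ^+ 2).

Lemma eq_L2 f g : f =1 g -> L2 f -> L2 g.
Proof. by move=> /funext ->. Qed.

Lemma L2M f g : L2 f -> L2 g -> L1 (fun w => f w * g w).
Proof.
move=> [mf If] [mg Ig]; apply: L1_le (L1D If Ig); first exact: measurable_funM.
by move=> w; rewrite ler_norml; apply/andP; split; nra.
Qed.

Lemma L2_cst c : L2 (fun=> c).
Proof. by split; [exact: measurable_cst|exact: L1_cst]. Qed.

Lemma L2_L1 f : L2 f -> L1 f.
Proof.
by move=> /L2M/(_ (L2_cst 1)); apply: eq_L1 => w; rewrite mulr1.
Qed.

Lemma L2D f g : L2 f -> L2 g -> L2 (fun w => f w + g w).
Proof.
move=> Lf Lg; split; first exact: measurable_funD Lf.1 Lg.1.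
apply: eq_L1 (L1D (L1D Lf.2 (L1Z 2 (L2M Lf Lg))) Lg.2) => w.
by ring.
Qed.

Lemma L2Z c f : L2 f -> L2 (fun w => c * f w).
Proof.
move=> [mf If]; split; first exact: measurable_funM.
by apply: eq_L1 (L1Z (c ^+ 2) If) => w; rewrite exprMn.
Qed.

Lemma L2N f : L2 f -> L2 (fun w => - f w).
Proof. by move=> /(L2Z (-1)); apply: eq_L2 => w; rewrite mulN1r. Qed.

Lemma L2B f g : L2 f -> L2 g -> L2 (fun w => f w - g w).
Proof. by move=> Lf /L2N; exact: L2D. Qed.

Lemma L2_sum I (s : seq I) (Q : pred I) (F : I -> T -> R) :
  (forall i, Q i -> L2 (F i)) -> L2 (fun w => \sum_(i <- s | Q i) F i w).
Proof.
move=> IF; elim: s => [|i s IHs].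
  by apply: eq_L2 (L2_cst 0) => w; rewrite big_nil.
have [Qi|Qi] := boolP (Q i); last by apply: eq_L2 IHs => w; rewrite big_cons (negbTE Qi).
by apply: eq_L2 (L2D (IF i Qi) IHs) => w; rewrite big_cons Qi.
Qed.

Lemma L2_le f g : measurable_fun setT f -> L2 g -> (forall w, `|f w| <= `|g w|) -> L2 f.
Proof.
move=> mf [mg Ig] fg; split=> //; apply: L1_le Ig; first exact: measurable_funX.
by move=> w; rewrite normrX -(real_normK (num_real (g w))) lerXn2r// nnegrE.
Qed.

Lemma L2_bounded f c : measurable_fun setT f -> (forall w, `|f w| <= c) -> L2 f.
Proof.
move=> mf fc; apply: L2_le (L2_cst c) _ => // w; exact: le_trans (fc w) (ler_norm _).
Qed.

Lemma Ex_CauchySchwarz f g : L2 f -> L2 g ->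
  Ex (fun w => f w * g w) ^+ 2 <= Ex (fun w => f w ^+ 2) * Ex (fun w => g w ^+ 2).
Proof.
move=> Lf Lg; set a := Ex (fun w => f w ^+ 2); set b := Ex (fun w => f w * g w).
set c := Ex (fun w => g w ^+ 2).
have quad x y : 0 <= x ^+ 2 * a + 2 * x * y * b + y ^+ 2 * c.
  have -> : x ^+ 2 * a + 2 * x * y * b + y ^+ 2 * c =
      Ex (fun w => (x * f w + y * g w) ^+ 2).
    rewrite -!ExZ; [|exact: Lg.2|exact: L2M|exact: Lf.2].
    rewrite -!ExD; first by apply: eq_Ex => w; ring.
    - by apply: L1D; apply: L1Z; [exact: Lf.2|exact: L2M].
    - by apply: L1Z; exact: Lg.2.
    - by apply: L1Z; exact: Lf.2.
    - by apply: L1Z; exact: L2M.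
  by apply: Ex_ge0 => w; exact: sqr_ge0.
have a0 : 0 <= a by apply: Ex_ge0 => w; exact: sqr_ge0.
have c0 : 0 <= c by apply: Ex_ge0 => w; exact: sqr_ge0.
(* The three choices give a (a c - b^2) >= 0, c (a c - b^2) >= 0 and, when a = c = 0, - 2 b^2 >=
   0. *)
have := quad (- b) a; have := quad c (- b); have := quad 1 (- b).
have [->|a_neq0] := eqVneq a 0; last first.
  have : 0 < a by rewrite lt_def a_neq0.
  by move=> ? _ _; have := quad (- b) a; nra.
have [->|c_neq0] := eqVneq c 0; last first.
  have : 0 < c by rewrite lt_def c_neq0.
  by move=> ? _; have := quad c (- b); nra.
by nra.
Qed.

End expectation_calculus.

(** * Integration against the standard Gaussian law *)

Section gaussian_integrals.
Context {R : realType}.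
Local Notation mu := (@lebesgue_measure R).
Local Notation gauss := (@normal_prob R 0 1).

Definition gpdf : R -> R := normal_pdf 0 1.

(** The Radon-Nikodym derivative and the density have the same integral over every measurable set,
    hence agree almost everywhere. *)
Lemma ge0_integral_gauss (f : R -> \bar R) :
  measurable_fun setT f -> (forall x, 0 <= f x)%E ->
  (\int[gauss]_x f x = \int[mu]_x (f x * (gpdf x)%:E))%E.
Proof.
move=> mf f0.
have dom := @normal_prob_dominates R 0 1.
rewrite -(Radon_Nikodym_SigmaFinite.change_of_variables dom f0)//.
have mpdf : measurable_fun setT (EFin \o gpdf).
  by apply/measurable_EFinP; exact: measurable_normal_pdf.
have iRN := Radon_Nikodym_SigmaFinite.f_integrable dom.
apply: ae_eq_integral => //.
- by apply: emeasurable_funM => //; exact: measurable_int iRN.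
- exact: emeasurable_funM.
- apply: ae_eqe_mul2l; apply: integral_ae_eq => //.
  by move=> E _ mE; rewrite -(Radon_Nikodym_SigmaFinite.f_integral dom).
Qed.

Lemma integral_gauss (f : R -> R) : measurable_fun setT f ->
  (\int[gauss]_x (f x)%:E = \int[mu]_x (f x * gpdf x)%:E)%E.
Proof.
move=> /measurable_EFinP mf; rewrite integralE [RHS]integralE.
rewrite !ge0_integral_gauss//; [|exact: measurable_funeneg|exact: measurable_funepos].
congr (_ - _)%E; apply: eq_integral => x _.
- rewrite !funeposE -!EFin_max -EFinM maxr_pMl ?mul0r//.
  exact: normal_pdf_ge0.
- rewrite !funenegE -!EFinN -!EFin_max -EFinM maxr_pMl ?mul0r ?mulNr//.
  exact: normal_pdf_ge0.
Qed.

Lemma gpdfE x : gpdf x = normal_peak 1 * expR (- x ^+ 2 / 2).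
Proof.
by rewrite /gpdf normal_pdfE ?oner_neq0// /normal_fun subr0 expr1n.
Qed.

(** Since x^2/4 - x^2/2 = - x^2/4, the integrand is a multiple of the Gaussian density of variance
    2. This single exponential moment controls all polynomial moments and, later, the Gaussian
    bumps. *)
Lemma integral_gauss_expsq_lty :
  (\int[gauss]_x (expR (x ^+ 2 / 4))%:E < +oo)%E.
Proof.
have mexp : measurable_fun setT (fun x : R => expR (x ^+ 2 / 4)).
  apply: measurableT_comp => //; apply: measurable_funM => //.
have s2 : Num.sqrt 2 != 0 :> R by rewrite sqrtr_eq0 -ltNge.
rewrite integral_gauss//.
have -> : (fun x : R => (expR (x ^+ 2 / 4) * gpdf x)%:E) =
    (fun x => (normal_peak 1 / normal_peak (Num.sqrt 2))%:E *
              (normal_pdf 0 (Num.sqrt 2) x)%:E)%E.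
  apply/funext => x; rewrite -EFinM gpdfE normal_pdfE// /normal_fun subr0.
  rewrite sqr_sqrtr// [in RHS]mulrA divfK; last by rewrite gt_eqF// normal_peak_gt0.
  rewrite mulrCA -expRD; congr (_ * expR _)%:E.
  by rewrite -mulr_natr; field.
rewrite integralZl//; last exact: integrable_normal_pdf.
by rewrite integral_normal_pdf mule1 ltry.
Qed.

End gaussian_integrals.

Section gaussian_moments.
Context d (T : measurableType d) (R : realType) (P : probability T R).
Implicit Types (Y Z : T -> R).

Lemma L1_expsq (Y : {RV P >-> R}) : standard_gaussian Y ->
  L1 P (fun w => expR (Y w ^+ 2 / 4)).
Proof.
move=> gY; have mexp : measurable_fun setT (fun x : R => expR (x ^+ 2 / 4)).
  apply: measurableT_comp => //; apply: measurable_funM => //.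
have mY : measurable_fun setT (Y : T -> measurableTypeR R) := measurable_funP Y.
apply/integrableP; split.
  apply/measurable_EFinP; exact (measurableT_comp mexp (measurable_funP Y)).
under eq_integral do rewrite gee0_abs ?lee_fin ?expR_ge0//.
have -> : (\int[P]_w (expR (Y w ^+ 2 / 4))%:E =
    \int[pushforward P (Y : T -> measurableTypeR R)]_x (expR (x ^+ 2 / 4))%:E)%E.
  by rewrite (ge0_integral_pushforward mY)//; exact/measurable_EFinP.
rewrite (@eq_measure_integral _ _ _ setT (normal_prob 0 1)).
  exact: integral_gauss_expsq_lty.
by move=> A mA _; exact: gY.
Qed.

(** Unlike L^2, this class is stable under products, so integrability of polynomial expressions in
    the X_i is settled structurally. *)
Definition tame Y := measurable_fun setT Y /\ forall k, L1 P (fun w => Y w ^+ k).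

Lemma eq_tame Y Z : Y =1 Z -> tame Y -> tame Z.
Proof. by move=> /funext ->. Qed.

Lemma tame_cst c : tame (fun=> c).
Proof. by split=> [|k]; [exact: measurable_cst|exact: L1_cst]. Qed.

Lemma tame_norm Y : tame Y -> forall k, L1 P (fun w => `|Y w| ^+ k).
Proof. by move=> [_ tY] k; apply: eq_L1 (L1_norm (tY k)) => w; rewrite normrX. Qed.

Lemma tame_L1 Y : tame Y -> L1 P Y.
Proof. by move=> [_ /(_ 1%N)]. Qed.

Lemma tame_L2 Y : tame Y -> L2 P Y.
Proof. by move=> [mY /(_ 2%N)]. Qed.

Lemma tameM Y Z : tame Y -> tame Z -> tame (fun w => Y w * Z w).
Proof.
move=> [mY tY] [mZ tZ]; split=> [|k]; first exact: measurable_funM.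
have LX (V : T -> R) : measurable_fun setT V -> (forall k, L1 P (fun w => V w ^+ k)) ->
    L2 P (fun w => V w ^+ k).
  move=> mV tV; split; first exact: measurable_funX.
  by apply: eq_L1 (tV (k * 2)%N) => w; rewrite exprM.
by apply: eq_L1 (L2M (LX _ mY tY) (LX _ mZ tZ)) => w; rewrite exprMn.
Qed.

Lemma tameZ c Y : tame Y -> tame (fun w => c * Y w).
Proof. by apply: tameM; exact: tame_cst. Qed.

(** The half sum is at most the larger of |a| and |b|, whose k-th power is one of the two
    summands. *)
Lemma exprD_le (a b : R) k : `|a + b| ^+ k <= 2 ^+ k * (`|a| ^+ k + `|b| ^+ k).
Proof.
have ub (x : R) : 0 <= x -> x <= Num.max `|a| `|b| -> x ^+ k <= `|a| ^+ k + `|b| ^+ k.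
  move=> x0; rewrite le_max => /orP[|] h; apply: le_trans (_ : _ <= _) _;
    [exact: lerXn2r h|by rewrite lerDl exprn_ge0|exact: lerXn2r h|by rewrite lerDr exprn_ge0].
have -> : `|a + b| ^+ k = 2 ^+ k * (`|a + b| / 2) ^+ k.
  by rewrite -exprMn mulrC divfK.
apply: ler_wpM2l; first by rewrite exprn_ge0.
apply: ub; first by rewrite divr_ge0.
rewrite ler_pdivrMr// mulr_natr mulr2n (le_trans (ler_normD _ _))// lerD// le_max lexx// orbT.
by [].
Qed.

Lemma tameD Y Z : tame Y -> tame Z -> tame (fun w => Y w + Z w).
Proof.
move=> tY tZ; have mYZ := measurable_funD tY.1 tZ.1; split=> // k.
apply: L1_le (L1Z (2 ^+ k) (L1D (tame_norm tY k) (tame_norm tZ k))) => [|w].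
  exact: measurable_funX.
by rewrite normrX exprD_le.
Qed.

Lemma tameN Y : tame Y -> tame (fun w => - Y w).
Proof. by move=> /(tameZ (-1)); apply: eq_tame => w; rewrite mulN1r. Qed.

Lemma tameB Y Z : tame Y -> tame Z -> tame (fun w => Y w - Z w).
Proof. by move=> tY /tameN; exact: tameD. Qed.

Lemma tameX Y k : tame Y -> tame (fun w => Y w ^+ k).
Proof.
move=> [mY tY]; split=> [|j]; first exact: measurable_funX.
by apply: eq_L1 (tY (k * j)%N) => w; rewrite exprM.
Qed.

Lemma tame_sum I (s : seq I) (Q : pred I) (F : I -> T -> R) :
  (forall i, Q i -> tame (F i)) -> tame (fun w => \sum_(i <- s | Q i) F i w).
Proof.
move=> IF; elim: s => [|i s IHs].
  by apply: eq_tame (tame_cst 0) => w; rewrite big_nil.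
have [Qi|Qi] := boolP (Q i); last by apply: eq_tame IHs => w; rewrite big_cons (negbTE Qi).
by apply: eq_tame (tameD (IF i Qi) IHs) => w; rewrite big_cons Qi.
Qed.

Lemma tame_prod I (s : seq I) (Q : pred I) (F : I -> T -> R) :
  (forall i, Q i -> tame (F i)) -> tame (fun w => \prod_(i <- s | Q i) F i w).
Proof.
move=> IF; elim: s => [|i s IHs].
  by apply: eq_tame (tame_cst 1) => w; rewrite big_nil.
have [Qi|Qi] := boolP (Q i); last by apply: eq_tame IHs => w; rewrite big_cons (negbTE Qi).
by apply: eq_tame (tameM (IF i Qi) IHs) => w; rewrite big_cons Qi.
Qed.

Lemma tame_bounded Y c : measurable_fun setT Y -> (forall w, `|Y w| <= c) -> tame Y.
Proof.
move=> mY Yc; split=> // k; apply: L1_le (L1_cst P (c ^+ k)) => [|w].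
  exact: measurable_funX.
by rewrite normrX lerXn2r ?nnegrE// (le_trans _ (Yc w)).
Qed.

Lemma tame_le Y Z : measurable_fun setT Y -> tame Z -> (forall w, `|Y w| <= `|Z w|) -> tame Y.
Proof.
move=> mY tZ YZ; split=> // k; apply: L1_le (tame_norm tZ k) => [|w].
  exact: measurable_funX.
by rewrite normrX lerXn2r ?nnegrE.
Qed.

(** From e^u >= 1 + u^k / k! at u = x^2/4 one gets x^(2k) <= 4^k k! e^(x^2/4), and |x|^k <= 1 +
    x^(2k). *)
Lemma gauss_tame (Y : {RV P >-> R}) : standard_gaussian Y -> tame Y.
Proof.
move=> gY; split=> // k; apply: L1_le (L1Z (1 + 4 ^+ k * k`!%:R) (L1_expsq gY)) => [|w].
  exact: measurable_funX.
set x := Y w; rewrite normrX.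
have x2 : 0 <= x ^+ 2 / 4 by rewrite divr_ge0// sqr_ge0.
have e1 : 1 <= expR (x ^+ 2 / 4) by rewrite -[leLHS]expR0 ler_expR.
have xk : (x ^+ 2) ^+ k <= 4 ^+ k * k`!%:R * expR (x ^+ 2 / 4).
  case: k => [|k]; first by rewrite !expr0 fact0 !mul1r.
  have := expR_ge1Dxn k x2; rewrite -lerBrDl.
  rewrite ler_pdivrMr ?ltr0n ?fact_gt0// expr_div_n ler_pdivrMr ?exprn_gt0//.
  move=> /le_trans; apply; rewrite mulrAC [leRHS]mulrC [4 ^+ _ * _]mulrC mulrA.
  by rewrite [leLHS]mulrAC !ler_pM2r ?exprn_gt0 ?ltr0n ?fact_gt0// gerBl.
rewrite mulrDl mul1r; apply: le_trans (lerD e1 xk).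
rewrite -normrX -[_ ^+ 2 ^+ k]exprM mulnC exprM -(real_normK (num_real (x ^+ k))).
by have := normr_ge0 (x ^+ k); nra.
Qed.

End gaussian_moments.

(** * Gaussian vectors *)

Section random_vectors.
Context {R : realType}.

Lemma cvg_row I (F : set_system I) {FF : Filter F} m (u : I -> 'I_m -> R)
    (a : 'I_m -> R) : (forall i, u n i @[n --> F] --> a i) ->
  (\row_i u n i : 'rV[R]_m) @[n --> F] --> (\row_i a i : 'rV[R]_m).
Proof.
move=> ua A [Q aQ QA].
have : \forall n \near F, forall i : 'I_m, Q ord0 i (u n i).
  apply: filter_forall => i; apply: (ua i).
  by have := aQ ord0 i; rewrite mxE.
apply: filterS => n Qn; apply: QA => i j.
by rewrite ord1 mxE; exact: Qn.
Qed.

Lemma cvg_floor_div (x : R) :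
  (Num.floor (n.+1%:R * x))%:~R / n.+1%:R @[n --> \oo] --> x.
Proof.
apply: (@squeeze_cvgr _ _ _ _ (fun n => x - n.+1%:R^-1) (cst x)); last 2 first.
- rewrite -[X in _ --> X]subr0; apply: cvgB; first exact: cvg_cst.
  exact: cvg_harmonic.
- exact: cvg_cst.
apply: nearW => n /=; have n0 : 0 < n.+1%:R :> R by rewrite ltr0n.
rewrite ler_pdivlMr// ler_pdivrMr// mulrBl mulVf ?gt_eqF// [x * _]mulrC.
rewrite floor_le andbT lerBlDr; apply: ltW; have := lt_succ_floor (n.+1%:R * x).
by rewrite intrD.
Qed.

(** Every preimage is a countable union of fibres of z, so V needs no sigma-algebra. *)
Lemma measurable_countable_cod d (T : measurableType d) (V : countType) d' (U : measurableType d')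
    (z : T -> V) (f : V -> U) :
  (forall v, measurable (z @^-1` [set v])) -> measurable_fun setT (f \o z).
Proof.
move=> mz _ B mB; rewrite setTI.
pose A (v : V) := if `[< B (f v) >] then z @^-1` [set v] else set0.
have -> : (f \o z) @^-1` B =
    \bigcup_(n in [set: nat]) oapp A set0 (choice.unpickle n).
  apply/seteqP; split=> [w /= Bw|w [n _]].
    exists (choice.pickle (z w)) => //; by rewrite choice.pickleK /= /A; case: asboolP.
  by case: choice.unpickle => //= v; rewrite /A; case: asboolP => //= Bv; rewrite /preimage/= => ->.
apply: bigcup_measurable => n _; case: choice.unpickle => //= v.
by rewrite /A; case: ifP.
Qed.

(* ['rV[R]_m] carries no Borel structure here: [g] is rounded to a countable grid. *)
Lemma measurable_comp_row d (T : measurableType d) m (K : 'rV[R]_m -> R)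
    (g : 'I_m -> T -> R) :
  continuous K -> (forall i, measurable_fun setT (g i)) ->
  measurable_fun setT (fun w => K (\row_i g i w)).
Proof.
move=> cK mg.
pose z n w : 'rV[int]_m := \row_i Num.floor (n.+1%:R * g i w).
pose f n (v : 'rV[int]_m) := K (\row_i ((v 0 i)%:~R / n.+1%:R)).
apply: (@measurable_fun_cvg _ _ _ _ (fun n => f n \o z n)).
  move=> n; apply: measurable_countable_cod => v.
  have -> : z n @^-1` [set v] =
      \bigcap_(i in [set: 'I_m]) (fun w => n.+1%:R * g i w) @^-1`
        `[(v 0 i)%:~R, (v 0 i + 1)%:~R[%classic.
    apply/seteqP; split=> [w /= <- i _ /=|w /= H].
      by rewrite in_itv/= mxE floor_le lt_succ_floor.
    apply/rowP => i; rewrite mxE; apply/eqP; rewrite floor_eq.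
    by have := H i I; rewrite /= in_itv.
  apply: fin_bigcap_measurable => // i _.
  by rewrite -[X in measurable X]setTI; apply: measurable_funM.
move=> w _.
have := @cvg_comp _ _ _ _ K _ _ _ (@cvg_row _ _ (@filter_filter _ _ eventually_filter) m _ _ (fun i => @cvg_floor_div (g i w))) (cK _).
congr (_ `=>` _).
rewrite [X in fmap X _](_ : _ = (fun n => (f n \o z n) w))//.
by apply/funext => n; rewrite /= /f; congr K; apply/rowP => i; rewrite !mxE.
Qed.

(** Tuples stand in for row vectors as a measurable space; boxes are the pi-system on which two laws
    will be compared. *)
Lemma tuple_box_generates m :
  @measurable _ (m.-tuple R) = <<s [set A | exists2 B : 'I_m -> set R,
    (forall i, measurable (B i)) &
    A = \bigcap_(i in [set: 'I_m]) (@tnth _ R ^~ i) @^-1` B i] >>.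
Proof.
apply/seteqP; split.
  apply: smallest_sub; first exact: smallest_sigma_algebra.
  rewrite -bigcup_seq => A [i _] [B mB <-]; rewrite setTI.
  apply: sub_gen_smallest; exists (fun j => if j == i then B else setT).
    by move=> j; case: ifP.
  apply/seteqP; split=> [t /= Bt j _|t /(_ i I)]; last by rewrite eqxx.
  by case: eqP => [->|].
apply: smallest_sub; first exact: sigma_algebra_measurable.
move=> A [B mB ->]; apply: fin_bigcap_measurable => // i _.
by rewrite -[X in measurable X]setTI; apply: measurable_tnth.
Qed.

(** The image measures on tuples agree on boxes, hence everywhere, by uniqueness of finite measures
    on a generating pi-system. *)
Lemma integral_eq_law m d1 (T1 : measurableType d1) d2 (T2 : measurableType d2)
    (m1 : {finite_measure set T1 -> \bar R}) (m2 : {measure set T2 -> \bar R})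
    (g : 'I_m -> T1 -> R) (h : 'I_m -> T2 -> R) (K : 'rV[R]_m -> R) (c : R) :
  (forall i, measurable_fun setT (g i)) -> (forall i, measurable_fun setT (h i)) ->
  (forall B : 'I_m -> set R, (forall i, measurable (B i)) ->
     m1 (\bigcap_(i in [set: 'I_m]) g i @^-1` B i) =
     m2 (\bigcap_(i in [set: 'I_m]) h i @^-1` B i)) ->
  continuous K -> (forall x, `|K x| <= c) ->
  (\int[m1]_w (K (\row_i g i w))%:E = \int[m2]_w (K (\row_i h i w))%:E)%E.
Proof.
move=> mg mh gh cK Kc.
pose G w := [tuple g i w | i < m]; pose H w := [tuple h i w | i < m].
have mG : measurable_fun setT G.
  apply/measurable_fun_tnthP => i; apply: eq_measurable_fun (mg i) => w _ /=.
  by rewrite tnth_mktuple.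
have mH : measurable_fun setT H.
  apply/measurable_fun_tnthP => i; apply: eq_measurable_fun (mh i) => w _ /=.
  by rewrite tnth_mktuple.
pose k (t : m.-tuple R) := K (\row_i tnth t i).
have mk : measurable_fun setT k.
  by apply: measurable_comp_row => // i; exact: measurable_tnth.
have boxG (B : 'I_m -> set R) : G @^-1` (\bigcap_(i in [set: 'I_m]) (@tnth _ R ^~ i) @^-1` B i) =
    \bigcap_(i in [set: 'I_m]) g i @^-1` B i.
  by apply/seteqP; split=> w /= Bw i _; have := Bw i I; rewrite /= tnth_mktuple.
have boxH (B : 'I_m -> set R) : H @^-1` (\bigcap_(i in [set: 'I_m]) (@tnth _ R ^~ i) @^-1` B i) =
    \bigcap_(i in [set: 'I_m]) h i @^-1` B i.
  by apply/seteqP; split=> w /= Bw i _; have := Bw i I; rewrite /= tnth_mktuple.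
(* The full box compares the total masses, which makes m2 finite as well. *)
have eqT : m1 setT = m2 setT.
  have := gh (fun=> setT) (fun=> measurableT).
  by congr (m1 _ = m2 _); apply/seteqP; split.
have fin2 : (m2 setT < +oo)%E by rewrite -eqT ltey_eq fin_num_measure.
have Kint d (T : measurableType d) (mu : {measure set T -> \bar R}) (q : T -> m.-tuple R) :
    (mu setT < +oo)%E -> measurable_fun setT q -> mu.-integrable setT (EFin \o (k \o q)).
  move=> muy mq; apply: measurable_bounded_integrable => //.
    exact: measurableT_comp.
  exists c; split; first exact: num_real.
  by move=> x cx w _ /=; rewrite (le_trans (Kc _))// ltW.
transitivity (\int[pushforward m1 G]_t (k t)%:E)%E.
  rewrite (integral_pushforward mG) ?preimage_setT//.
  - by apply: eq_integral => w _ /=; rewrite /k; congr (K _)%:E; apply/rowP => i; rewrite !mxE tnth_mktuple.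
  - exact/measurable_EFinP.
  - by apply: Kint => //; rewrite ltey_eq fin_num_measure.
transitivity (\int[pushforward m2 H]_t (k t)%:E)%E; last first.
  rewrite (integral_pushforward mH) ?preimage_setT//.
  - by apply: eq_integral => w _ /=; rewrite /k; congr (K _)%:E; apply/rowP => i; rewrite !mxE tnth_mktuple.
  - exact/measurable_EFinP.
  - exact: Kint.
apply: eq_measure_integral => A mA _.
apply: (measure_unique _ (fun=> setT) (tuple_box_generates m)) => //.
- move=> A1 A2 [B1 mB1 ->] [B2 mB2 ->]; exists (fun i => B1 i `&` B2 i).
    by move=> i; exact: measurableI.
  by apply/seteqP; split=> [t [H1 H2] i _|t H12]; [split; [exact: H1|exact: H2]|split=> i _; have [] := H12 i I].
- move=> _; exists (fun=> setT) => //.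
  by apply/seteqP; split.
- by rewrite bigcup_const//; exists 0%N.
- by move=> A0 [B mB ->]; have := gh B mB; rewrite -boxG -boxH.
- by move=> _; rewrite /= /pushforward preimage_setT ltey_eq fin_num_measure.
Qed.

End random_vectors.

Section gaussian_vector.
Context d (T : measurableType d) (R : realType) (P : probability T R).
Variable X : nat -> {RV P >-> R}.
Hypothesis X_gauss : forall i, standard_gaussian (X i).
Hypothesis X_indep : mutually_independent X.

Lemma indep_box m (B : nat -> set R) : (forall i, measurable (B i)) ->
  P (\bigcap_(i in [set: 'I_m]) X i @^-1` B i) =
  (\prod_(i < m) P (X i @^-1` B i))%E.
Proof.
move=> mB; pose J := [fset x in iota 0 m]%fset.
have memJ i : (i \in J) = (i < m)%N by rewrite !inE /= mem_iota.
rewrite (_ : \bigcap_(i in _) _ = \bigcap_(i in [set` J]) X i @^-1` B i); last first.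
  apply/seteqP; split=> w /= H.
    by move=> i /=; rewrite memJ => im; exact: (H (Ordinal im) I).
  by move=> i _; apply: H; rewrite /= memJ.
rewrite X_indep// -(big_mkord xpredT (fun i => P (X i @^-1` B i))).
rewrite /index_iota subn0; apply: perm_big; apply: uniq_perm.
- exact: fset_uniq.
- exact: iota_uniq.
- by move=> i; rewrite mem_iota memJ.
Qed.

Definition upd m (x : 'rV[R]_m) (i : 'I_m) (s : R) : 'rV[R]_m :=
  \row_j (if j == i then s else x 0 j).

Lemma upd_id m (x : 'rV[R]_m) i : upd x i (x 0 i) = x.
Proof. by apply/rowP => j; rewrite mxE; case: eqP => [->|]. Qed.

Lemma updE m (x : 'rV[R]_m) i s : upd x i s 0 i = s.
Proof. by rewrite mxE eqxx. Qed.

Lemma updD m (x : 'rV[R]_m) i s : upd x i s = x + (s - x 0 i) *: delta_mx 0 i.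
Proof.
apply/rowP => j; rewrite !mxE eqxx/=; case: eqP => [->|_].
  by rewrite mulr1 subrKC.
by rewrite mulr0 addr0.
Qed.

Lemma continuous_upd m (x : 'rV[R]_m) i : continuous (upd x i).
Proof.
move=> s; have -> : upd x i = fun s => x + (s - x 0 i) *: delta_mx 0 i.
  by apply/funext => u; exact: updD.
apply: cvgD; first exact: cvg_cst.
by apply: cvgZr_tmp; apply: cvgB; [exact: cvg_id|exact: cvg_cst].
Qed.

Local Notation gauss := (@normal_prob R 0 1).

(** By independence, replacing X_i by a fresh Gaussian variable does not change the joint law.
    Averaging over this variable first reduces integration by parts to one dimension. *)
Lemma Ex_resample m (i : 'I_m) (K : 'rV[R]_m -> R) (c : R) :
  continuous K -> (forall x, `|K x| <= c) ->
  (\int[P]_w (K (sample X m w))%:E =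
   \int[P]_w \int[gauss]_s (K (upd (sample X m w) i s))%:E)%E.
Proof.
move=> cK Kc.
pose h (j : 'I_m) (z : T * measurableTypeR R) : R := if j == i then z.2 else X j z.1.
have mh j : measurable_fun setT (h j).
  rewrite /h; case: eqP => _; first exact: measurable_snd.
  exact: measurableT_comp.
transitivity (\int[P]_w (K (\row_j X j w))%:E)%E; first by [].
rewrite (@integral_eq_law _ _ _ _ _ _ P (P \x gauss)%E _ h _ c)//.
- have mK : measurable_fun setT (fun z => K (\row_j h j z)) by exact: measurable_comp_row.
  have iK : (P \x gauss)%E.-integrable setT (EFin \o (fun z => K (\row_j h j z))).
    have fin : ((P \x gauss)%E setT < +oo)%E.
      rewrite -setXTT product_measure1E//.
      by rewrite ltey_eq fin_numM// fin_num_measure.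
    apply: measurable_bounded_integrable => //.
    exists c; split; first exact: num_real.
    by move=> x cx z _ /=; rewrite (le_trans (Kc _))// ltW.
  rewrite -(integral12_prod_meas1 iK).
  apply: eq_integral => w _; apply: eq_integral => s _; congr (K _)%:E.
  by apply/rowP => j; rewrite !mxE /h/=; case: eqP.
- move=> B mB.
  pose B' (k : nat) := if insub k is Some j then B j else setT.
  have mB' k : measurable (B' k) by rewrite /B'; case: insub.
  have B'E (j : 'I_m) : B' j = B j by rewrite /B' valK.
  (* Coordinate i is released from the box of the X_j: its constraint is carried by the second
     factor of the product space. *)
  pose B0 k := if k == i :> nat then setT else B' k.
  have mB0 k : measurable (B0 k) by rewrite /B0; case: ifP.
  rewrite (_ : \bigcap_(j in _) h j @^-1` B j =
      (\bigcap_(j in [set: 'I_m]) X j @^-1` B0 j) `*` B i); last first.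
    apply/seteqP; split=> [[w s] /= H|[w s] /= [H1 H2] j _].
      split=> [j _|]; last by have := H i I; rewrite /= /h eqxx.
      rewrite /B0; case: ifP => //; have := H j I.
      by rewrite /= /h (inj_eq val_inj) B'E => + jNi; rewrite jNi.
    have := H1 j I; rewrite /= /h /B0 (inj_eq val_inj) B'E.
    by case: eqP => // ->.
  transitivity (P (\bigcap_(j in [set: 'I_m]) X j @^-1` B0 j) * gauss (B i))%E; last first.
    apply/esym; apply: product_measure1E; last exact: mB.
    apply: fin_bigcap_measurable => // j _.
    by rewrite -[X in measurable X]setTI; exact: measurable_funP.
  rewrite indep_box// (_ : \bigcap_(j in _) _ =
      \bigcap_(j in [set: 'I_m]) X j @^-1` B' j); last first.
    by apply: eq_bigcapr => j _; rewrite B'E.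
  transitivity (\prod_(j < m) P (X j @^-1` B' j))%E; first exact: indep_box.
  rewrite (bigD1 i)//= [in RHS](bigD1 i)//= {1}/B0 eqxx.
  rewrite preimage_setT probability_setT mul1e muleC B'E; congr (_ * _)%E.
    by apply: eq_bigr => j ji; rewrite /B0 (inj_eq val_inj) (negbTE ji).
  exact: X_gauss.
Qed.

End gaussian_vector.

(** * Gaussian integration by parts *)

Section one_variable.
Context {R : realType}.
Implicit Types (f g : R -> R) (s : R).

Lemma isd_cst c s : is_derive s 1 (fun=> c : R) 0.
Proof. exact: is_derive_cst. Qed.

Lemma isd_eq f s a b : is_derive s 1 f a -> a = b -> is_derive s 1 f b.
Proof. by move=> ? <-. Qed.

Lemma isd_ext f g s a : f =1 g -> is_derive s 1 f a -> is_derive s 1 g a.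
Proof. by move=> /funext ->. Qed.

Lemma isdD f g s a b : is_derive s 1 f a -> is_derive s 1 g b ->
  is_derive s 1 (fun u => f u + g u) (a + b).
Proof. by move=> df dg; exact: is_deriveD. Qed.

Lemma isdN f s a : is_derive s 1 f a -> is_derive s 1 (fun u => - f u) (- a).
Proof. by move=> df; exact: is_deriveN. Qed.

Lemma isdB f g s a b : is_derive s 1 f a -> is_derive s 1 g b ->
  is_derive s 1 (fun u => f u - g u) (a - b).
Proof. by move=> df dg; exact: is_deriveB. Qed.

Lemma isdM f g s a b : is_derive s 1 f a -> is_derive s 1 g b ->
  is_derive s 1 (fun u => f u * g u) (a * g s + f s * b).
Proof.
move=> df dg; apply: isd_eq (is_deriveM df dg) _.
by rewrite /GRing.scale/= addrC; congr (_ + _); rewrite mulrC.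
Qed.

Lemma isdZ f c s a : is_derive s 1 f a -> is_derive s 1 (fun u => c * f u) (c * a).
Proof. by move=> df; apply: isd_eq (isdM (isd_cst c s) df) _; rewrite mul0r add0r. Qed.

Lemma isd_comp f g s a b : is_derive (g s) 1 f a -> is_derive s 1 g b ->
  is_derive s 1 (fun u => f (g u)) (a * b).
Proof. exact: is_derive1_comp. Qed.

Lemma isdX f n s a : is_derive s 1 f a ->
  is_derive s 1 (fun u => f u ^+ n) (n%:R * f s ^+ n.-1 * a).
Proof.
move=> df; apply: isd_ext (is_deriveX n df) => u.
by elim: n => [|n IHn]; rewrite ?expr0// !exprS -IHn.
Qed.

Lemma isd_sum I (r : seq I) (Q : pred I) (f : I -> R -> R) (a : I -> R) s :
  (forall i, Q i -> is_derive s 1 (f i) (a i)) ->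
  is_derive s 1 (fun u => \sum_(i <- r | Q i) f i u) (\sum_(i <- r | Q i) a i).
Proof.
move=> df; elim: r => [|i r IHr].
  by rewrite big_nil; apply: isd_ext (isd_cst 0 s) => u; rewrite big_nil.
rewrite big_cons; case: ifP => Qi; last first.
  by apply: isd_ext IHr => u; rewrite big_cons Qi.
by apply: isd_ext (isdD (df i Qi) IHr) => u; rewrite big_cons Qi.
Qed.

Lemma isd_continuous f s a : is_derive s 1 f a -> {for s, continuous f}.
Proof.
by move=> df; apply: differentiable_continuous; apply/derivable1_diffP; exact: ex_derive.
Qed.

(** Powers of the positive part are differentiable to an order that grows with k and vanish on a
    half-line: they provide compactly supported cutoffs without a smooth bump function. *)
Definition ppow k s : R := Num.max 0 s ^+ k.

Lemma ppow_ge0 k s : 0 <= ppow k s.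
Proof. by rewrite exprn_ge0// le_max lexx. Qed.

Lemma ppow_le0 k s : s <= 0 -> ppow k.+1 s = 0.
Proof. by move=> s0; rewrite /ppow max_l// expr0n. Qed.

Lemma ppow_le1 k s : s <= 1 -> ppow k s <= 1.
Proof. by move=> s1; rewrite exprn_ile1// ?le_max ?lexx// ge_max ler01. Qed.

Lemma continuous_ppow k : continuous (ppow k).
Proof.
move=> s; have c1 : {for s, continuous (fun u : R => Num.max 0 u)}.
  by apply: (@continuous_max _ R (cst 0) id); [exact: cvg_cst|exact: cvg_id].
exact: (continuous_comp c1 (@exprn_continuous R k _)).
Qed.

Lemma isd_ppow k s : is_derive s 1 (ppow k.+2) (k.+2%:R * ppow k.+1 s).
Proof.
have [s0|s0|->] := ltgtP s 0.
- apply: (@near_eq_is_derive _ _ _ (fun=> 0)); last first.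
    by rewrite (ppow_le0 _ (ltW s0)) mulr0; exact: isd_cst.
  near=> u; rewrite ppow_le0//.
  by apply: ltW; near: u; exact: (cvgr_lt s cvg_id).
- apply: near_eq_is_derive (isd_eq (isdX k.+2 (is_derive_id s (1 : R))) _); last first.
    by rewrite mulr1 /ppow max_r// ltW.
  near=> u; rewrite /ppow max_r//.
  by apply: ltW; near: u; exact: (cvgr_gt s cvg_id).
(* At the junction point the difference quotient is squeezed between - [ppow k.+1 h] and
   [ppow k.+1 h], which both tend to 0. *)
- rewrite (ppow_le0 _ (lexx 0)) mulr0.
  suff H : (fun h => h^-1 *: (ppow k.+2 (h *: 1 + 0) - ppow k.+2 0)) @ 0^' --> (0 : R).
    by apply: DeriveDef; [apply/cvg_ex; exists 0|exact/cvg_lim].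
  have lim0 : ppow k.+1 h @[h --> 0^'] --> (0 : R).
    rewrite -{2}(ppow_le0 k (lexx 0)); apply: cvg_within_filter.
    exact: continuous_ppow.
  apply: (@squeeze_cvgr _ _ _ _ (fun h => - ppow k.+1 h) (ppow k.+1)) => //; last first.
    by rewrite -[X in _ --> X]oppr0; apply: cvgN.
  near=> h; have h0 : h != 0 by near: h; exact: nbhs_dnbhs_neq.
  rewrite -ler_norml /GRing.scale/= mulr1 addr0 [ppow _ 0]ppow_le0// subr0.
  rewrite normrM normfV ler_pdivrMl ?normr_gt0//.
  rewrite ger0_norm ?ppow_ge0// /ppow exprS ler_wpM2r ?exprn_ge0 ?le_max ?lexx//.
  by rewrite ge_max normr_ge0 ler_norm.
Unshelve. all: by end_near. Qed.

Lemma isd_gpdf s : is_derive s 1 (@gpdf R) (- s * gpdf s).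
Proof.
have dsq : is_derive s 1 (fun u : R => - u ^+ 2 / 2) (- s).
  apply: isd_eq (isdM (isdN (isdX 2 (is_derive_id s 1))) (isd_cst (2^-1) s)) _.
  by rewrite mulr0 addr0 mulr1 expr1; field.
apply: isd_ext (isd_eq (isdZ (normal_peak 1) (isd_comp (is_derive_expR _) dsq)) _) => [u|].
  by rewrite gpdfE.
by rewrite gpdfE; ring.
Qed.

(** With gamma the Gaussian density, (psi' - s psi) gamma = (psi gamma)', whose integral over a
    segment containing the support vanishes. *)
Lemma gauss_ibp1 (psi dpsi : R -> R) (N : R) :
  (forall s, is_derive s 1 psi (dpsi s)) -> continuous dpsi ->
  (forall s, N <= `|s| -> psi s = 0 /\ dpsi s = 0) ->
  (\int[normal_prob 0 1]_s (dpsi s - s * psi s)%:E = 0)%E.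
Proof.
move=> dp cdp p0.
have cp : continuous psi by move=> s; exact: isd_continuous (dp s).
pose f s := (dpsi s - s * psi s) * gpdf s.
pose F s := psi s * gpdf s.
have dF s : is_derive s 1 F (f s).
  by apply: isd_eq (isdM (dp s) (isd_gpdf s)) _; rewrite /f; ring.
have cF : continuous F by move=> s; exact: isd_continuous (dF s).
have cdps : continuous (fun s => dpsi s - s * psi s).
  move=> s; apply: cvgB; first exact: cdp.
  by apply: cvgM; [exact: cvg_id|exact: cp].
have cf : continuous f.
  move=> s; apply: cvgM; first exact: cdps.
  by apply: continuous_normal_pdf; rewrite oner_neq0.
rewrite integral_gauss; last exact: continuous_measurable_fun.
(* N may be nonpositive; the maximum with 1 keeps the segment [-M, M] nondegenerate. *)
pose M := Num.max 1 N; have M0 : 0 < M by rewrite lt_max ltr01.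
have NM : N <= M by rewrite le_max lexx orbT.
rewrite [LHS](_ : _ = (\int[lebesgue_measure]_(s in `[(- M)%R, M]) (f s)%:E)%E); last first.
  rewrite [RHS]integral_mkcond; apply: eq_integral => s _.
  rewrite patchE; case: ifPn => // /negP sM.
  have [|-> ->] := p0 s; last by rewrite mulr0 subr0 mul0r.
  rewrite (le_trans NM)// leNgt; apply/negP => sltM; apply: sM.
  by rewrite inE/= in_itv/= -ler_norml ltW.
rewrite (@continuous_FTC2 _ f F)//; last first.
- by move=> s _; rewrite derive1E; case: (dF s).
- split=> [s _||]; first by case: (dF s).
  + by apply: cvg_at_right_filter; exact: cF.
  + by apply: cvg_at_left_filter; exact: cF.
- by apply: continuous_subspaceT; exact: cf.
- by rewrite gtrN.
- have FM s : `|s| = M -> F s = 0 by move=> sM; rewrite /F (p0 s _).1 ?mul0r ?sM.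
  by rewrite !FM ?normrN ?gtr0_norm// subee.
Qed.

End one_variable.

Section coordinate_derivative.
Context {R : realType} (m : nat).
Implicit Types (f g : 'rV[R]_m -> R) (i : 'I_m).

(* [f'] is the [i]-th partial derivative of [f]. *)
Definition cderiv i f f' :=
  forall x : 'rV[R]_m, is_derive (x 0 i) (1 : R) (fun s => f (upd x i s)) (f' x).

Lemma upd_upd (x : 'rV[R]_m) i s u : upd (upd x i s) i u = upd x i u.
Proof. by apply/rowP => j; rewrite !mxE; case: eqP. Qed.

Lemma cderiv_upd i f f' (x : 'rV[R]_m) s : cderiv i f f' ->
  is_derive s (1 : R) (fun u => f (upd x i u)) (f' (upd x i s)).
Proof.
move=> df; have := df (upd x i s); rewrite updE.
by apply: isd_ext => u; rewrite upd_upd.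
Qed.

Lemma cderiv_eq i f f' g : f' =1 g -> cderiv i f f' -> cderiv i f g.
Proof. by move=> /funext ->. Qed.

Lemma cderiv_cst i (c : R) : cderiv i (fun=> c) (fun=> 0).
Proof. by move=> x; exact: isd_cst. Qed.

Lemma cderiv_coord i j : cderiv i (fun x : 'rV[R]_m => x 0 j) (fun=> (j == i)%:R).
Proof.
move=> x; have [->|ji] := eqVneq j i.
  by apply: isd_ext (is_derive_id (x 0 i) (1 : R)) => s; rewrite updE.
by apply: isd_ext (isd_cst (x 0 j) (x 0 i)) => s; rewrite mxE (negbTE ji).
Qed.

Lemma cderivD i f f' g g' : cderiv i f f' -> cderiv i g g' ->
  cderiv i (fun x => f x + g x) (fun x => f' x + g' x).
Proof. by move=> df dg x; apply: isdD; [exact: df|exact: dg]. Qed.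

Lemma cderivB i f f' g g' : cderiv i f f' -> cderiv i g g' ->
  cderiv i (fun x => f x - g x) (fun x => f' x - g' x).
Proof. by move=> df dg x; apply: isdB; [exact: df|exact: dg]. Qed.

Lemma cderivM i f f' g g' : cderiv i f f' -> cderiv i g g' ->
  cderiv i (fun x => f x * g x) (fun x => f' x * g x + f x * g' x).
Proof.
move=> df dg x; apply: isd_eq (isdM (df x) (dg x)) _.
by rewrite upd_id.
Qed.

Lemma cderivZ i c f f' : cderiv i f f' ->
  cderiv i (fun x => c * f x) (fun x => c * f' x).
Proof. by move=> df x; apply: isdZ; exact: df. Qed.

Lemma cderiv_comp i (phi phi' : R -> R) f f' :
  (forall s, is_derive s (1 : R) phi (phi' s)) -> cderiv i f f' ->
  cderiv i (fun x => phi (f x)) (fun x => phi' (f x) * f' x).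
Proof.
by move=> dphi df x; apply: isd_comp (df x); rewrite upd_id.
Qed.

Lemma cderivX i k f f' : cderiv i f f' ->
  cderiv i (fun x => f x ^+ k) (fun x => k%:R * f x ^+ k.-1 * f' x).
Proof.
move=> df; apply: (cderiv_comp (phi := fun s => s ^+ k) (phi' := fun s => k%:R * s ^+ k.-1)) => // s.
by apply: isd_eq (isdX k (is_derive_id s (1 : R))) _; rewrite mulr1.
Qed.

Lemma cderiv_sum i I (r : seq I) (Q : pred I) (f f' : I -> 'rV[R]_m -> R) :
  (forall k, Q k -> cderiv i (f k) (f' k)) ->
  cderiv i (fun x => \sum_(k <- r | Q k) f k x) (fun x => \sum_(k <- r | Q k) f' k x).
Proof. by move=> df x; apply: isd_sum => k Qk; exact: df. Qed.

Lemma contM f g : continuous f -> continuous g -> continuous (fun x => f x * g x).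
Proof. by move=> cf cg x; apply: (@cvgM R _ (nbhs x)); [apply: cf|apply: cg]. Qed.

Lemma contD f g : continuous f -> continuous g -> continuous (fun x => f x + g x).
Proof. by move=> cf cg x; apply: (@cvgD R _ _ (nbhs x)); [apply: cf|apply: cg]. Qed.

Lemma contB f g : continuous f -> continuous g -> continuous (fun x => f x - g x).
Proof. by move=> cf cg x; apply: (@cvgB R _ _ (nbhs x)); [apply: cf|apply: cg]. Qed.

Lemma cont_cst (c : R) : continuous (fun _ : 'rV[R]_m => c).
Proof. by move=> x; apply: cst_continuous. Qed.

Lemma contZ c f : continuous f -> continuous (fun x => c * f x).
Proof. by apply: contM; exact: cont_cst. Qed.

Lemma cont_coord j : continuous (fun x : 'rV[R]_m => x 0 j).
Proof. exact: coord_continuous. Qed.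

Lemma cont_comp (phi : R -> R) f : continuous phi -> continuous f ->
  continuous (fun x => phi (f x)).
Proof. by move=> cp cf x; apply: continuous_comp; [exact: cf|exact: cp]. Qed.

Lemma contX k f : continuous f -> continuous (fun x => f x ^+ k).
Proof. by apply: (@cont_comp (fun u => u ^+ k)); exact: exprn_continuous. Qed.

Lemma cont_sum I (r : seq I) (Q : pred I) (f : I -> 'rV[R]_m -> R) :
  (forall k, Q k -> continuous (f k)) -> continuous (fun x => \sum_(k <- r | Q k) f k x).
Proof.
move=> cf; elim: r => [|k r IHr].
  by under eq_fun do rewrite big_nil; exact: cont_cst.
have [Qk|Qk] := boolP (Q k); last first.
  by under eq_fun do rewrite big_cons (negbTE Qk).
by under eq_fun do rewrite big_cons Qk; apply: contD => //; exact: cf.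
Qed.

Lemma bounded_compact_support (K : 'rV[R]_m -> R) (N : R) : continuous K ->
  (forall (x : 'rV[R]_m) j, N <= `|x 0 j| -> K x = 0) -> exists c, forall x, `|K x| <= c.
Proof.
move=> cK K0.
have cpt : compact [set v : 'rV[R]_m | forall i, `[- N, N]%classic (v ord0 i)].
  by apply: (@rV_compact R m (fun=> `[- N, N]%classic)) => i; exact: segment_compact.
have /compact_bounded[M [_ HM]] : compact [set K x | x in [set v : 'rV[R]_m | forall i, `[- N, N]%classic (v ord0 i)]].
  by apply: continuous_compact => //; apply: continuous_subspaceT.
exists (Num.max 0 (M + 1)) => x.
have [[j Nj]|H] := pselect (exists j, N <= `|x 0 j|).
  by rewrite (K0 _ _ Nj) normr0 le_max lexx.
rewrite le_max (HM (M + 1)) ?ltrDl ?orbT//=.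
exists x => //= i; rewrite in_itv/= -ler_norml leNgt; apply/negP => /ltW Ni.
by apply: H; exists i.
Qed.

Definition sqsum (x : 'rV[R]_m) : R := \sum_j x 0 j ^+ 2.

(* Twice differentiable for [k = 3], which is enough for [L]. *)
Definition cutoff n k (x : 'rV[R]_m) : R := ppow k (1 - sqsum x / n.+1%:R ^+ 2).

Lemma cont_sqsum : continuous sqsum.
Proof. by apply: cont_sum => j _; apply: contX; exact: cont_coord. Qed.

Lemma cont_cutoff n k : continuous (cutoff n k).
Proof.
apply: (@cont_comp (ppow k)); first exact: continuous_ppow.
by apply: contB; [exact: cont_cst|apply: contM; [exact: cont_sqsum|exact: cont_cst]].
Qed.

Lemma cderiv_sqsum i : cderiv i sqsum (fun x => 2 * x 0 i).
Proof.
apply: cderiv_eq (@cderiv_sum i _ (index_enum 'I_m) xpredT (fun j x => x 0 j ^+ 2) _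
  (fun j _ => cderivX 2 (cderiv_coord i j))) => x.
rewrite (bigD1 i)//= eqxx mulr1 big1 ?addr0// => j ji.
by rewrite (negbTE ji) mulr0.
Qed.

Lemma cderiv_cutoff i n k : cderiv i (cutoff n k.+2)
  (fun x => - (2 * k.+2%:R) * (x 0 i / n.+1%:R ^+ 2) * cutoff n k.+1 x).
Proof.
have dlin : cderiv i (fun x => 1 - sqsum x / n.+1%:R ^+ 2)
    (fun x => 0 - (2 * x 0 i / n.+1%:R ^+ 2 + sqsum x * 0)).
  apply: cderivB; first exact: cderiv_cst.
  by apply: cderivM; [exact: cderiv_sqsum|exact: cderiv_cst].
apply: cderiv_eq (cderiv_comp (@isd_ppow R k) dlin) => x.
rewrite -/(cutoff n k.+1 x); ring.
Qed.

Lemma sqsum_ge0 x : 0 <= sqsum x.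
Proof. by apply: sumr_ge0 => j _; exact: sqr_ge0. Qed.

Lemma cutoff_ge0 n k x : 0 <= cutoff n k x.
Proof. exact: ppow_ge0. Qed.

Lemma cutoff_le1 n k x : cutoff n k x <= 1.
Proof.
apply: ppow_le1; by rewrite gerBl divr_ge0// sqsum_ge0.
Qed.

Lemma cutoff0 n k (x : 'rV[R]_m) j : n.+1%:R <= `|x 0 j| -> cutoff n k.+1 x = 0.
Proof.
move=> nx; apply: ppow_le0; rewrite subr_le0 ler_pdivlMr ?exprn_gt0// mul1r.
apply: (@le_trans _ _ (x 0 j ^+ 2)).
  by rewrite -(real_normK (num_real (x 0 j))) lerXn2r ?nnegrE.
rewrite /sqsum (bigD1 j)//= lerDl; apply: sumr_ge0 => k0 _; exact: sqr_ge0.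
Qed.

Lemma cutoff_norm n k x : `|cutoff n k x| <= 1.
Proof. by rewrite ger0_norm ?cutoff_ge0 ?cutoff_le1. Qed.

Lemma cvg_invn2 : (n.+1%:R ^+ 2)^-1 @[n --> \oo] --> (0 : R).
Proof.
rewrite [X in fmap X](_ : _ = (@harmonic R) \* (@harmonic R)).
  by rewrite -[X in _ --> X](mulr0 0); apply: cvgM; exact: cvg_harmonic.
by apply/funext => n; rewrite /= -invfM.
Qed.

Lemma cutoff_cvg k x : cutoff n k x @[n --> \oo] --> (1 : R).
Proof.
have -> : 1 = ppow k 1 :> R by rewrite /ppow max_r// expr1n.
apply: (cvg_comp _ (ppow k)); last exact: continuous_ppow.
suff : 1 - sqsum x / n.+1%:R ^+ 2 @[n --> \oo] --> 1 - sqsum x * 0.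
  by rewrite mulr0 subr0.
apply: cvgB; first exact: cvg_cst.
by apply: cvgM; [exact: cvg_cst|exact: cvg_invn2].
Qed.

End coordinate_derivative.

Lemma cvg_const_eq {R : realType} (u : nat -> R) (a b : R) :
  (forall n, u n = a) -> u n @[n --> \oo] --> b -> b = a.
Proof.
move=> /funext -> ab; apply: (cvg_unique _ ab) => //; exact: cvg_cst.
Qed.

Lemma cvg_sumr {R : realType} I (r : seq I) (u : nat -> I -> R) (a : I -> R) :
  (forall i, u n i @[n --> \oo] --> a i) ->
  \sum_(i <- r) u n i @[n --> \oo] --> \sum_(i <- r) a i.
Proof.
move=> ua; elim: r => [|i r IHr].
  by rewrite big_nil; under eq_fun do rewrite big_nil; exact: cvg_cst.
rewrite big_cons; under eq_fun do rewrite big_cons.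
by apply: cvgD => //; exact: ua.
Qed.

Section gaussian_ibp.
Context d (T : measurableType d) (R : realType) (P : probability T R).
Variable X : nat -> {RV P >-> R}.
Hypothesis X_gauss : forall i, standard_gaussian (X i).
Hypothesis X_indep : mutually_independent X.
Variable m : nat.
Implicit Types (f g dg : 'rV[R]_m -> R) (i : 'I_m).

Lemma sampleE w i : sample X m w 0 i = X i w.
Proof. by rewrite mxE. Qed.

Lemma measurable_sample f : continuous f -> measurable_fun setT (fun w => f (sample X m w)).
Proof. by move=> cf; apply: measurable_comp_row => // i; exact: measurable_funP. Qed.

Lemma bounded_tame f c : continuous f -> (forall x, `|f x| <= c) ->
  tame P (fun w => f (sample X m w)).
Proof. by move=> cf fc; apply: (@tame_bounded _ _ _ _ _ c) => //; exact: measurable_sample. Qed.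

(** After resampling coordinate i, the inner integral vanishes for each value of the other
    coordinates by [gauss_ibp1]. *)
Lemma gauss_ibp_compact i (Psi dPsi : 'rV[R]_m -> R) (N : R) :
  continuous Psi -> continuous dPsi -> cderiv i Psi dPsi ->
  (forall (x : 'rV[R]_m) j, N <= `|x 0 j| -> Psi x = 0 /\ dPsi x = 0) ->
  L1 P (fun w => dPsi (sample X m w) - X i w * Psi (sample X m w)) /\
  Ex P (fun w => dPsi (sample X m w) - X i w * Psi (sample X m w)) = 0.
Proof.
move=> cPsi cdPsi dP P0.
pose K (x : 'rV[R]_m) := dPsi x - x 0 i * Psi x.
have cK : continuous K by apply: contB => //; apply: contM => //; exact: cont_coord.
have [c Kc] : exists c, forall x, `|K x| <= c.
  apply: (bounded_compact_support (N := N)) => // x j Nx.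
  by rewrite /K !(P0 _ _ Nx).1 !(P0 _ _ Nx).2 mulr0 subr0.
have KE w : dPsi (sample X m w) - X i w * Psi (sample X m w) = K (sample X m w).
  by rewrite /K sampleE.
have LK : L1 P (fun w => K (sample X m w)) by apply: tame_L1; exact: bounded_tame Kc.
split; first by apply: eq_L1 LK => w; rewrite KE.
rewrite (eq_Ex _ KE); apply: EFin_inj; rewrite -EFin_Ex// (Ex_resample X_gauss X_indep i cK Kc).
apply: integral0_eq => w _.
rewrite -[RHS](@gauss_ibp1 _ (fun s => Psi (upd (sample X m w) i s))
  (fun s => dPsi (upd (sample X m w) i s)) N).
- by apply: eq_integral => s _; rewrite /K updE.
- by move=> s; exact: cderiv_upd.
- move=> s; apply: continuous_comp; first exact: continuous_upd.
  exact: cdPsi.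
- by move=> s Ns; apply: (P0 _ i); rewrite updE.
Qed.

Lemma cutoff_scale n : 0 <= (n.+1%:R ^+ 2 : R)^-1 <= 1.
Proof.
rewrite invr_ge0 exprn_ge0//= invf_le1 ?exprn_gt0//.
by rewrite exprn_ege1// ler1n.
Qed.

Lemma norm_le_cutoff n k (x : 'rV[R]_m) (a : R) : `|a * cutoff n k x| <= `|a|.
Proof. by rewrite normrM ler_piMr// cutoff_norm. Qed.

Lemma gauss_ibp i g dg : continuous g -> continuous dg -> cderiv i g dg ->
  L1 P (fun w => X i w * g (sample X m w)) -> L1 P (fun w => dg (sample X m w)) ->
  Ex P (fun w => X i w * g (sample X m w)) = Ex P (fun w => dg (sample X m w)).
Proof.
move=> cg cdg dgg LXg Ldg.
(* The i-th partial derivative of [cutoff n 2]. Its product with g is at most 4 |x_i g|, which is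
   integrable, and tends to 0. *)
pose chi1 n (x : 'rV[R]_m) := - (2 * 2) * (x 0 i / n.+1%:R ^+ 2) * cutoff n 1 x.
pose Psi n x := g x * cutoff n 2 x.
pose dPsi n x := dg x * cutoff n 2 x + g x * chi1 n x.
have cchi1 n : continuous (chi1 n).
  apply: contM; last exact: cont_cutoff.
  apply: contZ; apply: contM; [exact: cont_coord|exact: cont_cst].
have E n := @gauss_ibp_compact i (Psi n) (dPsi n) n.+1%:R.
have {}E n : Ex P (fun w => dPsi n (sample X m w) - X i w * Psi n (sample X m w)) = 0.
  apply: (E n _ _ _ _).2.
  - by apply: contM => //; exact: cont_cutoff.
  - by apply: contD; apply: contM => //; exact: cont_cutoff.
  - by apply: cderivM => //; exact: cderiv_cutoff.
  - by move=> x j nx; rewrite /Psi /dPsi /chi1 !(cutoff0 _ nx) !mulr0 addr0.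
suff : Ex P (fun w => dPsi n (sample X m w) - X i w * Psi n (sample X m w)) @[n --> \oo] -->
    Ex P (fun w => dg (sample X m w) - X i w * g (sample X m w)).
  move=> cE; have : Ex P (fun w => dg (sample X m w) - X i w * g (sample X m w)) = 0.
    exact: cvg_const_eq E cE.
  by rewrite ExB// => /eqP; rewrite subr_eq0 => /eqP.
(* In the dominating function, 5 = 4 + 1: the derivative of the cutoff contributes 4 |X_i g| and the
   drift term |X_i g|. *)
apply: (Ex_cvg _ _ _ (L1D (L1_norm Ldg) (L1Z 5 (L1_norm LXg)))).2 => [n|w|n w].
- apply: measurable_funB; first by apply: measurable_sample; apply: contD; apply: contM => //; exact: cont_cutoff.
  apply: measurable_funM; first exact: measurable_funP.
  by apply: measurable_sample; apply: contM => //; exact: cont_cutoff.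
- set x := sample X m w; rewrite /dPsi /Psi.
  have -> : dg x - X i w * g x =
      dg x * 1 + g x * (- (2 * 2) * (x 0 i * 0) * 1) - X i w * (g x * 1) by ring.
  apply: cvgB; first apply: cvgD.
  + by apply: cvgM; [exact: cvg_cst|exact: cutoff_cvg].
  + apply: cvgM; first exact: cvg_cst.
    apply: cvgM; last exact: cutoff_cvg.
    apply: cvgM; first exact: cvg_cst.
    by apply: cvgM; [exact: cvg_cst|exact: cvg_invn2].
  + apply: cvgM; first exact: cvg_cst.
    by apply: cvgM; [exact: cvg_cst|exact: cutoff_cvg].
- set x := sample X m w; rewrite /dPsi /Psi /chi1 sampleE.
  rewrite (le_trans (ler_normB _ _))//.
  have /andP[s0 s1] := cutoff_scale n.
  have h1 : `|g x * (- (2 * 2) * (X i w / n.+1%:R ^+ 2) * cutoff n 1 x)| <= 4 * `|X i w * g x|.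
    rewrite mulrA (le_trans (norm_le_cutoff _ _ _ _))//.
    rewrite (_ : g x * _ = (X i w * g x) * (- 4 * (n.+1%:R ^+ 2)^-1)); last by ring.
    rewrite normrM mulrC ler_wpM2r// normrM normrN ger0_norm// ger0_norm//.
    by rewrite ler_piMr.
  have h2 := norm_le_cutoff n 2 x (dg x).
  have h3 : `|X i w * (g x * cutoff n 2 x)| <= `|X i w * g x|.
    by rewrite mulrA norm_le_cutoff.
  have := ler_normD (dg x * cutoff n 2 x) (g x * (- (2 * 2) * (X i w / n.+1%:R ^+ 2) * cutoff n 1 x)).
  lra.
Qed.

End gaussian_ibp.

(** * The Ornstein-Uhlenbeck operator on polynomials *)

Section ornstein_uhlenbeck_symmetry.
Context d (T : measurableType d) (R : realType) (P : probability T R).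
Variable X : nat -> {RV P >-> R}.
Hypothesis X_gauss : forall i, standard_gaussian (X i).
Hypothesis X_indep : mutually_independent X.

Lemma tame_X i : tame P (X i).
Proof. exact: gauss_tame. Qed.

Lemma L2_tame (Y Z : T -> R) : L2 P Y -> tame P Z -> L1 P (fun w => Y w * Z w).
Proof. by move=> LY tZ; apply: L2M => //; exact: tame_L2. Qed.

(* Nothing is known on the growth of [f1] and [f2]: [p] is cut off, so that the
   integrations by parts only involve compactly supported functions, and the
   cutoff is removed by dominated convergence. *)
Lemma ou_symmetry m (f p : 'rV[R]_m -> R) (f1 f2 p1 p2 : 'I_m -> 'rV[R]_m -> R) :
  continuous f -> (forall i, continuous (f1 i)) -> (forall i, continuous (f2 i)) ->
  continuous p -> (forall i, continuous (p1 i)) -> (forall i, continuous (p2 i)) ->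
  (forall i, cderiv i f (f1 i)) -> (forall i, cderiv i (f1 i) (f2 i)) ->
  (forall i, cderiv i p (p1 i)) -> (forall i, cderiv i (p1 i) (p2 i)) ->
  L2 P (fun w => f (sample X m w)) ->
  L2 P (fun w => \sum_i (f2 i (sample X m w) - X i w * f1 i (sample X m w))) ->
  tame P (fun w => p (sample X m w)) -> (forall i, tame P (fun w => p1 i (sample X m w))) ->
  (forall i, tame P (fun w => p2 i (sample X m w))) ->
  Ex P (fun w => (\sum_i (f2 i (sample X m w) - X i w * f1 i (sample X m w))) * p (sample X m w)) =
  Ex P (fun w => f (sample X m w) * \sum_i (p2 i (sample X m w) - X i w * p1 i (sample X m w))).
Proof.
move=> cf cf1 cf2 cp cp1 cp2 df df1 dp dp1 Lf LLf tp tp1 tp2.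
pose e n : R := (n.+1%:R ^+ 2)^-1.
(* The cut off polynomial with its first and second partial derivatives; exponent 3 leaves a
   continuous second derivative. *)
pose b n x := p x * cutoff n 3 x.
pose b1 n i x := p1 i x * cutoff n 3 x + p x * (- (2 * 3) * (x 0 i * e n) * cutoff n 2 x).
pose b2 n i (x : 'rV[R]_m) := p2 i x * cutoff n 3 x + p1 i x * (- 12 * (x 0 i * e n) * cutoff n 2 x)
  + p x * (- 6 * (e n * cutoff n 2 x) + 24 * ((x 0 i * e n) ^+ 2 * cutoff n 1 x)).
have cxe n i : continuous (fun x : 'rV[R]_m => x 0 i * e n).
  by apply: contM; [exact: cont_coord|exact: cont_cst].
have cb n : continuous (b n) by apply: contM => //; exact: cont_cutoff.
have cb1 n i : continuous (b1 n i).
  apply: contD; apply: contM => //; first exact: cont_cutoff.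
  by apply: contM; [exact: contZ|exact: cont_cutoff].
have cb2 n i : continuous (b2 n i).
  apply: contD; first apply: contD; apply: contM => //; first exact: cont_cutoff.
    by apply: contM; [exact: contZ|exact: cont_cutoff].
  apply: contD; apply: contZ; apply: contM; [exact: cont_cst|exact: cont_cutoff| |exact: cont_cutoff].
  exact: contX.
have db n i : cderiv i (b n) (b1 n i) by apply: cderivM => //; exact: cderiv_cutoff.
have db1 n i : cderiv i (b1 n i) (b2 n i).
  have dlin : cderiv i (fun x : 'rV[R]_m => - (2 * 3) * (x 0 i * e n)) (fun=> - 6 * e n).
    apply: cderiv_eq (cderivZ (- (2 * 3)) (cderivM (cderiv_coord i i) (cderiv_cst i (e n)))) => x.
    by rewrite eqxx /=; ring.
  apply: cderiv_eq (cderivD (cderivM (dp1 i) (cderiv_cutoff i n 1))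
    (cderivM (dp i) (cderivM dlin (cderiv_cutoff i n 0)))) => x.
  by rewrite /b2 -/(e n); ring.
have b0 n (x : 'rV[R]_m) j i : n.+1%:R <= `|x 0 j| -> [/\ b n x = 0, b1 n i x = 0 & b2 n i x = 0].
  by move=> nx; rewrite /b /b1 /b2 !(cutoff0 _ nx); split; ring.
(* The i-th summand of (L f) b - f (L b) equals (d_i - x_i)(b d_i f - f d_i b), because the mixed
   terms d_i f d_i b cancel; its expectation is therefore 0 by one integration by parts. *)
pose K n i w := (f2 i (sample X m w) - X i w * f1 i (sample X m w)) * b n (sample X m w) -
  f (sample X m w) * (b2 n i (sample X m w) - X i w * b1 n i (sample X m w)).
have LEK n i : L1 P (K n i) /\ Ex P (K n i) = 0.
  have KE w : K n i w = (f2 i (sample X m w) * b n (sample X m w) - f (sample X m w) * b2 n i (sample X m w))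
      - X i w * (f1 i (sample X m w) * b n (sample X m w) - f (sample X m w) * b1 n i (sample X m w)).
    by rewrite /K; ring.
  suff [LK EK] : L1 P (fun w => (f2 i (sample X m w) * b n (sample X m w) - f (sample X m w) * b2 n i (sample X m w))
      - X i w * (f1 i (sample X m w) * b n (sample X m w) - f (sample X m w) * b1 n i (sample X m w))) /\
    Ex P (fun w => (f2 i (sample X m w) * b n (sample X m w) - f (sample X m w) * b2 n i (sample X m w))
      - X i w * (f1 i (sample X m w) * b n (sample X m w) - f (sample X m w) * b1 n i (sample X m w))) = 0.
    by split; [apply: eq_L1 LK => w; rewrite KE|rewrite -EK; apply: eq_Ex].
  apply: (gauss_ibp_compact X_gauss X_indep (i := i)
    (Psi := fun x => f1 i x * b n x - f x * b1 n i x)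
    (dPsi := fun x => f2 i x * b n x - f x * b2 n i x) (N := n.+1%:R)).
  - by apply: contB; apply: contM.
  - by apply: contB; apply: contM.
  - apply: cderiv_eq (cderivB (cderivM (df1 i) (db n i)) (cderivM (df i) (db1 n i))) => x.
    by ring.
  - by move=> x j /b0 nx; have [-> -> ->] := nx i; rewrite !mulr0 subr0.
pose Lf_ w := \sum_i (f2 i (sample X m w) - X i w * f1 i (sample X m w)).
pose u n w := Lf_ w * b n (sample X m w) -
  f (sample X m w) * \sum_i (b2 n i (sample X m w) - X i w * b1 n i (sample X m w)).
have Eu n : Ex P (u n) = 0.
  transitivity (Ex P (fun w => \sum_i K n i w)).
    by apply: eq_Ex => w; rewrite /u mulr_suml mulr_sumr -sumrB.
  rewrite Ex_sum; last by move=> i _; exact: (LEK n i).1.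
  by rewrite big1// => i _; exact: (LEK n i).2.
(* This bound contains only f and L f, both in L^2, times tame factors. No individual derivative of
   f occurs, since every derivative has been moved to the cut off polynomial. *)
pose D w := `|Lf_ w * p (sample X m w)| + \sum_i `|f (sample X m w) *
  (`|p2 i (sample X m w)| + 12 * `|p1 i (sample X m w) * X i w| +
   `|p (sample X m w)| * (6 + 24 * X i w ^+ 2) +
   (`|X i w * p1 i (sample X m w)| + 6 * `|p (sample X m w) * X i w ^+ 2|))|.
have tnorm Y : tame P Y -> tame P (fun w => `|Y w|).
  move=> tY; apply: (tame_le _ tY) => [|w]; last by rewrite normr_id.
  by apply: measurableT_comp => //; exact: tY.1.
have LD : L1 P D.
  apply: L1D; first by apply: L1_norm; exact: L2_tame.
  apply: L1_sum => i _; apply: L1_norm; apply: L2_tame => //.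
  have tX := tame_X i.
  apply: tameD; first apply: tameD; first apply: tameD.
  - exact: tnorm.
  - by apply: tameZ; apply: tnorm; exact: tameM.
  - apply: tameM; first exact: tnorm.
    by apply: tameD; [exact: tame_cst|apply: tameZ; exact: tameX].
  - apply: tameD; first by apply: tnorm; exact: tameM.
    by apply: tameZ; apply: tnorm; apply: tameM => //; exact: tameX.
have : Ex P (u n) @[n --> \oo] --> Ex P (fun w => Lf_ w * p (sample X m w) -
    f (sample X m w) * \sum_i (p2 i (sample X m w) - X i w * p1 i (sample X m w))).
  apply: (Ex_cvg _ _ _ LD).2 => [n|w|n w].
  - apply: measurable_funB; apply: measurable_funM; [exact: LLf.1|exact: measurable_sample|exact: Lf.1|].
    apply: measurable_sum => i; apply: measurable_funB; first exact: measurable_sample.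
    by apply: measurable_funM; [exact: measurable_funP|exact: measurable_sample].
  - set x := sample X m w.
    have ce : e n @[n --> \oo] --> (0 : R) by exact: cvg_invn2.
    have cc k : cutoff n k x @[n --> \oo] --> (1 : R) by exact: cutoff_cvg.
    have cvgb : b n x @[n --> \oo] --> p x.
      by rewrite -[X in _ --> X]mulr1; apply: cvgM; [exact: cvg_cst|exact: cc].
    have cvgb1 i : b1 n i x @[n --> \oo] --> p1 i x.
      have -> : p1 i x = p1 i x * 1 + p x * (- (2 * 3) * (x 0 i * 0) * 1) by ring.
      apply: cvgD; (apply: cvgM; first exact: cvg_cst); first exact: cc.
      apply: cvgM; last exact: cc.
      by do 2 (apply: cvgM; first exact: cvg_cst).
    have cvgb2 i : b2 n i x @[n --> \oo] --> p2 i x.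
      have -> : p2 i x = p2 i x * 1 + p1 i x * (- 12 * (x 0 i * 0) * 1)
        + p x * (- 6 * (0 * 1) + 24 * ((x 0 i * 0 * (x 0 i * 0)) * 1)) by ring.
      have cxe0 : x 0 i * e n @[n --> \oo] --> x 0 i * 0 by apply: cvgM => //; exact: cvg_cst.
      apply: cvgD; first apply: cvgD; (apply: cvgM; first exact: cvg_cst); first exact: cc.
        apply: cvgM; last exact: cc.
        by apply: cvgM; first exact: cvg_cst.
      apply: cvgD; (apply: cvgM; first exact: cvg_cst); (apply: cvgM; last exact: cc); first exact: ce.
      by under eq_fun do rewrite expr2; apply: cvgM.
    apply: cvgB; first by apply: cvgM => //; exact: cvg_cst.
    apply: cvgM; first exact: cvg_cst.
    apply: cvg_sumr => i; apply: cvgB; first exact: cvgb2.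
    by apply: cvgM; [exact: cvg_cst|exact: cvgb1].
  - set x := sample X m w; rewrite /u /D (le_trans (ler_normB _ _))// lerD//.
      by rewrite /b mulrA norm_le_cutoff.
    rewrite mulr_sumr (le_trans (ler_norm_sum _ _ _))//; apply: ler_sum => i _.
    rewrite !normrM ler_wpM2l//; apply: le_trans (ler_norm _).
    have /andP[e0 e1] : 0 <= e n <= 1 by exact: cutoff_scale.
    have le_e (a : R) : `|a * e n| <= `|a| by rewrite normrM (ger0_norm e0) ler_piMr.
    have le_ce (c a : R) : 0 <= c -> `|- (c * (a * e n))| <= c * `|a|.
      by move=> c0; rewrite normrN normrM ger0_norm// ler_wpM2l.
    have c_ k : 0 <= cutoff n k x <= 1 by rewrite cutoff_ge0 cutoff_le1.
    have xi : x 0 i = X i w by exact: sampleE.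
    rewrite (le_trans (ler_normB _ _))//; apply: lerD.
      rewrite /b2 (le_trans (ler_normD _ _))// lerD//.
        rewrite (le_trans (ler_normD _ _))// lerD ?norm_le_cutoff//.
        rewrite mulrA (le_trans (norm_le_cutoff _ _ _ _))// xi.
        rewrite -normrM -/x (_ : p1 i x * (- 12 * (X i w * e n)) = - (12 * ((p1 i x * X i w) * e n))); last by ring.
        exact: le_ce.
      rewrite normrM ler_wpM2l// (le_trans (ler_normD _ _))// lerD//.
        rewrite mulrA (le_trans (norm_le_cutoff _ _ _ _))// (_ : -6 * e n = - (6 * e n)); last by ring.
        by rewrite normrN ger0_norm ?mulr_ge0// ler_piMr.
      rewrite mulrA (le_trans (norm_le_cutoff _ _ _ _))// normrM ger0_norm// ler_pM2l// xi.
      by rewrite ger0_norm ?sqr_ge0// exprMn ler_piMr ?sqr_ge0// expr2 mulr_ile1.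
    rewrite normrM /b1 xi (le_trans (ler_wpM2l _ (ler_normD _ _)))// mulrDr lerD//.
      by rewrite -!normrM mulrA norm_le_cutoff.
    rewrite -!normrM -/x.
    rewrite (_ : X i w * (p x * (- (2 * 3) * (X i w * e n) * cutoff n 2 x)) =
      - (6 * ((p x * (X i w * X i w)) * e n)) * cutoff n 2 x); last by ring.
    by rewrite (le_trans (norm_le_cutoff _ _ _ _))// le_ce.
move=> /(cvg_const_eq Eu); rewrite ExB; first by move=> /eqP; rewrite subr_eq0 => /eqP.
  exact: L2_tame.
apply: L2_tame => //; apply: tame_sum => i _; apply: tameB => //.
by apply: tameM => //; exact: tame_X.
Qed.

End ornstein_uhlenbeck_symmetry.

(** * Partial derivatives of functions of fewer variables and of monomials *)

Section smooth_cderiv.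
Context {R : realType}.

Lemma cderiv_partial m (i : 'I_m) (f : 'rV[R]_m -> R) :
  (forall x, derivable f x (delta_mx 0 i)) -> cderiv i f (partial i f).
Proof.
move=> df x.
have E : (fun h : R => h^-1 *: (f (upd x i (h *: 1 + x 0 i)) - f (upd x i (x 0 i)))) =
    (fun h : R => h^-1 *: (f (h *: delta_mx 0 i + x) - f x)).
  apply/funext => h; rewrite upd_id; congr (_ *: (f _ - _)).
  rewrite updD addrC; congr (_ *: _ + _).
  by rewrite /GRing.scale/= mulr1 addrK.
apply: DeriveDef; first by rewrite /derivable E; exact: df.
by rewrite /derive E.
Qed.

(** A smooth function and the monomial it is tested against may involve different numbers of
    variables; both are read in the larger dimension. *)
Definition restr k m (km : (k <= m)%N) (x : 'rV[R]_m) : 'rV[R]_k :=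
  \row_j x 0 (widen_ord km j).

Lemma cont_restr k m (km : (k <= m)%N) (f : 'rV[R]_k -> R) :
  continuous f -> continuous (fun x => f (restr km x)).
Proof.
move=> cf x.
apply: (@cvg_comp _ _ _ (restr km) f (nbhs x) (nbhs (restr km x)) _); last exact: cf.
apply: (@cvg_row R _ (nbhs x) _ k (fun y j => y 0 (widen_ord km j))) => j.
exact: cont_coord.
Qed.

Lemma cderiv_restr k m (km : (k <= m)%N) (f : 'rV[R]_k -> R) (f1 : 'I_k -> 'rV[R]_k -> R) :
  (forall i, cderiv i f (f1 i)) -> forall i : 'I_m,
  cderiv i (fun x => f (restr km x))
    (fun x => if insub (val i) is Some j then f1 j (restr km x) else 0).
Proof.
move=> df i x; case: insubP => [j _ ji|ik].
  have -> : x 0 i = restr km x 0 j by rewrite mxE; congr (x _ _); exact: val_inj.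
  apply: isd_ext (df j (restr km x)) => s; congr f; apply/rowP => l; rewrite !mxE.
  by rewrite -!(inj_eq val_inj) /= ji.
apply: isd_ext (isd_cst (f (restr km x)) (x 0 i)) => s; congr f; apply/rowP => l.
rewrite !mxE; case: eqP => // li; move: ik; rewrite -li /= ltn_ord.
by [].
Qed.

(** Multi-indices live on all of nat so as not to depend on the number of variables. At exponent 0
    the truncated predecessor is harmless: the derivative carries the factor [al i]. *)
Definition dec (al : nat -> nat) i : nat -> nat := fun j => if j == i then (al j).-1 else al j.

Lemma cont_mono m (al : nat -> nat) : continuous (fun x : 'rV[R]_m => \prod_(j < m) x 0 j ^+ al j).
Proof.
elim: (index_enum 'I_m) => [|j r IHr].
  by under eq_fun do rewrite big_nil; exact: cont_cst.
under eq_fun do rewrite big_cons.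
by apply: contM => //; apply: contX; exact: cont_coord.
Qed.

Lemma cderiv_mono m (al : nat -> nat) (i : 'I_m) :
  cderiv i (fun x : 'rV[R]_m => \prod_(j < m) x 0 j ^+ al j)
    (fun x => (al i)%:R * \prod_(j < m) x 0 j ^+ dec al i j).
Proof.
move=> x; pose c := \prod_(j < m | j != i) x 0 j ^+ al j.
have E s : s ^+ al i * c = \prod_(j < m) upd x i s 0 j ^+ al j.
  rewrite [RHS](bigD1 i)//= updE; congr (_ * _); apply: eq_bigr => j ji.
  by rewrite mxE (negbTE ji).
apply: isd_ext E _; apply: isd_eq (isdM (isdX (al i) (is_derive_id _ (1 : R))) (isd_cst c _)) _.
rewrite mulr0 addr0 mulr1 -mulrA; congr (_ * _).
rewrite [RHS](bigD1 i)//= /dec eqxx; congr (_ * _); apply: eq_bigr => j ji.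
by rewrite (inj_eq val_inj) (negbTE ji).
Qed.

End smooth_cderiv.

Section chaos_moments.
Context d (T : measurableType d) (R : realType) (P : probability T R).
Variable X : nat -> {RV P >-> R}.
Hypothesis X_gauss : forall i, standard_gaussian (X i).
Hypothesis X_indep : mutually_independent X.
Implicit Types (F G Z : T -> R) (al : nat -> nat).

Lemma Lfun_L2 F : F \in Lfun P 2%:E -> L2 P F.
Proof.
move=> LF; split; last exact: Lfun2_integrable_sqr.
by move: (sub_Lfun_mfun LF); rewrite inE.
Qed.

Lemma L2_cvg_Ex (u : nat -> T -> R) F : (forall n, L2 P (u n)) -> L2 P F ->
  L2_cvg P u F -> Ex P (fun w => (u n w - F w) ^+ 2) @[n --> \oo] --> 0.
Proof.
move=> Lu LF; rewrite /L2_cvg => uF.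
have E n : ('N[P]_2%:E[EFin \o (u n \- F)%R])%E =
    (Num.sqrt (Ex P (fun w => (u n w - F w) ^+ 2)))%:E.
  rewrite unlock /Lnorm -powR12_sqrt; last by apply: Ex_ge0 => w; exact: sqr_ge0.
  rewrite -poweR_EFin -EFin_Ex; last exact: (L2B (Lu n) LF).2.
  congr (_ `^ _)%E; apply: eq_integral => w _ /=.
  by rewrite powR_mulrn// real_normK// num_real.
pose s n := Num.sqrt (Ex P (fun w => (u n w - F w) ^+ 2)).
have s0 : s n @[n --> \oo] --> 0.
  by apply: (@fine_cvg R _ _ _ (fun n => (s n)%:E)); under eq_fun do rewrite -E; exact: uF.
have -> : (fun n => Ex P (fun w => (u n w - F w) ^+ 2)) = (fun n => s n * s n).
  by apply/funext => n; rewrite -expr2 sqr_sqrtr//; apply: Ex_ge0 => w; exact: sqr_ge0.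
by rewrite -[X in _ --> X](mulr0 0); exact: cvgM.
Qed.

Lemma Ex_L2_cvg (u : nat -> T -> R) F Z : (forall n, L2 P (u n)) -> L2 P F -> L2 P Z ->
  Ex P (fun w => (u n w - F w) ^+ 2) @[n --> \oo] --> 0 ->
  Ex P (fun w => u n w * Z w) @[n --> \oo] --> Ex P (fun w => F w * Z w).
Proof.
move=> Lu LF LZ uF; apply/subr_cvg0.
have E n : Ex P (fun w => u n w * Z w) - Ex P (fun w => F w * Z w) =
    Ex P (fun w => (u n w - F w) * Z w).
  by rewrite -ExB; [apply: eq_Ex => w; rewrite mulrBl|exact: L2M|exact: L2M].
under eq_fun do rewrite E; apply/norm_cvg0P.
pose c := Ex P (fun w => Z w ^+ 2).
have s0 : Num.sqrt (Ex P (fun w => (u n w - F w) ^+ 2) * c) @[n --> \oo] --> 0.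
  rewrite -[X in _ --> X]sqrtr0 -[X in _ --> Num.sqrt X](mul0r c).
  apply: (cvg_comp _ Num.sqrt); last exact: sqrt_continuous.
  by apply: cvgM => //; exact: cvg_cst.
apply: (squeeze_cvgr _ (cvg_cst 0) s0); apply: nearW => n.
rewrite normr_ge0/= -sqrtr_sqr ler_wsqrtr//; apply: Ex_CauchySchwarz => //; exact: L2B.
Qed.

Definition monoX m al w := \prod_(j < m) X j w ^+ al j.

Lemma tame_mono m al : tame P (monoX m al).
Proof. by apply: tame_prod => i _; apply: tameX; exact: tame_X. Qed.

(* [L] applied to the monomial [monoX m al]. *)
Definition ou_mono m al w := \sum_(i < m)
  ((al i)%:R * ((dec al i i)%:R * monoX m (dec (dec al i) i) w) -
   X i w * ((al i)%:R * monoX m (dec al i) w)).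

Lemma tame_ou_mono m al : tame P (ou_mono m al).
Proof.
apply: tame_sum => i _; apply: tameB.
  by do 2 apply: tameZ; exact: tame_mono.
by apply: tameM; [exact: tame_X|apply: tameZ; exact: tame_mono].
Qed.

Lemma eq_monoX m al be : (forall i, (i < m)%N -> al i = be i) -> monoX m al =1 monoX m be.
Proof. by move=> ab w; apply: eq_bigr => i _; rewrite ab. Qed.

Definition trunc m al : nat -> nat := fun i => if (i < m)%N then al i else 0%N.

Lemma monoX_widen m M al : (m <= M)%N -> monoX M (trunc m al) =1 monoX m al.
Proof.
move=> mM w; rewrite /monoX (big_ord_widen M (fun j => X j w ^+ al j) mM) [RHS]big_mkcond/=.
by apply: eq_bigr => i _; rewrite /trunc; case: ifP.
Qed.

Lemma dec_trunc m al i : dec (trunc m al) i =1 trunc m (dec al i).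
Proof. by move=> j; rewrite /dec /trunc; case: ifP; case: ifP. Qed.

Lemma ou_mono_widen m M al : (m <= M)%N -> ou_mono M (trunc m al) =1 ou_mono m al.
Proof.
move=> mM w; rewrite /ou_mono (big_ord_widen M (fun i => (al i)%:R *
   ((dec al i i)%:R * monoX m (dec (dec al i) i) w) -
   X i w * ((al i)%:R * monoX m (dec al i) w)) mM) [RHS]big_mkcond/=.
apply: eq_bigr => i _; rewrite [trunc m al i]/trunc; case: ifP => im; last first.
  by rewrite !mul0r mulr0 subr0.
rewrite [dec (trunc m al) i i]dec_trunc [trunc m (dec al i) i]/trunc im.
rewrite -(monoX_widen (dec al i) mM) -(monoX_widen (dec (dec al i) i) mM).
congr (_ * (_ * _) - _ * (_ * _)); apply: eq_monoX => j _; last by rewrite dec_trunc.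
by rewrite /dec /trunc; case: (_ == _); case: (_ < _)%N.
Qed.

Lemma ou_smooth_mono F G m al : ou_smooth_graph X F G ->
  Ex P (fun w => G w * monoX m al w) = Ex P (fun w => F w * ou_mono m al w).
Proof.
move=> [/Lfun_L2 LF [/Lfun_L2 LG [k [f [sf FE GE]]]]].
pose M := maxn k m; have kM : (k <= M)%N by exact: leq_maxl.
have mM : (m <= M)%N by exact: leq_maxr.
pose f1 i := partial i f; pose f2 i := partial i (partial i f).
have cf : continuous f by have [] := sf [::].
have cf1 i : continuous (f1 i) by have [] := sf [:: i].
have cf2 i : continuous (f2 i) by have [] := sf [:: i; i].
have df i : cderiv i f (f1 i) by apply: cderiv_partial => x; have [_] := sf [::]; exact.
have df1 i : cderiv i (f1 i) (f2 i) by apply: cderiv_partial => x; have [_] := sf [:: i]; exact.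
pose ff x := f (restr kM x).
pose ff1 (i : 'I_M) x := if insub (val i) is Some j then f1 j (restr kM x) else 0.
pose ff2 (i : 'I_M) x := if insub (val i) is Some j then f2 j (restr kM x) else 0.
have restr_sample w : restr kM (sample X M w) = sample X k w.
  by apply/rowP => j; rewrite !mxE.
have GM w : \sum_i (ff2 i (sample X M w) - X i w * ff1 i (sample X M w)) = G w.
  rewrite GE /= /ou_diff -sumrB.
  pose h (i : nat) := if insub i is Some j then f2 j (sample X k w) - X i w * f1 j (sample X k w) else 0.
  transitivity (\sum_(i < M) h i).
    apply: eq_bigr => i _; rewrite /ff1 /ff2 /h; case: insubP => [j _ _|_].
      by rewrite restr_sample.
    by rewrite mulr0 subr0.
  transitivity (\sum_(i < k) h i); last first.
    by apply: eq_bigr => i _; rewrite /h valK sampleE.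
  rewrite (big_ord_widen M h kM) [RHS]big_mkcond/=; apply: eq_bigr => i _.
  by rewrite /h; case: ifP => //; case: insubP => // j ->.
pose q (x : 'rV[R]_M) := \prod_(j < M) x 0 j ^+ trunc m al j.
pose q1 (i : 'I_M) (x : 'rV[R]_M) := (trunc m al i)%:R * \prod_(j < M) x 0 j ^+ dec (trunc m al) i j.
pose q2 (i : 'I_M) (x : 'rV[R]_M) := (trunc m al i)%:R * ((dec (trunc m al) i i)%:R *
  \prod_(j < M) x 0 j ^+ dec (dec (trunc m al) i) i j).
have mono_sample (be : nat -> nat) w : \prod_(j < M) sample X M w 0 j ^+ be j = monoX M be w.
  by apply: eq_bigr => j _; rewrite sampleE.
have := @ou_symmetry _ _ _ P X X_gauss X_indep M ff q ff1 ff2 q1 q2.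
rewrite (_ : (fun w => _ * q (sample X M w)) = (fun w => G w * monoX m al w)); last first.
  by apply/funext => w; rewrite GM /q mono_sample monoX_widen.
rewrite (_ : (fun w => ff _ * _) = (fun w => F w * ou_mono m al w)); last first.
  apply/funext => w; rewrite /ff restr_sample FE /= -(ou_mono_widen al mM).
  by congr (_ * _); apply: eq_bigr => i _; rewrite /q1 /q2 !mono_sample.
apply.
- exact: cont_restr.
- move=> i; rewrite /ff1; case: insubP => [j _ _|_]; [exact: cont_restr|exact: cont_cst].
- move=> i; rewrite /ff2; case: insubP => [j _ _|_]; [exact: cont_restr|exact: cont_cst].
- exact: cont_mono.
- by move=> i; apply: contZ; exact: cont_mono.
- by move=> i; do 2 apply: contZ; exact: cont_mono.
- by move=> i; exact: cderiv_restr.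
- move=> i; rewrite /ff1 /ff2; case: insubP => [j _ ji|_]; last exact: cderiv_cst.
  apply: cderiv_eq (cderiv_restr kM (f1 := fun l x => partial l (f1 j) x) _ i) => [x|l].
    rewrite -ji valK.
    by [].
  by apply: cderiv_partial => x; have [_] := sf [:: j]; exact.
- by move=> i; exact: cderiv_mono.
- by move=> i; apply: cderivZ; exact: cderiv_mono.
- by apply: eq_L2 LF => w; rewrite FE /= /ff restr_sample.
- by apply: eq_L2 LG => w; rewrite GM.
- by apply: eq_tame (tame_mono M (trunc m al)) => w; rewrite /q mono_sample.
- by move=> i; apply: tameZ; apply: eq_tame (tame_mono M (dec (trunc m al) i)) => w; rewrite mono_sample.
- by move=> i; do 2 apply: tameZ; apply: eq_tame (tame_mono M (dec (dec (trunc m al) i) i)) => w; rewrite mono_sample.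
Qed.

(** The monomial and its image under [L] both lie in L^2, so the two sides are L^2-continuous and
    the identity passes to the closure of the graph. *)
Lemma ou_graph_mono F G m al : ou_graph X F G ->
  Ex P (fun w => G w * monoX m al w) = Ex P (fun w => F w * ou_mono m al w).
Proof.
move=> [/Lfun_L2 LF [/Lfun_L2 LG [u [v [uv uF vG]]]]].
have Lu n : L2 P (u n) by apply: Lfun_L2; case: (uv n).
have Lv n : L2 P (v n) by apply: Lfun_L2; case: (uv n) => _ [].
have c1 := Ex_L2_cvg Lu LF (tame_L2 (tame_ou_mono m al)) (L2_cvg_Ex Lu LF uF).
have c2 := Ex_L2_cvg Lv LG (tame_L2 (tame_mono m al)) (L2_cvg_Ex Lv LG vG).
have E : (fun n => Ex P (fun w => v n w * monoX m al w)) =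
    (fun n => Ex P (fun w => u n w * ou_mono m al w)).
  by apply/funext => n; exact: ou_smooth_mono.
rewrite E in c2; exact: (cvg_unique _ c2 c1).
Qed.

End chaos_moments.

(** * Quadratic forms in Gaussian variables *)

Section quadratic_forms.
Context d (T : measurableType d) (R : realType) (P : probability T R).
Variable X : nat -> {RV P >-> R}.
Hypothesis X_gauss : forall i, standard_gaussian (X i).
Hypothesis X_indep : mutually_independent X.
Variable m : nat.
Implicit Types (A B C : 'M[R]_m) (x : 'rV[R]_m).

Definition lin A i x : R := \sum_j A i j * x 0 j.

Definition quad A x : R := \sum_i x 0 i * lin A i x.

Lemma cont_lin A i : continuous (lin A i).
Proof. by apply: cont_sum => j _; apply: contZ; exact: cont_coord. Qed.

Lemma cont_quad A : continuous (quad A).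
Proof.
by apply: cont_sum => i _; apply: contM; [exact: cont_coord|exact: cont_lin].
Qed.

Lemma cderiv_lin A i k : cderiv i (lin A k) (fun=> A k i).
Proof.
apply: cderiv_eq (@cderiv_sum _ _ i _ (index_enum 'I_m) xpredT (fun j x => A k j * x 0 j) _
  (fun j _ => cderivZ (A k j) (cderiv_coord i j))) => x.
rewrite (bigD1 i)//= eqxx mulr1 big1 ?addr0// => j ji.
by rewrite (negbTE ji) mulr0.
Qed.

Lemma cderiv_quad A i : A^T = A -> cderiv i (quad A) (fun x => 2 * lin A i x).
Proof.
move=> sA; apply: cderiv_eq (@cderiv_sum _ _ i _ (index_enum 'I_m) xpredT
  (fun j x => x 0 j * lin A j x) _
  (fun j _ => cderivM (cderiv_coord i j) (cderiv_lin A i j))) => x.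
rewrite big_split/= (bigD1 i)//= eqxx mul1r big1 ?addr0; last first.
  by move=> j ji; rewrite (negbTE ji) mul0r.
rewrite mulr_natl mulr2n; congr (_ + _); apply: eq_bigr => j _.
by rewrite mulrC; congr (_ * _); rewrite -{1}sA mxE.
Qed.

Lemma tame_coord i : tame P (fun w => sample X m w 0 i).
Proof. by apply: eq_tame (tame_X X_gauss i) => w; rewrite sampleE. Qed.

Lemma tame_lin A i : tame P (fun w => lin A i (sample X m w)).
Proof. by apply: tame_sum => j _; apply: tameZ; exact: tame_coord. Qed.

Lemma tame_quad A : tame P (fun w => quad A (sample X m w)).
Proof. by apply: tame_sum => i _; apply: tameM; [exact: tame_coord|exact: tame_lin]. Qed.

Lemma quad_trmul A C x : \sum_i lin C i x * lin A i x = quad (C^T *m A) x.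
Proof.
transitivity (\sum_i \sum_j x 0 j * (C i j * lin A i x)).
  apply: eq_bigr => i _; rewrite mulr_suml; apply: eq_bigr => j _.
  by rewrite mulrAC mulrC mulrA.
rewrite exchange_big; apply: eq_bigr => j _; rewrite -mulr_sumr; congr (_ * _).
transitivity (\sum_i \sum_k C i j * A i k * x 0 k).
  by apply: eq_bigr => i _; rewrite mulr_sumr; apply: eq_bigr => k _; rewrite mulrA.
rewrite exchange_big; apply: eq_bigr => k _; rewrite -mulr_suml; congr (_ * _).
by rewrite mxE; apply: eq_bigr => i _; rewrite mxE.
Qed.

(* Gaussian integration by parts against [x^T C x], along the gradient of the
   quadratic form [A]. *)
Lemma quad_ibp A C (phi phi' : R -> R) : A^T = A ->
  (forall s, is_derive s (1 : R) phi (phi' s)) -> continuous phi' ->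
  tame P (fun w => phi (quad A (sample X m w))) ->
  tame P (fun w => phi' (quad A (sample X m w))) ->
  Ex P (fun w => quad C (sample X m w) * phi (quad A (sample X m w))) =
  \tr C * Ex P (fun w => phi (quad A (sample X m w))) +
  2 * Ex P (fun w => quad (C^T *m A) (sample X m w) * phi' (quad A (sample X m w))).
Proof.
move=> sA dphi cphi' tphi tphi'.
have cphi : continuous phi by move=> s; exact: isd_continuous (dphi s).
pose g i x := lin C i x * phi (quad A x).
pose dg i x := C i i * phi (quad A x) + lin C i x * (phi' (quad A x) * (2 * lin A i x)).
have tg i : tame P (fun w => g i (sample X m w)) by apply: tameM => //; exact: tame_lin.
have tdg i : tame P (fun w => dg i (sample X m w)).
  apply: tameD; first exact: tameZ.
  apply: tameM; first exact: tame_lin.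
  by apply: tameM => //; apply: tameZ; exact: tame_lin.
have tXg (i : 'I_m) : tame P (fun w => X i w * g i (sample X m w)).
  by apply: tameM => //; exact: tame_X.
transitivity (Ex P (fun w => \sum_(i < m) X i w * g i (sample X m w))).
  apply: eq_Ex => w; rewrite /quad mulr_suml; apply: eq_bigr => i _.
  by rewrite sampleE -mulrA.
rewrite Ex_sum; last by move=> i _; exact: tame_L1.
transitivity (\sum_i Ex P (fun w => dg i (sample X m w))).
  apply: eq_bigr => i _; apply: (gauss_ibp X_gauss X_indep).
  - by apply: contM; [exact: cont_lin|apply: (cont_comp (phi := phi)) => //; exact: cont_quad].
  - apply: contD; first by apply: contZ; apply: (cont_comp (phi := phi)) => //; exact: cont_quad.
    apply: contM; first exact: cont_lin.
    apply: contM; first by apply: (cont_comp (phi := phi')) => //; exact: cont_quad.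
    by apply: contZ; exact: cont_lin.
  - apply: cderivM; first exact: cderiv_lin.
    by apply: (cderiv_comp (phi := phi)) => //; exact: cderiv_quad.
  - exact: tame_L1.
  - exact: tame_L1.
rewrite -Ex_sum; last by move=> i _; exact: tame_L1.
rewrite -ExZ; last exact: tame_L1.
rewrite -ExZ; last by apply: tame_L1; apply: tameM => //; exact: tame_quad.
rewrite -ExD; last 2 first.
- by apply: L1Z; exact: tame_L1.
- by apply: L1Z; apply: tame_L1; apply: tameM => //; exact: tame_quad.
apply: eq_Ex => w; rewrite -quad_trmul big_split/= -mulr_suml; congr (_ + _).
rewrite mulr_suml mulr_sumr; apply: eq_bigr => i _; ring.
Qed.

Definition cquad A w : R := quad A (sample X m w) - \tr A.

Lemma tame_cquad A : tame P (cquad A).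
Proof. by apply: tameB; [exact: tame_quad|exact: tame_cst]. Qed.

(** The centering of C absorbs the trace term of [quad_ibp]. For k = 0 the factor k kills the
    right-hand side, whatever the truncated power is. *)
Lemma cquad_ibp A C k : A^T = A ->
  Ex P (fun w => cquad C w * cquad A w ^+ k) =
  (2 * k%:R) * Ex P (fun w => quad (C^T *m A) (sample X m w) * cquad A w ^+ k.-1).
Proof.
move=> sA.
have dphi s : is_derive s (1 : R) (fun s => (s - \tr A) ^+ k) (k%:R * (s - \tr A) ^+ k.-1).
  apply: isd_eq (isdX k (isdB (is_derive_id s (1 : R)) (isd_cst (\tr A) s))) _.
  by rewrite subr0 mulr1.
have ck : tame P (fun w => cquad A w ^+ k) by apply: tameX; exact: tame_cquad.
have cdphi : continuous (fun s => k%:R * (s - \tr A) ^+ k.-1).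
  move=> s; have [] := isdM (isd_cst k%:R s) (isdX k.-1 (isdB (is_derive_id s (1 : R)) (isd_cst (\tr A) s))).
  by move=> /derivable1_diffP/differentiable_continuous.
have := @quad_ibp A C _ _ sA dphi cdphi ck _.
move=> /(_ (tameZ k%:R (tameX k.-1 (tame_cquad A)))) E.
transitivity (Ex P (fun w => quad C (sample X m w) * cquad A w ^+ k) -
    \tr C * Ex P (fun w => cquad A w ^+ k)).
  rewrite -ExZ; last exact: tame_L1.
  rewrite -ExB; first by apply: eq_Ex => w; rewrite /cquad mulrBl.
    by apply: tame_L1; apply: tameM => //; exact: tame_quad.
  by apply: L1Z; exact: tame_L1.
rewrite E addrC addKr -mulrA; congr (_ * _); rewrite -ExZ.
  by apply: eq_Ex => w; rewrite mulrCA.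
by apply: tame_L1; apply: tameM; [exact: tame_quad|apply: tameX; exact: tame_cquad].
Qed.

Lemma Ex_cquad A : Ex P (cquad A) = 0.
Proof.
have := @cquad_ibp 0 A 0 (trmx0 _ _ _); rewrite mulr0 mul0r => <-.
by apply: eq_Ex => w; rewrite expr0 mulr1.
Qed.

Lemma Ex_quad A : Ex P (fun w => quad A (sample X m w)) = \tr A.
Proof.
apply/eqP; rewrite -subr_eq0 -(Ex_cst P (\tr A)) -ExB.
- by apply/eqP; exact: Ex_cquad.
- exact: tame_L1 (tame_quad A).
- exact: L1_cst.
Qed.

Lemma Ex_cquad2 A C : A^T = A ->
  Ex P (fun w => cquad C w * cquad A w) = 2 * \tr (C^T *m A).
Proof.
move=> sA; transitivity (Ex P (fun w => cquad C w * cquad A w ^+ 1)) => //.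
rewrite cquad_ibp// mulr1; congr (2 * _); rewrite -Ex_quad.
by apply: eq_Ex => w; rewrite expr0 mulr1.
Qed.

(** Successive integrations by parts replace A by A^2, A^3 and A^4, with factors 6, 4 and 2, whose
    product is 48. The trace of A^2 split off at the first stage meets E q^2 = 2 tr(A^2) and gives
    12 tr(A^2)^2. *)
Lemma Ex_cquad4 A : A^T = A -> Ex P (fun w => cquad A w ^+ 4) =
  12 * (\tr (A *m A)) ^+ 2 + 48 * \tr (A *m A *m (A *m A)).
Proof.
move=> sA.
have sAA : (A *m A)^T = A *m A by rewrite trmx_mul sA.
have quadE C Y : tame P Y -> Ex P (fun w => quad C (sample X m w) * Y w) =
    \tr C * Ex P Y + Ex P (fun w => cquad C w * Y w).
  move=> tY; rewrite -ExZ; last exact: tame_L1.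
  rewrite -ExD; [|by apply: L1Z; exact: tame_L1|by apply: tame_L1; apply: tameM => //; exact: tame_cquad].
  by apply: eq_Ex => w; rewrite /cquad mulrBl subrKC.
have tA k : tame P (fun w => cquad A w ^+ k) by apply: tameX; exact: tame_cquad.
transitivity (Ex P (fun w => cquad A w * cquad A w ^+ 3)).
  by apply: eq_Ex => w; rewrite -exprS.
rewrite cquad_ibp// sA quadE// cquad_ibp// sAA quadE//=.
have -> : Ex P (fun w => cquad A w ^+ 2) = 2 * \tr (A *m A).
  by rewrite -{2}sA -Ex_cquad2//; apply: eq_Ex => w; rewrite expr2.
have -> : Ex P (fun w => cquad A w ^+ 1) = 0 by rewrite -(Ex_cquad A).
have -> : Ex P (fun w => cquad (A *m A *m A) w * cquad A w ^+ 1) =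
    2 * \tr (A *m A *m (A *m A)).
  transitivity (Ex P (fun w => cquad (A *m A *m A) w * cquad A w)) => //.
  by rewrite Ex_cquad2// !trmx_mul !sA !mulmxA.
by ring.
Qed.

End quadratic_forms.

Section characteristic_function.
Context d (T : measurableType d) (R : realType) (P : probability T R).
Implicit Types Y : T -> R.

(** Differentiation under the integral sign: |Y| dominates the derivative in t, uniformly in t. *)
Lemma isd_Ex (f f' : R -> R) Y (c : R) t : L1 P Y ->
  (forall s, is_derive s (1 : R) f (f' s)) -> (forall s, `|f s| <= c) -> (forall s, `|f' s| <= 1) ->
  is_derive t (1 : R) (fun t => Ex P (fun w => f (t * Y w))) (Ex P (fun w => Y w * f' (t * Y w))).
Proof.
move=> LY df fc f'1; have mY := L1_measurable LY.
have cf : continuous f by move=> s; exact: isd_continuous (df s).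
have dfY (x : R) w : is_derive x (1 : R) (fun x => f (x * Y w)) (Y w * f' (x * Y w)).
  apply: isd_eq (isd_comp (df _) (isdM (is_derive_id x (1 : R)) (isd_cst (Y w) x))) _.
  by rewrite mul1r mulr0 addr0 mulrC.
have tI : `]t - 1, t + 1[%classic t by rewrite /= in_itv/= ltrBlDr ltrDl ltr01.
have Lf x : L1 P (fun w => f (x * Y w)).
  apply: L1_le (L1_cst P c) => [|w]; last exact: fc.
  apply: (measurableT_comp (continuous_measurable_fun cf)).
  exact: measurable_funM.
have i1 (x : R) : `]t - 1, t + 1[%classic x -> P.-integrable setT (EFin \o (fun w => f (x * Y w))).
  by move=> _; exact: Lf.
have i2 (x : R) w : `]t - 1, t + 1[%classic x -> [set: T] w -> derivable ((fun x : R => f (x * Y w)) : R -> R) x 1.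
  by move=> _ _; case: (dfY x w).
have dE (x : R) w : partial1of2 (fun x w => f (x * Y w)) x w = Y w * f' (x * Y w).
  by rewrite partial1of2E; case: (dfY x w).
have i3 (x : R) w : `]t - 1, t + 1[%classic x -> [set: T] w ->
    `|partial1of2 (fun x w => f (x * Y w)) x w| <= `|Y w|.
  by move=> _ _; rewrite dE normrM ler_piMr.
have G0 w : 0 <= `|Y w| by [].
have LG := L1_norm LY.
have := @differentiation_under_integral R d T P (fun x w => f (x * Y w)) setT measurableT
  t _ _ tI i1 i2 (fun w => `|Y w|) G0 LG i3.
have D := @derivable_under_integral R d T P (fun x w => f (x * Y w)) setT measurableT
  t _ _ tI i1 i2 (fun w => `|Y w|) G0 LG i3.
rewrite derive1E => E; apply: DeriveDef; first exact: D.
by rewrite /Ex E; apply: eq_Rintegral => w _; rewrite dE.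
Qed.

End characteristic_function.

(** * Resolvent and trace inequalities *)

Section matrix_bounds.
Context {R : realType} (m : nat).
Implicit Types (A B S : 'M[R]_m).

Definition nsq n (v : 'rV[R]_n) : R := \sum_j v 0 j ^+ 2.

Lemma nsqE n (v : 'rV[R]_n) : nsq v = (v *m v^T) 0 0.
Proof. by rewrite mxE; apply: eq_bigr => j _; rewrite mxE expr2. Qed.

Lemma nsq_ge0 n (v : 'rV[R]_n) : 0 <= nsq v.
Proof. by apply: sumr_ge0 => j _; exact: sqr_ge0. Qed.

Lemma nsq_eq0 n (v : 'rV[R]_n) : nsq v = 0 -> v = 0.
Proof.
move=> /eqP; rewrite psumr_eq0; last by move=> j _; exact: sqr_ge0.
move=> /allP v0; apply/rowP => j; rewrite mxE; apply/eqP.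
by have := v0 j (mem_index_enum j); rewrite /= expf_eq0.
Qed.

Lemma mxtrace_rows S : \tr (S *m S^T) = \sum_i nsq (row i S).
Proof.
by apply: eq_bigr => i _; rewrite mxE; apply: eq_bigr => j _; rewrite !mxE expr2.
Qed.

Lemma mxtrace_sqr_ge0 S : 0 <= \tr (S *m S^T).
Proof. by rewrite mxtrace_rows; apply: sumr_ge0 => i _; exact: nsq_ge0. Qed.

(** The operator bound is applied to each row of S; this replaces the monotonicity of the trace on
    positive matrices. *)
Lemma mxtrace_sqr_le S A (M : R) : (forall v, nsq (v *m A) <= M * nsq v) ->
  \tr (S *m A *m (S *m A)^T) <= M * \tr (S *m S^T).
Proof.
move=> AM; rewrite !mxtrace_rows mulr_sumr; apply: ler_sum => i _.
by rewrite row_mul; exact: AM.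
Qed.

Section resolvent.
Variables (A : 'M[R]_m) (r : R).
Hypotheses (sA : A^T = A) (r0 : 0 <= r).

Let N : 'M[R]_m := 1%:M + r *: (A *m A).

Definition resolvent := invmx N.

(** If v N = 0, pairing with v gives |v|^2 + r |v A|^2 = 0, hence v = 0. *)
Lemma resolvent_unit : N \in unitmx.
Proof.
rewrite -row_free_unit -kermx_eq0; apply/eqP/row_matrixP => i; rewrite row0.
set v := row i _; apply: nsq_eq0.
have vN : v *m N = 0 by rewrite -row_mul mulmx_ker row0.
have : nsq v + r * nsq (v *m A) = 0.
  rewrite !nsqE trmx_mul sA mulmxA -[v *m A *m A]mulmxA.
  have -> : (v *m v^T) 0 0 + r * (v *m (A *m A) *m v^T) 0 0 = (v *m N *m v^T) 0 0.
    by rewrite mulmxDr mulmxDl mulmx1 -scalemxAr -scalemxAl !mxE.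
  by rewrite vN mul0mx mxE.
have := nsq_ge0 v; have := mulr_ge0 r0 (nsq_ge0 (v *m A)); lra.
Qed.

Lemma resolventC : resolvent *m A = A *m resolvent.
Proof.
have AN : A *m N = N *m A by rewrite mulmxDr mulmxDl mulmx1 mul1mx -scalemxAr -scalemxAl mulmxA.
rewrite -[LHS]mulmx1 -(mulmxV resolvent_unit) mulmxA -(mulmxA resolvent A) AN mulmxA.
by rewrite mulVmx ?resolvent_unit// mul1mx.
Qed.

Lemma trmx_resolvent : resolvent^T = resolvent.
Proof. by rewrite trmx_inv linearD/= linearZ/= trmx_mul sA trmx1. Qed.

Lemma resolventE : resolvent + r *: (resolvent *m A *m A) = 1%:M.
Proof.
by rewrite -(mulVmx resolvent_unit) mulmxDr mulmx1 -scalemxAr mulmxA.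
Qed.

(** On eigenvalues this is lambda^2 <= (1 + r M) lambda^2 / (1 + r lambda^2) for lambda^2 <= M. The
    proof expands A^2 = A D A + r A D A A^2 and bounds the trace of the second term. *)
Lemma resolvent_trace (M : R) : (forall v, nsq (v *m A) <= M * nsq v) ->
  \tr (A *m A) <= (1 + r * M) * \tr (A *m resolvent *m A).
Proof.
move=> AM; set D := resolvent.
have DC : D *m A = A *m D := resolventC.
have sD : D^T = D := trmx_resolvent.
have DE : D + r *: (D *m A *m A) = 1%:M := resolventE.
pose S := D *m A; pose S2 := D *m A *m A.
have CAD n (Y : 'M[R]_(n, m)) : Y *m A *m D = Y *m D *m A by rewrite -!mulmxA DC.
have sS : S^T = S by rewrite /S trmx_mul sA sD DC.
have sS2 : S2^T = S2 by rewrite /S2 -/S trmx_mul sS sA /S mulmxA -DC.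
(* Writing A D A as a nonnegative combination of Gram matrices is what lets [mxtrace_sqr_le] bound
   the trace of its product with A^2. *)
have ADA : A *m D *m A = S *m S^T + r *: (S2 *m S2^T).
  rewrite sS /S2 [(D *m A *m A)^T]trmx_mul [(D *m A)^T]sS sA /S.
  have -> : A *m D *m A = A *m D *m (D + r *: (D *m A *m A)) *m A.
    by rewrite DE mulmx1.
  rewrite mulmxDr mulmxDl -scalemxAr -scalemxAl -DC !mulmxA; congr (_ + r *: _).
  by rewrite !CAD.
have AA : A *m A = A *m D *m A + r *: (A *m D *m A *m (A *m A)).
  rewrite -{1}[A]mulmx1 -DE mulmxDr mulmxDl -scalemxAr -scalemxAl; congr (_ + r *: _).
  by rewrite !mulmxA.
have b1 : \tr (A *m D *m A *m (A *m A)) <= M * \tr (A *m D *m A).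
  rewrite ADA mulmxDl !mxtraceD mulrDr -scalemxAl !mxtraceZ lerD//.
    have := mxtrace_sqr_le S AM; congr (_ <= _).
    by rewrite trmx_mul sA sS -mulmxA mxtrace_mulC [RHS]mxtrace_mulC !mulmxA.
  rewrite mulrCA ler_wpM2l//.
  have := mxtrace_sqr_le S2 AM; congr (_ <= _).
  by rewrite trmx_mul sA sS2 -mulmxA mxtrace_mulC [RHS]mxtrace_mulC !mulmxA.
by rewrite {1}AA mxtraceD mxtraceZ mulrDl mul1r lerD2l -mulrA ler_wpM2l.
Qed.

End resolvent.

End matrix_bounds.

(** * Decay of the characteristic function of a single quadratic form *)

Section quadratic_decay.
Context d (T : measurableType d) (R : realType) (P : probability T R).
Variable X : nat -> {RV P >-> R}.
Hypothesis X_gauss : forall i, standard_gaussian (X i).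
Hypothesis X_indep : mutually_independent X.
Variables (m : nat) (A : 'M[R]_m).
Hypothesis sA : A^T = A.

Local Notation q := (cquad X A).

Let cf t := Ex P (fun w => cos (t * q w)).
Let sf t := Ex P (fun w => sin (t * q w)).
Let U t C := Ex P (fun w => quad C (sample X m w) * cos (t * q w)).
Let V t C := Ex P (fun w => quad C (sample X m w) * sin (t * q w)).

Lemma measurable_cquad : measurable_fun setT q.
Proof. exact: (tame_cquad X_gauss A).1. Qed.

Lemma tame_cosq t : tame P (fun w => cos (t * q w)).
Proof.
apply: (@tame_bounded _ _ _ _ _ 1) => [|w]; last exact: cos_max.
apply: (measurableT_comp (continuous_measurable_fun (@continuous_cos R))).
by apply: measurable_funM => //; exact: measurable_cquad.
Qed.

Lemma tame_sinq t : tame P (fun w => sin (t * q w)).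
Proof.
apply: (@tame_bounded _ _ _ _ _ 1) => [|w]; last exact: sin_max.
apply: (measurableT_comp (continuous_measurable_fun (@continuous_sin R))).
by apply: measurable_funM => //; exact: measurable_cquad.
Qed.

Let dlin t s : is_derive s (1 : R) (fun s => t * (s - \tr A)) t.
Proof.
by apply: isd_eq (isdZ t (isdB (is_derive_id s (1 : R)) (isd_cst (\tr A) s))) _; rewrite subr0 mulr1.
Qed.

Lemma U_ibp t C : U t C = \tr C * cf t - 2 * t * V t (C^T *m A).
Proof.
have dphi s : is_derive s (1 : R) (fun s => cos (t * (s - \tr A))) (- t * sin (t * (s - \tr A))).
  by apply: isd_eq (isd_comp (is_derive_cos _) (dlin t s)) _; ring.
have cphi' : continuous (fun s => - t * sin (t * (s - \tr A))).
  by move=> s; exact: isd_continuous (isdZ (- t) (isd_comp (is_derive_sin _) (dlin t s))).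
rewrite /U (quad_ibp X_gauss X_indep C sA dphi cphi' (tame_cosq t) (tameZ (- t) (tame_sinq t))).
congr (_ + _); rewrite -mulrA -mulrN; congr (_ * _); rewrite -mulNr /V -ExZ.
  by apply: eq_Ex => w; rewrite mulrCA.
by apply: tame_L1; apply: tameM; [exact: tame_quad|exact: tame_sinq].
Qed.

Lemma V_ibp t C : V t C = \tr C * sf t + 2 * t * U t (C^T *m A).
Proof.
have dphi s : is_derive s (1 : R) (fun s => sin (t * (s - \tr A))) (t * cos (t * (s - \tr A))).
  by apply: isd_eq (isd_comp (is_derive_sin _) (dlin t s)) _; ring.
have cphi' : continuous (fun s => t * cos (t * (s - \tr A))).
  by move=> s; exact: isd_continuous (isdZ t (isd_comp (is_derive_cos _) (dlin t s))).
rewrite /V (quad_ibp X_gauss X_indep C sA dphi cphi' (tame_sinq t) (tameZ t (tame_cosq t))).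
congr (_ + _); rewrite -mulrA; congr (_ * _); rewrite /U -ExZ.
  by apply: eq_Ex => w; rewrite mulrCA.
by apply: tame_L1; apply: tameM; [exact: tame_quad|exact: tame_cosq].
Qed.

Lemma quad_lin (B C : 'M[R]_m) (r : R) x : quad (B + r *: C) x = quad B x + r * quad C x.
Proof.
rewrite /quad mulr_sumr -big_split; apply: eq_bigr => i _ /=.
rewrite mulrCA -mulrDr; congr (_ * _); rewrite /lin mulr_sumr -big_split; apply: eq_bigr => j _ /=.
by rewrite !mxE mulrDl mulrA.
Qed.

Lemma Ex_quad_lin (Y : T -> R) B C r : tame P Y ->
  Ex P (fun w => quad (B + r *: C) (sample X m w) * Y w) =
  Ex P (fun w => quad B (sample X m w) * Y w) + r * Ex P (fun w => quad C (sample X m w) * Y w).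
Proof.
move=> tY; have tq D : tame P (fun w => quad D (sample X m w) * Y w).
  by apply: tameM => //; exact: tame_quad.
rewrite -ExZ ?tame_L1// -ExD; [|exact: tame_L1|by apply: L1Z; exact: tame_L1].
by apply: eq_Ex => w; rewrite quad_lin mulrDl mulrA.
Qed.

(** Here 4 t^2 = (2 t)^2: passing from cos to sin and back takes two integrations by parts, each
    with a factor 2 t. *)
Let D t := resolvent A (4 * t ^+ 2).

Let r0 (t : R) : 0 <= 4 * t ^+ 2.
Proof. by rewrite mulr_ge0// sqr_ge0. Qed.

Let DC t : D t *m A = A *m D t.
Proof. exact: resolventC. Qed.

Let AD_sym t : (A *m D t)^T = A *m D t.
Proof. by rewrite trmx_mul (trmx_resolvent _ sA) sA DC. Qed.

Let ADA_sym t : (A *m D t *m A)^T = A *m D t *m A.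
Proof. by rewrite trmx_mul AD_sym sA -[RHS]mulmxA DC. Qed.

Let AE t : A *m D t + (4 * t ^+ 2) *: (A *m D t *m A *m A) = A.
Proof. by rewrite -!mulmxA scalemxAr -mulmxDr [D t *m _]mulmxA resolventE// mulmx1. Qed.

(** Split A as A D + 4 t^2 A D A^2. Two integrations by parts of the first piece reproduce the
    second one with coefficient - 4 t^2, so the unknown terms cancel and only traces remain. *)
Lemma U_resolvent t :
  U t A = \tr (A *m D t) * cf t - 2 * t * (\tr (A *m D t *m A) * sf t).
Proof.
rewrite -{1}(AE t) /U Ex_quad_lin; last exact: tame_cosq.
rewrite -!/(U t _) U_ibp AD_sym V_ibp ADA_sym; ring.
Qed.

Lemma V_resolvent t :
  V t A = \tr (A *m D t) * sf t + 2 * t * (\tr (A *m D t *m A) * cf t).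
Proof.
rewrite -{1}(AE t) /V Ex_quad_lin; last exact: tame_sinq.
rewrite -!/(V t _) V_ibp AD_sym U_ibp ADA_sym; ring.
Qed.

Let Lq : L1 P q.
Proof. by apply: tame_L1; exact: tame_cquad. Qed.

Lemma isd_cf t : is_derive t (1 : R) cf (- (V t A - \tr A * sf t)).
Proof.
apply: isd_eq (isd_Ex (f := cos) (f' := fun s => - sin s) (c := 1) t Lq _ _ _) _.
- exact: cos_max.
- by move=> s; rewrite normrN; exact: sin_max.
- rewrite /V /sf -ExZ; last by apply: tame_L1; exact: tame_sinq.
  rewrite -ExB; last 2 first.
  + by apply: tame_L1; apply: tameM; [exact: tame_quad|exact: tame_sinq].
  + by apply: L1Z; apply: tame_L1; exact: tame_sinq.
  rewrite -ExN; last first.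
    apply: L1B; last by apply: L1Z; apply: tame_L1; exact: tame_sinq.
    by apply: tame_L1; apply: tameM; [exact: tame_quad|exact: tame_sinq].
  by apply: eq_Ex => w; rewrite mulrN -mulrBl.
Qed.

Lemma isd_sf t : is_derive t (1 : R) sf (U t A - \tr A * cf t).
Proof.
apply: isd_eq (isd_Ex (f := sin) (f' := cos) (c := 1) t Lq _ _ _) _.
- exact: sin_max.
- exact: cos_max.
- rewrite /U /cf -ExZ; last by apply: tame_L1; exact: tame_cosq.
  rewrite -ExB; last 2 first.
  + by apply: tame_L1; apply: tameM; [exact: tame_quad|exact: tame_cosq].
  + by apply: L1Z; apply: tame_L1; exact: tame_cosq.
  by apply: eq_Ex => w; rewrite -mulrBl.
Qed.

(* The squared modulus [h] of the characteristic function solves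
   [h' = - 4 t tr (A (1 + 4 t^2 A^2)^-1 A) h]. *)
Lemma isd_modulus t : is_derive t (1 : R) (fun t => cf t ^+ 2 + sf t ^+ 2)
  (- (4 * t * \tr (A *m D t *m A)) * (cf t ^+ 2 + sf t ^+ 2)).
Proof.
apply: isd_eq (isdD (isdX 2 (isd_cf t)) (isdX 2 (isd_sf t))) _.
rewrite U_resolvent V_resolvent /=; ring.
Qed.

Lemma quadratic_decay (M : R) p : 0 <= M -> (forall v, nsq (v *m A) <= M * nsq v) ->
  2 * p%:R * M <= \tr (A *m A) ->
  (Ex P (fun w => cos (q w)) ^+ 2 + Ex P (fun w => sin (q w)) ^+ 2) * (1 + 4 * M) ^+ p <= 1.
Proof.
move=> M0 AM pM.
pose h t := cf t ^+ 2 + sf t ^+ 2.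
pose b t := 1 + 4 * t ^+ 2 * M.
pose g t := h t * b t ^+ p.
have b1 t : 0 <= b t by rewrite /b addr_ge0// mulr_ge0.
have h0 t : 0 <= h t by rewrite addr_ge0// sqr_ge0.
pose tau t := \tr (A *m D t *m A).
pose g' t := 4 * t * h t * (2 * p%:R * M * b t ^+ p.-1 - tau t * b t ^+ p).
have db t : is_derive t (1 : R) b (8 * t * M).
  apply: isd_eq (isdD (isd_cst 1 t) (isdM (isdZ 4 (isdX 2 (is_derive_id t (1 : R)))) (isd_cst M t))) _.
  by rewrite /=; ring.
have dg t : is_derive t (1 : R) g (g' t).
  apply: isd_eq (isdM (isd_modulus t) (isdX p (db t))) _.
  by rewrite /g' -/(h t) -/(tau t); ring.
have g'0 t : 0 <= t -> g' t <= 0.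
  move=> t0; apply: mulr_ge0_le0; first by rewrite !mulr_ge0.
  (* For p = 0 the power [p.-1] does not drop, so no factor [b t] can be split off; it then suffices
     that tr(A D A) >= 0, which [resolvent_trace] gives too. *)
  rewrite subr_le0; case: p pM @g @g' dg => [|p] pM g g' dg.
    rewrite mulr0 !mul0r expr0 mulr1.
    rewrite /tau; have := resolvent_trace sA (r0 t) AM; rewrite -/(D t).
    have : 0 <= \tr (A *m A) by rewrite -{2}sA mxtrace_sqr_ge0.
    have : 0 < 1 + 4 * t ^+ 2 * M by rewrite ltr_pwDl// mulr_ge0.
    move=> b0 tr0 /(le_trans tr0); rewrite pmulr_rge0//.
  rewrite /= exprS mulrA [tau t * _]mulrC ler_wpM2r ?exprn_ge0//.
  exact: le_trans pM (resolvent_trace sA (r0 t) AM).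
have g1 : g 1 <= g 0.
  apply: (@ler0_derive1_nincr R g 0 1) => //.
  - move=> x; rewrite in_itv/= => /andP[/ltW x0 _].
    by rewrite derive1E; case: (dg x) => _ ->; exact: g'0.
  - by apply: continuous_subspaceT => x; exact: isd_continuous (dg x).
have g0E : g 0 = 1.
  rewrite /g /h /b /cf /sf expr0n /= mulr0 mul0r addr0 expr1n mulr1.
  have -> : Ex P (fun w => cos (0 * q w)) = 1.
    by rewrite -[RHS](Ex_cst P); apply: eq_Ex => w; rewrite mul0r cos0.
  have -> : Ex P (fun w => sin (0 * q w)) = 0.
    by rewrite -[RHS](Ex_cst P); apply: eq_Ex => w; rewrite mul0r sin0.
  by rewrite expr1n expr0n addr0.
move: g1; rewrite g0E /g /h /b /cf /sf expr1n mulr1; congr (_ <= _).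
by congr ((_ ^+ 2 + _ ^+ 2) * _); apply: eq_Ex => w; rewrite mul1r.
Qed.

End quadratic_decay.

(** * Projection of the second chaos *)

Section second_chaos.
Context d (T : measurableType d) (R : realType) (P : probability T R).
Variable X : nat -> {RV P >-> R}.
Hypothesis X_gauss : forall i, standard_gaussian (X i).
Hypothesis X_indep : mutually_independent X.
Implicit Types (F Y p q : T -> R) (al be : nat -> nat).

Lemma chaos_L2 k F : wiener_chaos X k F -> L2 P F.
Proof. by move=> [G [/Lfun_L2]]. Qed.

(* Monomials as weak test functions for [L F = - 2 F]. *)
Definition weak_eigen m Y :=
  forall al, Ex P (fun w => Y w * ou_mono X m al w) = - 2 * Ex P (fun w => Y w * monoX X m al w).

Lemma chaos_weak_eigen m F : wiener_chaos X 2 F -> weak_eigen m F.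
Proof.
move=> [G FG GF] al; rewrite -(ou_graph_mono X_gauss X_indep m al FG).
have LF : L2 P F by case: FG => /Lfun_L2.
have LG : L2 P G by case: FG => _ [/Lfun_L2].
have LFm : L1 P (fun w => F w * monoX X m al w) by apply: L2_tame => //; exact: tame_mono.
have LGm : L1 P (fun w => G w * monoX X m al w) by apply: L2_tame => //; exact: tame_mono.
rewrite -ExZ// /Ex /Rintegral; congr fine; apply: ae_eq_integral => //.
- by apply/measurable_EFinP; exact: L1_measurable LGm.
- by apply/measurable_EFinP; apply: measurable_funM => //; exact: L1_measurable LFm.
- apply: filterS GF => w GF _; congr (_%:E).
  by rewrite mulrA; congr (_ * _); lra.
Qed.

Lemma weak_eigenB m Y F : L2 P Y -> L2 P F -> weak_eigen m Y -> weak_eigen m F ->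
  weak_eigen m (fun w => Y w - F w).
Proof.
move=> LY LF eY eF al.
have LM (V Z : T -> R) : L2 P V -> tame P Z -> L1 P (fun w => V w * Z w) by exact: L2_tame.
transitivity (Ex P (fun w => Y w * ou_mono X m al w) - Ex P (fun w => F w * ou_mono X m al w)).
  rewrite -ExB; [|apply: LM => //; exact: tame_ou_mono|apply: LM => //; exact: tame_ou_mono].
  by apply: eq_Ex => w; rewrite mulrBl.
rewrite eY eF -mulrBr; congr (_ * _).
rewrite -ExB; [|apply: LM => //; exact: tame_mono|apply: LM => //; exact: tame_mono].
by apply: eq_Ex => w; rewrite mulrBl.
Qed.

Lemma mono_dec m al (i : 'I_m) w : (0 < al i)%N ->
  X i w * monoX X m (dec al i) w = monoX X m al w.
Proof.
move=> ai; rewrite /monoX (bigD1 i)//= [RHS](bigD1 i)//= mulrA /dec eqxx -exprS prednK//.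
by congr (_ * _); apply: eq_bigr => j ji; rewrite (inj_eq val_inj) (negbTE ji).
Qed.

(** Each drift term X_i d_i multiplies the monomial by its i-th exponent, so the diagonal part of
    [L] is minus the total degree. *)
Lemma Ex_ou_mono m al Y : L2 P Y -> Ex P (fun w => Y w * ou_mono X m al w) =
  \sum_(i < m) (al i)%:R * ((dec al i i)%:R * Ex P (fun w => Y w * monoX X m (dec (dec al i) i) w))
  - (\sum_(i < m) al i)%:R * Ex P (fun w => Y w * monoX X m al w).
Proof.
move=> LY; have LM be : L1 P (fun w => Y w * monoX X m be w).
  by apply: L2_tame => //; exact: tame_mono.
have -> : (\sum_(i < m) al i)%:R * Ex P (fun w => Y w * monoX X m al w) =
    \sum_(i < m) (al i)%:R * Ex P (fun w => Y w * monoX X m al w).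
  by rewrite natr_sum mulr_suml.
rewrite -sumrB (eq_bigr (fun i : 'I_m => Ex P (fun w =>
   (al i)%:R * ((dec al i i)%:R * (Y w * monoX X m (dec (dec al i) i) w)) -
   (al i)%:R * (Y w * monoX X m al w)))); last first.
  by move=> i _; rewrite -!ExZ// ?ExB//; do ?apply: L1Z.
rewrite -Ex_sum; last by move=> i _; apply: L1B; do ?apply: L1Z.
apply: eq_Ex => w; rewrite mulr_sumr; apply: eq_bigr => i _.
rewrite mulrBr; congr (_ - _); first by rewrite mulrCA; congr (_ * _); rewrite mulrCA.
have [->|ai] := posnP (al i); first by rewrite !mul0r !mulr0.
by rewrite (mulrCA (X i w)) mono_dec// mulrCA.
Qed.

Lemma sum_dec m al (i : 'I_m) : (0 < al i)%N ->
  (\sum_(j < m) dec al i j).+1 = (\sum_(j < m) al j)%N.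
Proof.
move=> ai; rewrite (bigD1 i)//= [RHS](bigD1 i)//= /dec eqxx -addSn prednK//.
by congr addn; apply: eq_bigr => j ji; rewrite (inj_eq val_inj) (negbTE ji).
Qed.

Lemma sum_pos_ex m al k : (\sum_(j < m) al j)%N = k.+1 -> exists i : 'I_m, (0 < al i)%N.
Proof.
move=> H; apply: contrapT => /forallNP h; move: H; rewrite big1// => i _.
by apply/eqP; rewrite -leqn0 leqNgt; apply/negP; exact: h.
Qed.

(* [L] lowers the degree by 2 up to the eigenvalue [- |al|], and [|al| = 2] is the
   only degree at which this eigenvalue is [- 2]. *)
Lemma weak_eigen_orth m Y : L2 P Y -> weak_eigen m Y ->
  (forall i j : 'I_m, Ex P (fun w => Y w * (X i w * X j w)) = 0) ->
  forall al, Ex P (fun w => Y w * monoX X m al w) = 0.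
Proof.
move=> LY eY Y2 al.
have [k] := ubnP (\sum_(i < m) al i)%N; elim: k => // k IHk in al *; rewrite ltnS => alk.
have [al2|al2] := eqVneq (\sum_(i < m) al i)%N 2.
  have [i ai] := sum_pos_ex al2; have := sum_dec ai; rewrite al2 => -[d1].
  have [j aj] := sum_pos_ex d1; have := sum_dec aj; rewrite d1 => -[/eqP d0].
  rewrite -[RHS](Y2 i j); apply: eq_Ex => w; rewrite -(mono_dec _ ai) -(mono_dec _ aj).
  congr (_ * (_ * _)); rewrite /monoX big1 ?mulr1// => l _.
  by move: d0; rewrite sum_nat_eq0 => /forallP/(_ l)/eqP ->.
(* In degrees 0 and 1 every second derivative carries a zero factor, so orthogonality to these
   monomials starts the induction without a separate case. *)
have := eY al; rewrite Ex_ou_mono// big1 => [|i _]; last first.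
  have [->|ai] := posnP (al i); first by rewrite mul0r.
  have [->|bi] := posnP (dec al i i); first by rewrite mul0r mulr0.
  rewrite IHk ?mulr0//; apply: leq_trans alk.
  by rewrite -(sum_dec ai) -(sum_dec bi).
rewrite sub0r => /eqP; rewrite -subr_eq0 mulNr opprK addrC -mulrBl mulf_eq0 => /orP[|/eqP//].
by rewrite subr_eq0 eqr_nat eq_sym (negbTE al2).
Qed.

(** The Laplacian of x^T A x is 2 tr A and the drift doubles the form, so [L] maps the centered form
    to - 2 times itself; symmetry then moves [L] to the monomial. *)
Lemma cquad_weak_eigen m (A : 'M[R]_m) : A^T = A -> weak_eigen m (cquad X A).
Proof.
move=> sA al.
pose f x := quad A x - \tr A.
pose q1 (i : 'I_m) (x : 'rV[R]_m) := (al i)%:R * \prod_(j < m) x 0 j ^+ dec al i j.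
pose q2 (i : 'I_m) (x : 'rV[R]_m) := (al i)%:R * ((dec al i i)%:R *
  \prod_(j < m) x 0 j ^+ dec (dec al i) i j).
have mono_sample (be : nat -> nat) w : \prod_(j < m) sample X m w 0 j ^+ be j = monoX X m be w.
  by apply: eq_bigr => j _; rewrite sampleE.
have GE w : \sum_(i < m) (2 * A i i - X i w * (2 * lin A i (sample X m w))) = - 2 * cquad X A w.
  rewrite sumrB -mulr_sumr /cquad /quad mulrBr !mulNr opprK addrC; congr (- _ + _).
  by rewrite mulr_sumr; apply: eq_bigr => i _; rewrite sampleE mulrCA.
have tc : tame P (cquad X A) := tame_cquad X_gauss A.
have := @ou_symmetry _ _ _ P X X_gauss X_indep m f (fun x => \prod_(j < m) x 0 j ^+ al j)
  (fun i x => 2 * lin A i x) (fun i _ => 2 * A i i) q1 q2.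
rewrite (_ : (fun w => _ * _) = (fun w => - 2 * (cquad X A w * monoX X m al w))); last first.
  by apply/funext => w; rewrite GE mono_sample mulrA.
rewrite (_ : (fun w => f _ * _) = (fun w => cquad X A w * ou_mono X m al w)); last first.
  apply/funext => w; congr (_ * _); apply: eq_bigr => i _.
  by rewrite /q1 /q2 !mono_sample.
rewrite ExZ; last by apply: tame_L1; apply: tameM => //; exact: tame_mono.
move=> H; apply/esym; apply: H.
- by apply: contB; [exact: cont_quad|exact: cont_cst].
- by move=> i; apply: contZ; exact: cont_lin.
- by move=> i; exact: cont_cst.
- exact: cont_mono.
- by move=> i; apply: contZ; exact: cont_mono.
- by move=> i; do 2 apply: contZ; exact: cont_mono.
- move=> i; apply: cderiv_eq (cderivB (cderiv_quad i sA) (cderiv_cst i (\tr A))) => x.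
  by rewrite subr0.
- by move=> i; apply: cderivZ; exact: cderiv_lin.
- by move=> i; exact: cderiv_mono.
- by move=> i; apply: cderivZ; exact: cderiv_mono.
- exact: tame_L2.
- by apply: eq_L2 (tame_L2 (tameZ (- 2) tc)) => w; rewrite GE.
- by apply: eq_tame (tame_mono X_gauss m al) => w; rewrite mono_sample.
- by move=> i; apply: tameZ; apply: eq_tame (tame_mono X_gauss m (dec al i)) => w; rewrite mono_sample.
- by move=> i; do 2 apply: tameZ; apply: eq_tame (tame_mono X_gauss m (dec (dec al i) i)) => w; rewrite mono_sample.
Qed.

(* Matrix of the projection of [F] on the quadratic polynomials in
   [X 0, ..., X (m - 1)], when [F] is centered. *)
Definition coefmx m F : 'M[R]_m := \matrix_(i, j) (Ex P (fun w => F w * (X i w * X j w)) / 2).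

Lemma trmx_coefmx m F : (coefmx m F)^T = coefmx m F.
Proof.
by apply/matrixP => i j; rewrite !mxE; congr (_ / _); apply: eq_Ex => w; rewrite (mulrC (X i w)).
Qed.

(** X_i X_j is the quadratic form of an elementary matrix, so [Ex_cquad2] reads off one entry of A.
    The factor 2 is the origin of the division by 2 in [coefmx]. *)
Lemma Ex_cquad_XX m (A : 'M[R]_m) (i j : 'I_m) : A^T = A ->
  Ex P (fun w => cquad X A w * (X i w * X j w)) = 2 * A i j.
Proof.
move=> sA; have tc : tame P (cquad X A) := tame_cquad X_gauss A.
have tXX : tame P (fun w => X i w * X j w) by apply: tameM; exact: tame_X.
have qE w : quad (delta_mx i j) (sample X m w) = X i w * X j w.
  rewrite /quad (bigD1 i)//= big1 ?addr0 => [|k ki].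
    rewrite sampleE; congr (_ * _); rewrite /lin (bigD1 j)//= big1 ?addr0 => [|l lj].
      by rewrite mxE !eqxx mul1r sampleE.
    by rewrite mxE (negbTE lj) andbF mul0r.
  rewrite /lin big1 ?mulr0// => l _.
  by rewrite mxE (negbTE ki) mul0r.
transitivity (Ex P (fun w => cquad X (delta_mx i j) w * cquad X A w)).
  transitivity (Ex P (fun w => cquad X A w * (X i w * X j w)) -
      \tr (delta_mx i j : 'M[R]_m) * Ex P (cquad X A)).
    by rewrite Ex_cquad// mulr0 subr0.
  rewrite -ExZ; last exact: tame_L1.
  rewrite -ExB; [|by apply: tame_L1; exact: tameM|by apply: L1Z; exact: tame_L1].
  by apply: eq_Ex => w; rewrite /cquad qE; ring.
rewrite Ex_cquad2//; congr (_ * _).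
rewrite trmx_delta /mxtrace (bigD1 j)//= big1 ?addr0 => [|k kj].
  rewrite mxE (bigD1 i)//= big1 ?addr0 => [|l li]; first by rewrite mxE !eqxx mul1r.
  by rewrite mxE (negbTE li) andbF mul0r.
by rewrite mxE big1// => l _; rewrite mxE (negbTE kj) mul0r.
Qed.

Lemma chaos_orth m F : wiener_chaos X 2 F -> forall al,
  Ex P (fun w => (F w - cquad X (coefmx m F) w) * monoX X m al w) = 0.
Proof.
move=> cF; have LF := chaos_L2 cF; have sA := trmx_coefmx m F.
have Lc : L2 P (cquad X (coefmx m F)) by apply: tame_L2; exact: tame_cquad.
apply: weak_eigen_orth; first exact: L2B.
  by apply: weak_eigenB => //; [exact: chaos_weak_eigen|exact: cquad_weak_eigen].
move=> i j; have tXX : tame P (fun w => X i w * X j w) by apply: tameM; exact: tame_X.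
transitivity (Ex P (fun w => F w * (X i w * X j w)) - Ex P (fun w => cquad X (coefmx m F) w * (X i w * X j w))).
  rewrite -ExB; [|exact: L2_tame|exact: L2_tame].
  by apply: eq_Ex => w; rewrite mulrBl.
by rewrite Ex_cquad_XX// mxE mulrC divfK ?subrr.
Qed.

Definition pol m p := exists s : seq (R * (nat -> nat)),
  p =1 fun w => \sum_(c <- s) c.1 * monoX X m c.2 w.

Lemma eq_pol m p q : p =1 q -> pol m p -> pol m q.
Proof. by move=> /funext ->. Qed.

Lemma pol_mono m al : pol m (monoX X m al).
Proof. by exists [:: (1, al)] => w; rewrite big_seq1 mul1r. Qed.

Lemma polD m p q : pol m p -> pol m q -> pol m (fun w => p w + q w).
Proof. by move=> [s ps] [r qr]; exists (s ++ r) => w; rewrite big_cat ps qr. Qed.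

Lemma polZ m a p : pol m p -> pol m (fun w => a * p w).
Proof.
move=> [s ps]; exists [seq (a * c.1, c.2) | c <- s] => w.
by rewrite big_map ps mulr_sumr; apply: eq_bigr => c _; rewrite mulrA.
Qed.

Lemma pol0 m : pol m (fun=> 0).
Proof. by exists [::] => w; rewrite big_nil. Qed.

Lemma pol_sum m I (s : seq I) (F : I -> T -> R) : (forall i, pol m (F i)) ->
  pol m (fun w => \sum_(i <- s) F i w).
Proof.
move=> pF; elim: s => [|i s IHs].
  by apply: eq_pol (pol0 m) => w; rewrite big_nil.
by apply: eq_pol (polD (pF i) IHs) => w; rewrite big_cons.
Qed.

Lemma monoM m al be w : monoX X m al w * monoX X m be w = monoX X m (fun i => al i + be i)%N w.
Proof. by rewrite /monoX -big_split; apply: eq_bigr => i _; rewrite exprD. Qed.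

Lemma polM m p q : pol m p -> pol m q -> pol m (fun w => p w * q w).
Proof.
move=> [s ps] [r qr].
apply: (@eq_pol _ (fun w => \sum_(c <- s) \sum_(b <- r) (c.1 * b.1) * monoX X m (fun i => c.2 i + b.2 i)%N w)).
  move=> w; rewrite ps qr mulr_suml; apply: eq_bigr => c _; rewrite mulr_sumr.
  by apply: eq_bigr => b _; rewrite -monoM mulrACA.
by apply: pol_sum => c; apply: pol_sum => b; apply: polZ; exact: pol_mono.
Qed.

Lemma pol_cst m c : pol m (fun=> c).
Proof.
apply: eq_pol (polZ c (pol_mono m (fun=> 0%N))) => w.
by rewrite /monoX big1 ?mulr1.
Qed.

Lemma polX m k p : pol m p -> pol m (fun w => p w ^+ k).
Proof.
move=> pp; elim: k => [|k IHk]; first exact: pol_cst.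
by apply: eq_pol (polM pp IHk) => w; rewrite exprS.
Qed.

Lemma pol_coord m i : (i < m)%N -> pol m (X i).
Proof.
move=> im; apply: eq_pol (pol_mono m (fun j => (j == i : nat))) => w.
rewrite /monoX (bigD1 (Ordinal im))//= eqxx expr1 big1 ?mulr1// => j.
by rewrite -(inj_eq val_inj) /= => /negbTE ->.
Qed.

Lemma pol_widen m M p : (m <= M)%N -> pol m p -> pol M p.
Proof.
move=> mM [s ps]; exists [seq (c.1, trunc m c.2) | c <- s] => w.
by rewrite big_map ps; apply: eq_bigr => c _; rewrite /= monoX_widen.
Qed.

Lemma tame_pol m p : pol m p -> tame P p.
Proof.
move=> [s ps]; apply: (@eq_tame _ _ _ _ (fun w => \sum_(c <- s) c.1 * monoX X m c.2 w)).
  by move=> w; rewrite ps.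
by apply: tame_sum => c _; apply: tameZ; exact: tame_mono.
Qed.

Lemma pol_cquad m (A : 'M[R]_m) : pol m (cquad X A).
Proof.
apply: (@eq_pol _ (fun w => (\sum_(i < m) X i w * (\sum_(j < m) A i j * X j w)) + (- \tr A))).
  move=> w; congr (_ - _); apply: eq_bigr => i _; rewrite sampleE; congr (_ * _).
  by apply: eq_bigr => j _; rewrite sampleE.
apply: polD; last exact: pol_cst.
apply: pol_sum => i; apply: polM; first exact: pol_coord.
by apply: pol_sum => j; apply: polZ; exact: pol_coord.
Qed.

Lemma chaos_orth_pol m F p : wiener_chaos X 2 F -> pol m p ->
  Ex P (fun w => (F w - cquad X (coefmx m F) w) * p w) = 0.
Proof.
move=> cF [s ps].
have LH : L2 P (fun w => F w - cquad X (coefmx m F) w).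
  by apply: L2B; [exact: chaos_L2 cF|apply: tame_L2; exact: tame_cquad].
transitivity (Ex P (fun w => \sum_(c <- s) c.1 * ((F w - cquad X (coefmx m F) w) * monoX X m c.2 w))).
  by apply: eq_Ex => w; rewrite ps mulr_sumr; apply: eq_bigr => c _; rewrite mulrCA.
have LM al : L1 P (fun w => (F w - cquad X (coefmx m F) w) * monoX X m al w).
  by apply: L2_tame => //; exact: tame_mono.
rewrite Ex_sum; last by move=> c _; exact: L1Z.
by rewrite big1// => c _; rewrite ExZ// chaos_orth// mulr0.
Qed.

End second_chaos.

(** * Density of the polynomials *)

Lemma cvg_norm_le {R : realType} (u : nat -> R) (l c : R) :
  u n @[n --> \oo] --> l -> (forall n, `|u n| <= c) -> `|l| <= c.
Proof.
move=> ul uc; have nl : `|u n| @[n --> \oo] --> `|l| by exact: cvg_norm.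
rewrite -(cvg_lim _ nl)//; apply: limr_le; first by apply: cvgP nl.
by apply: nearW.
Qed.

Section density.
Context d (T : measurableType d) (R : realType) (P : probability T R).
Variable X : nat -> {RV P >-> R}.
Hypothesis X_gauss : forall i, standard_gaussian (X i).
Implicit Types (V W : T -> R) (g : R -> R).

Definition approx V := L2 P V /\ forall e : R, 0 < e ->
  exists m p, pol X m p /\ Ex P (fun w => (V w - p w) ^+ 2) < e.

Lemma eq_approx V W : V =1 W -> approx V -> approx W.
Proof. by move=> /funext ->. Qed.

Lemma approx_pol m p : pol X m p -> approx p.
Proof.
move=> pp; split; first by apply: tame_L2; exact: tame_pol pp.
move=> e e0; exists m, p; split=> //.
by under eq_Ex do rewrite subrr expr0n; rewrite Ex_cst.
Qed.

Lemma sqrD_le (a b : R) : (a + b) ^+ 2 <= 2 * a ^+ 2 + 2 * b ^+ 2.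
Proof. by have := sqr_ge0 (a - b); nra. Qed.

Lemma Ex_sqrD_le V W : L2 P V -> L2 P W ->
  Ex P (fun w => (V w + W w) ^+ 2) <= 2 * Ex P (fun w => V w ^+ 2) + 2 * Ex P (fun w => W w ^+ 2).
Proof.
move=> LV LW; rewrite -!ExZ; [|exact: LW.2|exact: LV.2].
rewrite -ExD; [|by apply: L1Z; exact: LV.2|by apply: L1Z; exact: LW.2].
apply: le_Ex; first exact: (L2D LV LW).2.
  by apply: L1D; apply: L1Z; [exact: LV.2|exact: LW.2].
by move=> w; exact: sqrD_le.
Qed.

Lemma approx_closed V : L2 P V -> (forall e : R, 0 < e ->
  exists W, approx W /\ Ex P (fun w => (V w - W w) ^+ 2) < e) -> approx V.
Proof.
move=> LV H; split=> // e e0.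
have e4 : 0 < e / 4 by rewrite divr_gt0.
have [W [[LW aW] VW]] := H _ e4; have [m [p [pp Wp]]] := aW _ e4.
exists m, p; split=> //; have Lp : L2 P p by apply: tame_L2; exact: tame_pol pp.
have := Ex_sqrD_le (L2B LV LW) (L2B LW Lp).
rewrite (_ : Ex P (fun w => (V w - W w + _) ^+ 2) = Ex P (fun w => (V w - p w) ^+ 2)); first lra.
by apply: eq_Ex => w; rewrite subrKA.
Qed.

(** Dominated convergence in L^2: the squared error is at most 4 h^2. *)
Lemma approx_cvg (u : nat -> T -> R) V (h : T -> R) : (forall n, approx (u n)) ->
  (forall w, u n w @[n --> \oo] --> V w) -> (forall n w, `|u n w| <= h w) -> L2 P h ->
  approx V.
Proof.
move=> au uV uh Lh.
have mV : measurable_fun setT V.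
  by apply: (measurable_fun_cvg (fun n => (au n).1.1)) => w _; exact: uV.
have Vh w : `|V w| <= h w.
  by apply: cvg_norm_le (uV w) _ => n; exact: uh.
have h0 w : 0 <= h w by apply: le_trans (Vh w).
have LV : L2 P V by apply: L2_le Lh _ => // w; rewrite (ger0_norm (h0 w)).
apply: approx_closed => // e e0.
have : Ex P (fun w => (V w - u n w) ^+ 2) @[n --> \oo] --> 0.
  rewrite -(Ex_cst P 0); apply: (Ex_cvg _ _ _ (L1Z 4 Lh.2)).2 => [n|w|n w].
  - by apply: measurable_funX; apply: measurable_funB => //; exact: (au n).1.1.
  - have -> : 0 = (V w - V w) * (V w - V w) by rewrite subrr mul0r.
    under eq_fun do rewrite expr2.
    by apply: cvgM; apply: cvgB => //; exact: cvg_cst.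
  - rewrite ger0_norm ?sqr_ge0//.
    have := sqrD_le (V w) (- u n w); rewrite sqrrN.
    have sq (x : R) : `|x| <= h w -> x ^+ 2 <= h w ^+ 2.
      by move=> xh; rewrite -(real_normK (num_real x)) lerXn2r ?nnegrE.
    have := sq _ (Vh w); have := sq _ (uh n w); lra.
move=> /cvgrPdist_lt/(_ e e0) [N _ /(_ N (leqnn N))]; rewrite sub0r normrN => He.
by exists (u N); split=> //; apply: le_lt_trans (ler_norm _) He.
Qed.

Lemma approx_lin a V W : approx V -> approx W -> approx (fun w => a * V w + W w).
Proof.
move=> [LV aV] [LW aW]; split; first by apply: L2D => //; exact: L2Z.
move=> e e0; pose c := 4 * (a ^+ 2 + 1).
have a2 := sqr_ge0 a.
have c0 : 0 < c by rewrite /c; lra.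
have e1 : 0 < e / c by rewrite divr_gt0.
have [m [p [pp Vp]]] := aV _ e1; have [k [q [pq Wq]]] := aW _ e1.
exists (maxn m k), (fun w => a * p w + q w); split.
  by apply: polD; [apply: polZ; apply: pol_widen pp; exact: leq_maxl|apply: pol_widen pq; exact: leq_maxr].
have Lp : L2 P p by apply: tame_L2; exact: tame_pol pp.
have Lq : L2 P q by apply: tame_L2; exact: tame_pol pq.
have := Ex_sqrD_le (L2Z a (L2B LV Lp)) (L2B LW Lq).
rewrite (_ : Ex P (fun w => (a * _ + _) ^+ 2) = Ex P (fun w => (a * V w + W w - (a * p w + q w)) ^+ 2)); last first.
  by apply: eq_Ex => w; congr (_ ^+ 2); ring.
rewrite (_ : Ex P (fun w => (a * _) ^+ 2) = a ^+ 2 * Ex P (fun w => (V w - p w) ^+ 2)); last first.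
  by rewrite -ExZ; [apply: eq_Ex => w; rewrite exprMn|exact: (L2B LV Lp).2].
move: Vp Wq; rewrite !ltr_pdivlMr// /c => Vp Wq.
have V0 : 0 <= Ex P (fun w => (V w - p w) ^+ 2) by apply: Ex_ge0 => w; exact: sqr_ge0.
have W0 : 0 <= Ex P (fun w => (W w - q w) ^+ 2) by apply: Ex_ge0 => w; exact: sqr_ge0.
nra.
Qed.

(** Multipliers form an algebra closed under bounded pointwise limits. Applied to one coordinate
    after another, they turn the constant 1 into indicators of cylinders. *)
Definition multiplier i g := [/\ measurable_fun setT g,
  exists c, forall x, `|g x| <= c & forall V, approx V -> approx (fun w => V w * g (X i w))].

Lemma eq_multiplier i g h : g =1 h -> multiplier i g -> multiplier i h.
Proof. by move=> /funext ->. Qed.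

Lemma multiplier_cst i c : multiplier i (fun=> c).
Proof.
split; [exact: measurable_cst|by exists (`|c|)|move=> V aV].
apply: eq_approx (approx_lin c aV (approx_pol (pol0 X 0))) => w.
by rewrite addr0 mulrC.
Qed.

Lemma multiplierM i g h : multiplier i g -> multiplier i h -> multiplier i (fun x => g x * h x).
Proof.
move=> [mg [c gc] ag] [mh [b hb] ah]; split; first exact: measurable_funM.
  by exists (c * b) => x; rewrite normrM ler_pM.
by move=> V /ag/ah; apply: eq_approx => w; rewrite mulrA.
Qed.

Lemma multiplier_lin i a g h : multiplier i g -> multiplier i h -> multiplier i (fun x => a * g x + h x).
Proof.
move=> [mg [c gc] ag] [mh [b hb] ah]; split.
- by apply: measurable_funD => //; exact: measurable_funM.
- exists (`|a| * c + b) => x; rewrite (le_trans (ler_normD _ _))// lerD//.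
  by rewrite normrM ler_wpM2l.
- move=> V aV; apply: eq_approx (approx_lin a (ag _ aV) (ah _ aV)) => w.
  by rewrite mulrDr mulrCA.
Qed.

Lemma multiplierX i g k : multiplier i g -> multiplier i (fun x => g x ^+ k).
Proof.
move=> mg; elim: k => [|k IHk]; first exact: multiplier_cst.
by apply: eq_multiplier (multiplierM mg IHk) => x; rewrite exprS.
Qed.

Lemma multiplier_onem i g : multiplier i g -> multiplier i (fun x => 1 - g x).
Proof.
move=> mg; apply: eq_multiplier (multiplier_lin (-1) mg (multiplier_cst i 1)) => x.
by rewrite mulN1r addrC.
Qed.

Lemma multiplier_cvg i (u : nat -> R -> R) g (c : R) : (forall n, multiplier i (u n)) ->
  (forall x, u n x @[n --> \oo] --> g x) -> (forall n x, `|u n x| <= c) -> multiplier i g.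
Proof.
move=> mu ug uc; split.
- by apply: (measurable_fun_cvg (fun n => let: And3 m _ _ := mu n in m)) => x _; exact: ug.
- by exists c => x; apply: cvg_norm_le (ug x) _ => n; exact: uc.
- move=> V aV; apply: (@approx_cvg (fun n w => V w * u n (X i w)) _ (fun w => c * `|V w|)).
  + by move=> n; have [_ _] := mu n; exact.
  + by move=> w; apply: cvgM; [exact: cvg_cst|exact: ug].
  + by move=> n w; rewrite normrM mulrC ler_wpM2r.
  + apply: L2Z; apply: L2_le aV.1 _; last by move=> w; rewrite normr_id.
    by apply: measurableT_comp => //; exact: aV.1.1.
Qed.

Lemma norm_exp_partial (z : R) n : `|series (exp_coeff z) n| <= expR `|z|.
Proof.
apply: (@le_trans _ _ (series (exp_coeff `|z|) n)).
  rewrite /series/= (le_trans (ler_norm_sum _ _ _))//; apply: ler_sum => k _.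
  by rewrite !exp_coeffE normrM normrX ger0_norm.
apply: (@nondecreasing_cvgn_le _ (series (exp_coeff `|z|))); last exact: is_cvg_series_exp_coeff.
by apply: nondecreasing_series => k _ _; rewrite exp_coeff_ge0.
Qed.

(* The partial sums of the exponential series are dominated by [expR `|z|], and
   the scale 32 leaves [expR (4 * `|z|)] integrable. *)
Lemma multiplier_gauss i y : multiplier i (fun x => expR (- ((x - y) ^+ 2 / 32))).
Proof.
pose z x : R := - ((x - y) ^+ 2 / 32).
have mz : measurable_fun setT z.
  apply: measurableT_comp => //; apply: measurable_funM => //.
  by apply: measurable_funX; exact: measurable_funB.
have z0 x : z x <= 0 by rewrite oppr_le0 divr_ge0// sqr_ge0.
have ez x : `|expR (z x)| <= 1 by rewrite ger0_norm ?expR_ge0// -[leRHS]expR0 ler_expR.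
have mX : measurable_fun setT (X i) := measurable_funP (X i).
have mexp (c : R) : measurable_fun setT (fun w => expR (c * z (X i w))).
  apply: (measurableT_comp (@measurable_expR R)); apply: measurable_funM => //.
  exact: (measurableT_comp mz mX).
(* Here - 4 z = (x - y)^2 / 8 <= x^2/4 + y^2/4, which is within reach of [L1_expsq]. *)
have Lexp : L1 P (fun w => expR (- 4 * z (X i w))).
  apply: L1_le (L1Z (expR (y ^+ 2 / 4)) (L1_expsq (X_gauss i))) => // w.
  rewrite ger0_norm ?expR_ge0// -expRD ler_expR /z.
  by have := sqr_ge0 (X i w + y); nra.
have pol_case m p : pol X m p -> approx (fun w => p w * expR (z (X i w))).
  move=> pp; pose M := maxn m i.+1.
  have tp : tame P p by exact: tame_pol pp.
  apply: (@approx_cvg (fun n w => p w * series (exp_coeff (z (X i w))) n) _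
    (fun w => `|p w| * expR (- z (X i w)))).
  - move=> n; apply: (@approx_pol M); apply: polM; first exact: pol_widen (leq_maxl _ _) pp.
    apply: (eq_pol (p := fun w => \sum_(k <- index_iota 0 n) k`!%:R^-1 * z (X i w) ^+ k)).
      by move=> w; rewrite /series/=; apply: eq_bigr => k _; rewrite exp_coeffE.
    apply: pol_sum => k; apply: polZ; apply: polX.
    apply: (eq_pol (p := fun w => (- 32^-1) * (X i w + - y) ^+ 2)).
      by move=> w; rewrite /z mulNr mulrC.
    apply: polZ; apply: polX; apply: polD; last exact: pol_cst.
    by apply: pol_coord; exact: leq_maxr.
  - move=> w; apply: cvgM; first exact: cvg_cst.
    exact: is_cvg_series_exp_coeff.
  - by move=> n w; rewrite normrM ler_wpM2l// (le_trans (norm_exp_partial _ _))// ler0_norm.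
  - split.
      apply: measurable_funM; first by apply: measurableT_comp => //; exact: tp.1.
      by under eq_fun do rewrite -mulN1r; exact: mexp.
    (* The dominating function is square integrable because p^2 e^(-2z) <= p^4 + e^(-4z). *)
    apply: L1_le (L1D (tame_L1 (tameX 4 tp)) Lexp).
      apply: measurable_funX; apply: measurable_funM; first by apply: measurableT_comp => //; exact: tp.1.
      by under eq_fun do rewrite -mulN1r; exact: mexp.
    move=> w; rewrite ger0_norm ?sqr_ge0// exprMn real_normK ?num_real//.
    have -> : expR (- 4 * z (X i w)) = (expR (- z (X i w)) ^+ 2) ^+ 2.
      by rewrite -exprM -expRM_natl; congr expR; ring.
    rewrite -[p w ^+ 4]/(p w ^+ (2 * 2)) exprM.
    by move: (p w ^+ 2) (expR _ ^+ 2) => a b; have := sqr_ge0 (a - b); have := sqr_ge0 (a + b); nra.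
split; [exact: (measurableT_comp (@measurable_expR R) mz)|by exists 1|move=> V aV].
have mg : measurable_fun setT (fun w => expR (z (X i w))).
  exact: (measurableT_comp (measurableT_comp (@measurable_expR R) mz) mX).
have Lmul W : L2 P W -> L2 P (fun w => W w * expR (z (X i w))).
  move=> LW; apply: (L2_le (measurable_funM LW.1 mg) LW) => w.
  by rewrite normrM ler_piMr.
(* The factor is at most 1, so multiplication by it contracts L^2 and the polynomial case extends to
   limits of polynomials. *)
apply: approx_closed; first exact: Lmul aV.1.
move=> e e0; have [m [p [pp Vp]]] := aV.2 e e0.
exists (fun w => p w * expR (z (X i w))); split; first exact: pol_case pp.
apply: le_lt_trans Vp; have Lp : L2 P p by apply: tame_L2; exact: tame_pol pp.
apply: le_Ex; first exact: (L2B (Lmul _ aV.1) (Lmul _ Lp)).2.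
  exact: (L2B aV.1 Lp).2.
move=> w; rewrite -mulrBl exprMn ler_piMr ?sqr_ge0//.
by have := ez (X i w); rewrite ger0_norm ?expR_ge0// => e1; rewrite exprn_ile1 ?expR_ge0.
Qed.

End density.

(** * Indicators as limits of powers *)

Section power_limits.
Context {R : realType}.
Implicit Types x r : R.

Lemma bernoulli_upper x l : 0 <= x <= 1 -> (1 - x) ^+ l * (1 + l%:R * x) <= 1.
Proof.
move=> /andP[x0 x1]; elim: l => [|l IHl]; first by rewrite mul0r addr0 mulr1.
apply: le_trans IHl; rewrite exprSr -mulrA ler_wpM2l ?exprn_ge0 ?subr_ge0//.
have l0 : 0 <= l%:R :> R by [].
rewrite -[l.+1%:R]natr1; have := mulr_ge0 l0 (sqr_ge0 x); have := sqr_ge0 x; nra.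
Qed.

Lemma bernoulli_lower x l : 0 <= x <= 1 -> 1 - l%:R * x <= (1 - x) ^+ l.
Proof.
move=> /andP[x0 x1]; elim: l => [|l IHl]; first by rewrite mul0r subr0.
have l0 : 0 <= l%:R :> R by [].
rewrite exprS; apply: (@le_trans _ _ ((1 - x) * (1 - l%:R * x))).
  by rewrite -[l.+1%:R]natr1; have := mulr_ge0 l0 (sqr_ge0 x); nra.
by rewrite ler_wpM2l// subr_ge0.
Qed.

(** With s = sqrt r, [bernoulli_upper] bounds k s^k by 1 / (1 - s), and a factor s^k is left
    over. *)
Lemma cvg_nat_expr r : 0 <= r < 1 -> k%:R * r ^+ k @[k --> \oo] --> 0.
Proof.
move=> /andP[r0 r1]; pose s := Num.sqrt r.
have s0 : 0 <= s by exact: sqrtr_ge0.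
have ss : s ^+ 2 = r by rewrite sqr_sqrtr.
have s1 : s < 1 by rewrite -(ltr_pXn2r (n := 2)) ?nnegrE// ss expr1n.
have x0 : 0 < 1 - s by rewrite subr_gt0.
have lims : (1 - s)^-1 * s ^+ k @[k --> \oo] --> 0.
  rewrite -[X in _ --> X](mulr0 (1 - s)^-1); apply: cvgM; first exact: cvg_cst.
  by apply: cvg_expr; rewrite ger0_norm.
apply: (squeeze_cvgr _ (cvg_cst 0) lims); apply: nearW => k.
rewrite mulr_ge0 ?exprn_ge0//= -ss -exprM mulnC exprM expr2 mulrA ler_wpM2r ?exprn_ge0//.
rewrite -[leRHS]mul1r ler_pdivlMr//.
have : s ^+ k * (1 + k%:R * (1 - s)) <= 1.
  rewrite -[X in X ^+ k](subKr 1); apply: bernoulli_upper.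
  by rewrite (ltW x0) gerBl.
have := exprn_ge0 k s0; rewrite mulrDr mulr1 mulrCA mulrA; lra.
Qed.

(* An exponent making [1 - (1 - g ^+ k) ^+ l] converge to the indicator of [a <= g]. *)
Definition sharp_exp (a : R) k : nat := (k * (Num.truncn (a^-1 ^+ k)).+1)%N.

Lemma sharp_cvg (a g : R) : 0 < a <= 1 -> 0 <= g <= 1 ->
  1 - (1 - g ^+ k) ^+ sharp_exp a k @[k --> \oo] --> (if a <= g then 1 else 0 : R).
Proof.
move=> /andP[a0 a1] /andP[g0 g1].
have b0 k : 0 < a^-1 ^+ k by rewrite exprn_gt0// invr_gt0.
have b1 k : 1 <= a^-1 ^+ k by rewrite exprn_ege1// invf_ge1.
have ab k : a ^+ k * a^-1 ^+ k = 1 by rewrite -exprMn mulfV ?gt_eqF// expr1n.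
have /= L k := truncn_itv (ltW (b0 k)).
have pg k : 0 <= g ^+ k <= 1 by rewrite exprn_ge0// exprn_ile1.
have pa k : 0 <= a ^+ k <= 1 by rewrite exprn_ge0 ?(ltW a0)// exprn_ile1// ltW.
(* The exponent l lies between k a^(-k) and 2 k a^(-k). If a <= g, then l g^k >= k and (1 - g^k)^l
   <= 1 / (1 + k); if g < a, then l g^k <= 2 k (g/a)^k, which tends to 0. *)
case: ifPn => [ag|]; last rewrite -ltNge => ga.
  rewrite -[X in _ --> X]subr0; apply: cvgB; first exact: cvg_cst.
  apply: (squeeze_cvgr _ (cvg_cst 0) (@cvg_harmonic R)); apply: nearW => k /=.
  have /andP[gk0 gk1] := pg k.
  rewrite exprn_ge0 ?subr_ge0//=.
  apply: (@le_trans _ _ ((1 - a ^+ k) ^+ sharp_exp a k)).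
    rewrite lerXn2r ?nnegrE ?subr_ge0//; first by have /andP[] := pa k.
    by rewrite lerD2l lerN2 lerXn2r ?nnegrE// ltW.
  have /andP[ak0 ak1] := pa k.
  rewrite -[leRHS]mul1r ler_pdivlMr ?ltr0n//.
  apply: le_trans (bernoulli_upper (sharp_exp a k) (pa k)).
  rewrite ler_wpM2l ?exprn_ge0 ?subr_ge0// -natr1 addrC lerD2l /sharp_exp natrM -mulrA.
  rewrite ler_peMr//.
  have /andP[_ /ltW Lk] := L k.
  by rewrite -[leLHS](ab k) mulrC ler_wpM2r.
have lim := @cvg_nat_expr (g / a) _.
have {}lim : 2 * (k%:R * (g / a) ^+ k) @[k --> \oo] --> 0.
  rewrite -[X in _ --> X](mulr0 2); apply: cvgM; first exact: cvg_cst.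
  by apply: lim; rewrite divr_ge0 ?(ltW a0)//= ltr_pdivrMr// mul1r.
apply: (squeeze_cvgr _ (cvg_cst 0) lim); apply: nearW => k.
have /andP[gk0 gk1] := pg k.
rewrite subr_ge0 exprn_ile1 ?subr_ge0//=; last by rewrite gerBl.
have := bernoulli_lower (sharp_exp a k) (pg k).
suff : (sharp_exp a k)%:R * g ^+ k <= 2 * (k%:R * (g / a) ^+ k) by lra.
rewrite /sharp_exp natrM expr_div_n -exprVn mulrCA -mulrA ler_wpM2l//.
rewrite mulrCA mulrC ler_wpM2l// -natr1.
by have /andP[+ _] := L k; have := b1 k; lra.
Qed.

End power_limits.

Import HBNNSimple.

(** * From intervals to all square-integrable variables *)

Section density_theorem.
Context d (T : measurableType d) (R : realType) (P : probability T R).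
Variable X : nat -> {RV P >-> R}.
Hypothesis X_gauss : forall i, standard_gaussian (X i).
Hypothesis X_gen : (@measurable d T) =
  <<s \bigcup_i preimage_set_system setT (X i) measurable >>.
Implicit Types (V W : T -> R) (g : R -> R).

Local Notation multiplier := (multiplier X).
Local Notation approx := (approx X).

(** A closed interval is a superlevel set of a Gaussian bump centered at its midpoint, to which
    [sharp_cvg] applies. *)
Lemma multiplier_itv i y r : 0 <= r ->
  multiplier i (fun x => if `|x - y| <= r then 1 else 0).
Proof.
move=> r0; pose a : R := expR (- (r ^+ 2 / 32)).
pose G x : R := expR (- ((x - y) ^+ 2 / 32)).
have a01 : 0 < a <= 1.
  by rewrite expR_gt0 -[leRHS]expR0 ler_expR oppr_le0 divr_ge0// sqr_ge0.
have G01 x : 0 <= G x <= 1.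
  by rewrite expR_ge0 -[leRHS]expR0 ler_expR oppr_le0 divr_ge0// sqr_ge0.
have aG x : (a <= G x) = (`|x - y| <= r).
  rewrite ler_expR lerN2 ler_pM2r ?invr_gt0// -(real_normK (num_real (x - y))).
  by rewrite ler_pXn2r ?nnegrE.
apply: (multiplier_cvg X_gauss (u := fun k (x : R) => 1 - (1 - G x ^+ k) ^+ sharp_exp a k) (c := 1)).
- move=> k; apply: (multiplier_onem X_gauss); apply: (multiplierX X_gauss); apply: (multiplier_onem X_gauss).
  by apply: (multiplierX X_gauss); exact: multiplier_gauss.
- by move=> x; rewrite -aG; exact: sharp_cvg.
- move=> k x; have /andP[G0 G1] := G01 x.
  have Gk1 : G x ^+ k <= 1 by exact: exprn_ile1.
  have Gk0 : 0 <= G x ^+ k by exact: exprn_ge0.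
  have e1 : (1 - G x ^+ k) ^+ sharp_exp a k <= 1 by apply: exprn_ile1; lra.
  have e0 : 0 <= (1 - G x ^+ k) ^+ sharp_exp a k by apply: exprn_ge0; lra.
  by rewrite ger0_norm ?subr_ge0// gerBl.
Qed.

Lemma cvg_eventually (u : nat -> R) l N : (forall n, (N <= n)%N -> u n = l) -> u n @[n --> \oo] --> l.
Proof. by move=> uN; apply: cvg_near_cst; exists N => // n /=; exact: uN. Qed.

(** The complementary half-line is the increasing union of the intervals [a - 2k, a], centered at a
    - k with radius k. *)
Lemma multiplier_ray i a : multiplier i (\1_(`]a, +oo[%classic : set R)).
Proof.
apply: (multiplier_cvg X_gauss (u := fun k (x : R) => 1 - (if `|x - (a - k%:R)| <= k%:R then 1 else 0)) (c := 1)).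
- by move=> k; apply: (multiplier_onem X_gauss); exact: multiplier_itv.
- move=> x; rewrite indicE; have [ax|xa] := ltP a x.
    rewrite mem_set; last by rewrite /= in_itv/= ax.
    apply: (@cvg_eventually _ _ 0) => k _; rewrite ifF ?subr0//; apply/negbTE; rewrite -ltNge.
    by rewrite ger0_norm; have : 0 <= k%:R :> R by []; lra.
  rewrite memNset; last by rewrite /= in_itv/= andbT; apply/negP; rewrite -leNgt.
  apply: (@cvg_eventually _ _ (Num.truncn (a - x)).+1) => k kN; rewrite ifT ?subrr//.
  have : a - x < k%:R.
    by apply: lt_le_trans (_ : (Num.truncn (a - x)).+1%:R <= _); [exact: truncnS_gt|rewrite ler_nat].
  by rewrite ler_norml => ?; apply/andP; split; have : 0 <= k%:R :> R by []; lra.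
- by move=> k x; case: ifP => _; rewrite ?subrr ?subr0 ?normr0 ?normr1.
Qed.

Lemma indicC_onem (U : Type) (A : set U) x : \1_(~` A) x = 1 - \1_A x :> R.
Proof.
rewrite !indicE; have [xA|xA] := pselect (A x).
  by rewrite memNset ?mem_set ?subrr//; exact.
by rewrite mem_set ?memNset ?subr0.
Qed.

Lemma cvg_indic_bigsetU (U : Type) (F : nat -> set U) x :
  (\1_(\big[setU/set0]_(k < n) F k) x : R) @[n --> \oo] --> (\1_(\bigcup_k F k) x : R).
Proof.
rewrite indicE; have [[k _ Fk]|nF] := pselect ((\bigcup_k F k) x).
  rewrite mem_set; last by exists k.
  apply: (@cvg_eventually _ _ k.+1) => n kn; rewrite indicE mem_set// -bigcup_mkord.
  by exists k.
rewrite memNset//; apply: (@cvg_eventually _ _ 0) => n _; rewrite indicE memNset// -bigcup_mkord.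
by move=> [k _ Fk]; apply: nF; exists k.
Qed.

Lemma indic_norm_le1 (U : Type) (A : set U) x : `|\1_A x : R| <= 1.
Proof. by rewrite indicE; case: (x \in A); rewrite ?normr1 ?normr0. Qed.

(** Open rays are stable under intersection and generate the Borel sets; multipliers supply the
    closure properties of a Dynkin system. *)
Lemma multiplier_indic i (B : set R) : measurable B -> multiplier i (\1_B : R -> R).
Proof.
move=> mB; pose G : set (set R) := [set A | exists a, A = `]a, +oo[%classic].
have GE : @measurable _ R = <<s G >> by exact: RGenOInfty.measurableE.
apply: (@dynkin_induction _ R G (fun B => multiplier i (\1_B : R -> R)) GE); last by rewrite -GE.
- move=> _ _ [a ->] [b ->]; exists (Num.max a b); apply/seteqP; split=> x /=.
    by rewrite !in_itv/= !andbT gt_max => -[-> ->].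
  by rewrite !in_itv/= !andbT gt_max => /andP[].
- by apply: eq_multiplier (multiplier_cst X_gauss i 1) => x; rewrite indicT.
- by move=> _ [a ->]; exact: multiplier_ray.
- by move=> S _ /(multiplier_onem X_gauss); apply: eq_multiplier => x; rewrite indicC_onem.
- move=> F _ _ mF; apply: (multiplier_cvg X_gauss _ (@cvg_indic_bigsetU _ F) (fun n => @indic_norm_le1 _ _)).
  elim=> [|n IHn].
    by apply: eq_multiplier (multiplier_cst X_gauss i 0) => x; rewrite big_ord0 indicE in_set0.
  have := multiplier_onem X_gauss (multiplierM (multiplier_onem X_gauss IHn) (multiplier_onem X_gauss (mF n))).
  apply: eq_multiplier => x; rewrite big_ord_recr/= !indicE in_setU.
  by case: (x \in _); case: (x \in _); rewrite /= ?subrr ?subr0 ?mul0r ?mulr0 ?mulr1 ?subrr ?subr0.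
Qed.

(** This is where [X_gen] enters: finite cylinders form a pi-system generating all events, and a
    cylinder indicator is the constant 1 multiplied by one multiplier per coordinate. *)
Lemma approx_indic (S : set T) : measurable S -> approx (\1_S : T -> R).
Proof.
move=> mS; pose G : set (set T) := [set A | exists m (B : nat -> set R),
  (forall i, measurable (B i)) /\ A = \bigcap_(i in `I_m) X i @^-1` B i].
have mG : G `<=` measurable.
  move=> A [m [B [mB ->]]]; rewrite bigcap_mkord; apply: bigsetI_measurable => i _.
  by rewrite -[X in measurable X]setTI; exact: measurable_funP.
have GE : @measurable _ T = <<s G >>.
  apply/seteqP; split; last by apply: smallest_sub mG; exact: sigma_algebra_measurable.
  rewrite {1}X_gen; apply: smallest_sub; first exact: smallest_sigma_algebra.
  move=> A [i _ [B mB <-]]; apply: sub_gen_smallest; exists i.+1, (fun j => if j == i then B else setT).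
  split; first by move=> j; case: ifP.
  rewrite setTI; apply/seteqP; split=> w /=.
    by move=> Bw j _; case: eqP => [->|].
  by move=> /(_ i (ltnSn i)); rewrite /= eqxx.
apply: (@dynkin_induction _ T G (fun S => approx (\1_S : T -> R)) GE); last by rewrite -GE.
- move=> _ _ [m [B [mB ->]]] [n [C [mC ->]]].
  exists (maxn m n), (fun i => (if (i < m)%N then B i else setT) `&` (if (i < n)%N then C i else setT)).
  split; first by move=> i; apply: measurableI; case: ifP.
  apply/seteqP; split=> w /=.
    move=> [H1 H2] i _ /=; split; case: ifP => // im; [exact: H1|exact: H2].
  move=> H; split=> i /= im.
    by have := H i (leq_trans im (leq_maxl _ _)) => -[]; rewrite im.
  by have := H i (leq_trans im (leq_maxr _ _)) => -[_]; rewrite im.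
- by apply: eq_approx (approx_pol X_gauss (pol_cst X 0 1)) => x; rewrite indicT.
- move=> _ [m [B [mB ->]]]; elim: m => [|m IHm].
    apply: eq_approx (approx_pol X_gauss (pol_cst X 0 1)) => x.
    by rewrite indicE mem_set.
  have [_ _ /(_ _ IHm)] := multiplier_indic m (mB m).
  apply: eq_approx => w; rewrite IIS bigcap_setU bigcap_set1 indicI.
  by [].
- move=> A _ aA; apply: eq_approx (approx_lin X_gauss (-1) aA (approx_pol X_gauss (pol_cst X 0 1))) => x.
  by rewrite indicC_onem mulN1r addrC.
- move=> F _ tF aF; apply: (approx_cvg X_gauss _ (@cvg_indic_bigsetU _ F) (fun n => @indic_norm_le1 _ _) (L2_cst P 1)).
  elim=> [|n IHn].
    by apply: eq_approx (approx_pol X_gauss (pol0 X 0)) => x; rewrite big_ord0 indicE in_set0.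
  (* [approx] is linear but not known to be stable under products, so disjointness is used to write
     the indicator of the union as a sum. *)
  apply: eq_approx (approx_lin X_gauss 1 IHn (aF n)) => w.
  rewrite mul1r big_ord_recr/= !indicE in_setU.
  have [wn|wn] := pselect (F n w); last by rewrite (memNset wn) orbF addr0.
  rewrite (mem_set wn) orbT memNset ?add0r// -bigcup_mkord => -[k /= kn Fk].
  by have := tF k n I I (ex_intro _ w (conj Fk wn)) => kn'; rewrite kn' ltnn in kn.
Qed.

Lemma approx_sfun (f : {nnsfun T >-> R}) : approx f.
Proof.
have -> : (f : T -> R) = fun w => \sum_(y <- fset_set (range f)) y * \1_(f @^-1` [set y]) w.
  by apply/funext => w; rewrite [LHS]fimfunE fsbig_finite.
elim: (enum_fset _) => [|y s IHs].
  by apply: eq_approx (approx_pol X_gauss (pol0 X 0)) => w; rewrite big_nil.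
have ay : approx (\1_(f @^-1` [set y]) : T -> R) by apply: approx_indic.
by apply: eq_approx (approx_lin X_gauss y ay IHs) => w; rewrite big_cons.
Qed.

Lemma approx_ge0 V : L2 P V -> (forall w, 0 <= V w) -> approx V.
Proof.
move=> LV V0; have mV : measurable_fun setT (EFin \o V) by apply/measurable_EFinP; exact: LV.1.
pose f := nnsfun_approx measurableT mV.
have fV w : f n w @[n --> \oo] --> V w.
  apply: (@fine_cvg R _ _ _ (fun n => (f n w)%:E)).
  by apply: cvg_nnsfun_approx => // x _ /=; rewrite lee_fin.
apply: (approx_cvg X_gauss (fun n => approx_sfun (f n)) fV _ LV) => n w.
rewrite ger0_norm// -(cvg_lim _ (fV w))//.
apply: (@nondecreasing_cvgn_le _ (fun n => f n w)); last by apply: cvgP (fV w).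
by move=> a b ab; exact/lefP/nd_nnsfun_approx.
Qed.

Theorem polynomials_dense V : L2 P V -> approx V.
Proof.
move=> LV.
have Lp (W : T -> R) : L2 P W -> L2 P (fun w => Num.max (W w) 0).
  move=> LW; apply: L2_le (LW) _.
    by apply: measurable_maxr; [exact: LW.1|exact: measurable_cst].
  by move=> w; rewrite ger0_norm ?le_max ?lexx ?orbT// ge_max ler_norm normr_ge0.
have ap : approx (fun w => Num.max (V w) 0).
  by apply: approx_ge0; [exact: Lp|move=> w; rewrite le_max lexx orbT].
have an : approx (fun w => Num.max (- V w) 0).
  by apply: approx_ge0; [apply: Lp; exact: L2N|move=> w; rewrite le_max lexx orbT].
apply: eq_approx (approx_lin X_gauss (-1) an ap) => w; rewrite mulN1r.
by case: (leP (V w) 0) => h; case: (leP (- V w) 0) => h'; lra.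
Qed.

End density_theorem.

(** * Decay of the characteristic function *)

Section matrix_norms.
Context {R : realType}.

(** Lagrange's identity: the defect is half the sum of the squares (a_i b_j - a_j b_i)^2. *)
Lemma sum_CauchySchwarz n (a b : 'I_n -> R) :
  (\sum_i a i * b i) ^+ 2 <= (\sum_i a i ^+ 2) * \sum_i b i ^+ 2.
Proof.
have : 0 <= \sum_i \sum_j (a i * b j - a j * b i) ^+ 2.
  by apply: sumr_ge0 => i _; apply: sumr_ge0 => j _; exact: sqr_ge0.
have -> : \sum_i \sum_j (a i * b j - a j * b i) ^+ 2 = \sum_i \sum_j a i ^+ 2 * b j ^+ 2 +
    \sum_i \sum_j a j ^+ 2 * b i ^+ 2 - 2 * \sum_i \sum_j (a i * b i) * (a j * b j).
  rewrite mulr_sumr -big_split -sumrB/=; apply: eq_bigr => i _.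
  by rewrite mulr_sumr -big_split -sumrB/=; apply: eq_bigr => j _; ring.
have -> : \sum_i \sum_j a j ^+ 2 * b i ^+ 2 = \sum_i \sum_j a i ^+ 2 * b j ^+ 2 by rewrite exchange_big.
rewrite expr2 !big_distrlr/=; lra.
Qed.

Lemma nsq_mul_le m n (B : 'M[R]_(m, n)) v : nsq (v *m B) <= nsq v * \sum_j \sum_i B i j ^+ 2.
Proof.
by rewrite mulr_sumr; apply: ler_sum => j _; rewrite mxE; exact: sum_CauchySchwarz.
Qed.

(** By symmetry |v A|^2 is the scalar product of v A^2 and v; Cauchy-Schwarz and the Hilbert-Schmidt
    norm of A^2 bound it. *)
Lemma nsq_mul_sqr_le m (A : 'M[R]_m) v : A^T = A ->
  nsq (v *m A) ^+ 2 <= \tr (A *m A *m (A *m A)) * nsq v ^+ 2.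
Proof.
move=> sA.
have -> : nsq (v *m A) = \sum_i (v *m (A *m A)) 0 i * v 0 i.
  rewrite nsqE trmx_mul sA (mulmxA (v *m A)) -[v *m A *m A]mulmxA mxE.
  by apply: eq_bigr => i _; rewrite [v^T _ _]mxE.
apply: le_trans (sum_CauchySchwarz _ _) _.
rewrite -/(nsq v) expr2 mulrA ler_wpM2r ?nsq_ge0// mulrC.
apply: le_trans (nsq_mul_le _ _) _.
rewrite ler_wpM2l ?nsq_ge0//.
have sAA : (A *m A)^T = A *m A by rewrite trmx_mul sA.
rewrite le_eqVlt; apply/orP; left; apply/eqP; apply: eq_bigr => j _.
rewrite mxE; apply: eq_bigr => i _; rewrite expr2; congr (_ * _).
by rewrite -{1}sAA mxE.
Qed.

Lemma nsq_mul_sum_le m n (A : 'I_n -> 'M[R]_m) (xi : 'rV[R]_n) v :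
  nsq (v *m (\sum_k xi 0 k *: A k)) <= nsq xi * \sum_k nsq (v *m A k).
Proof.
rewrite /nsq [X in _ * X]exchange_big mulr_sumr; apply: ler_sum => j _.
apply: le_trans (sum_CauchySchwarz _ _); rewrite mulmx_sumr summxE.
rewrite le_eqVlt; apply/orP; left; apply/eqP; congr (_ ^+ 2).
by apply: eq_bigr => k _; rewrite -scalemxAr mxE.
Qed.

End matrix_norms.

Section chaos_vectors.
Context d (T : measurableType d) (R : realType) (P : probability T R).
Variable X : nat -> {RV P >-> R}.
Hypothesis X_gauss : forall i, standard_gaussian (X i).
Hypothesis X_indep : mutually_independent X.
Hypothesis X_gen : (@measurable d T) =
  <<s \bigcup_i preimage_set_system setT (X i) measurable >>.

Lemma cquad_sum m n (A : 'I_n -> 'M[R]_m) (xi : 'rV[R]_n) w :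
  cquad X (\sum_k xi 0 k *: A k) w = \sum_k xi 0 k * cquad X (A k) w.
Proof.
apply: (big_ind2 (fun (B : 'M[R]_m) y => cquad X B w = y)).
- by rewrite /cquad mxtrace0 subr0 /quad big1// => i _; rewrite /lin big1 ?mulr0// => j _; rewrite mxE mul0r.
- move=> B b C c <- <-; rewrite /cquad -[C]scale1r quad_lin mxtraceD scale1r; ring.
- move=> k _; rewrite /cquad -[_ *: _]add0r quad_lin mxtraceD mxtraceZ mxtrace0.
  have -> : quad 0 (sample X m w) = 0.
    by rewrite /quad big1// => i _; rewrite /lin big1 ?mulr0// => j _; rewrite mxE mul0r.
  ring.
Qed.

Section one_element.
Variable F : T -> R.
Hypothesis F_chaos : wiener_chaos X 2 F.

Local Notation f m := (cquad X (coefmx X m F)).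

Let LF : L2 P F. Proof. exact: chaos_L2 F_chaos. Qed.

Let Lf m : L2 P (f m). Proof. by apply: tame_L2; exact: tame_cquad. Qed.

Lemma chaos_centered : Ex P F = 0.
Proof.
have := chaos_orth_pol X_gauss X_indep F_chaos (pol_cst X 0 1).
under eq_Ex do rewrite mulr1.
rewrite ExB; [|exact: L2_L1|exact: L2_L1].
by rewrite Ex_cquad// subr0.
Qed.

(** Pythagoras: the remainder is orthogonal to polynomials of every degree in the first m variables,
    so the quadratic projection is at least as close to F as any of them. *)
Lemma chaos_best_approx m p : pol X m p ->
  Ex P (fun w => (F w - f m w) ^+ 2) <= Ex P (fun w => (F w - p w) ^+ 2).
Proof.
move=> pp; have tp := tame_pol X_gauss pp; have Lp : L2 P p by exact: tame_L2.
have LFf := L2B LF (Lf m); have Lfp := L2B (Lf m) Lp.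
have pfp : pol X m (fun w => -1 * p w + f m w) by apply: polD; [exact: polZ|exact: pol_cquad].
have orth := chaos_orth_pol X_gauss X_indep F_chaos pfp.
have -> : Ex P (fun w => (F w - p w) ^+ 2) = Ex P (fun w => (F w - f m w) ^+ 2) +
    2 * Ex P (fun w => (F w - f m w) * (-1 * p w + f m w)) +
    Ex P (fun w => (f m w - p w) ^+ 2).
  have Lc : L1 P (fun w => (F w - f m w) * (-1 * p w + f m w)).
    by apply: eq_L1 (L2M LFf Lfp) => w; rewrite mulN1r [- p w + _]addrC.
  rewrite -ExZ// -(ExD LFf.2 (L1Z 2 Lc)) -(ExD (L1D LFf.2 (L1Z 2 Lc)) Lfp.2).
  by apply: eq_Ex => w; ring.
rewrite orth mulr0 addr0 lerDl; apply: Ex_ge0 => w; exact: sqr_ge0.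
Qed.

Lemma chaos_approx_cvg : Ex P (fun w => (F w - f m w) ^+ 2) @[m --> \oo] --> 0.
Proof.
apply/cvgrPdist_lt => e e0.
have [_ /(_ e e0)[m [p [pp Fp]]]] := polynomials_dense X_gauss X_gen LF.
exists m => // k /= mk; rewrite sub0r normrN ger0_norm; last first.
  by apply: Ex_ge0 => w; exact: sqr_ge0.
exact: le_lt_trans (chaos_best_approx (pol_widen mk pp)) Fp.
Qed.

(** Pythagoras again, the left side being the second moment of the projection. *)
Lemma chaos_approx_sqr m : 2 * \tr (coefmx X m F *m coefmx X m F) =
  Ex P (fun w => F w ^+ 2) - Ex P (fun w => (F w - f m w) ^+ 2).
Proof.
have orth := chaos_orth_pol X_gauss X_indep F_chaos (pol_cquad X (coefmx X m F)).
rewrite -{1}trmx_coefmx -(Ex_cquad2 X_gauss X_indep) ?trmx_coefmx//.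
rewrite -[LHS]addr0 -(mulr0 2) -orth -!ExZ ?mulr0; last exact: L2M (L2B LF (Lf m)) (Lf m).
rewrite -ExD; last 2 first.
- exact: L2M.
- by apply: L1Z; exact: L2M (L2B LF (Lf m)) (Lf m).
rewrite -ExB; [by apply: eq_Ex => w; ring|exact: LF.2|exact: (L2B LF (Lf m)).2].
Qed.

(* Jensen: [F ^+ 4 >= f ^+ 4 + 4 f ^+ 3 (F - f)], where [f ^+ 3] is orthogonal to [F - f]. *)
Lemma chaos_approx_fourth m : L1 P (fun w => F w ^+ 4) ->
  Ex P (fun w => f m w ^+ 4) <= Ex P (fun w => F w ^+ 4).
Proof.
move=> F4.
have orth := chaos_orth_pol X_gauss X_indep F_chaos (polX 3 (pol_cquad X (coefmx X m F))).
have tf := tame_cquad X_gauss (coefmx X m F).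
have Lc := L2M (L2B LF (Lf m)) (tame_L2 (tameX 3 tf)).
have L4 := tame_L1 (tameX 4 tf).
rewrite -[leLHS]addr0 -(mulr0 4) -orth -ExZ// -ExD//; last exact: L1Z.
apply: le_Ex => //; first by apply: L1D => //; exact: L1Z.
move=> w; rewrite -subr_ge0; move: (F w) (f m w) => a b.
(* The gap between a^4 and its tangent at b, factored so that its sign is visible. *)
rewrite (_ : _ - _ = (a - b) ^+ 2 * ((a + b) ^+ 2 + 2 * b ^+ 2)); last by ring.
by apply: mulr_ge0; [exact: sqr_ge0|apply: addr_ge0; [|apply: mulr_ge0 => //]; exact: sqr_ge0].
Qed.

End one_element.

Lemma derive_lipschitz (f f' : R -> R) x y :
  (forall z, is_derive z (1 : R) f (f' z)) -> (forall z, `|f' z| <= 1) ->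
  `|f x - f y| <= `|x - y|.
Proof.
move=> df f1; wlog yx : x y / y <= x.
  by move=> H; have [/H//|/ltW/H] := leP y x; rewrite distrC [in leRHS]distrC.
have [|z _ ->] := MVT_segment yx (fun z _ => df z).
  by apply: continuous_subspaceT => z; exact: isd_continuous (df z).
by rewrite normrM ler_piMl.
Qed.

(** The difference of the expectations is at most E|V - u_m|, hence at most the L^2 distance. *)
Lemma Ex_lipschitz_cvg (g : R -> R) (u : nat -> T -> R) V :
  (forall x y, `|g x - g y| <= `|x - y|) -> (forall x, `|g x| <= 1) ->
  measurable_fun setT g -> L2 P V -> (forall m, L2 P (u m)) ->
  Ex P (fun w => (V w - u m w) ^+ 2) @[m --> \oo] --> 0 ->
  Ex P (fun w => g (u m w)) @[m --> \oo] --> Ex P (fun w => g (V w)).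
Proof.
move=> lip g1 mg LV Lu uV.
have Lg W : L2 P W -> L1 P (fun w => g (W w)).
  move=> LW; apply: L2_L1; apply: (@L2_bounded _ _ _ P _ 1) => [|w]; last exact: g1.
  exact: (measurableT_comp mg LW.1).
have lim0 : Num.sqrt (Ex P (fun w => (V w - u m w) ^+ 2)) @[m --> \oo] --> 0.
  by rewrite -[X in _ --> X](@sqrtr0 R); apply: continuous_cvg => //; exact: sqrt_continuous.
apply/cvgrPdist_le => e e0.
move/cvgrPdist_le : lim0 => /(_ e e0); apply: filterS => m.
rewrite sub0r normrN ger0_norm ?sqrtr_ge0// => He; apply: le_trans He.
rewrite -ExB; [|exact: Lg|exact: Lg].
apply: le_trans (normr_Ex _) _; first by apply: L1B; exact: Lg.
have LB := L2B LV (Lu m).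
apply: (@le_trans _ _ (Ex P (fun w => `|V w - u m w|))).
  apply: le_Ex; last by move=> w; exact: lip.
    by apply: L1_norm; apply: L1B; exact: Lg.
  by apply: L1_norm; exact: L2_L1.
rewrite -[leLHS]ger0_norm; last by apply: Ex_ge0.
rewrite -sqrtr_sqr ler_wsqrtr//.
have LN : L2 P (fun w => `|V w - u m w|).
  by apply: (L2_le _ LB) => [|w]; [apply: measurableT_comp => //; exact: LB.1|rewrite normr_id].
have := Ex_CauchySchwarz LN (L2_cst P 1).
under eq_Ex do rewrite mulr1.
under [X in _ <= X * _]eq_Ex do rewrite real_normK ?num_real//.
by under [X in _ <= _ * X]eq_Ex do rewrite expr1n; rewrite Ex_cst mulr1.
Qed.

(* With [eta = 1 / (16 p n)], the moment bound yields [\tr (A_k ^ 4) <= eta ^ 2] for the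
   projections, hence [|v A|^2 <= |xi|^2 n eta |v|^2 = M |v|^2] for
   [A = \sum_k xi_k A_k] and [M = |xi|^2 / (16 p)]. *)
Lemma chaos_vector_decay n p (F : 'I_n -> T -> R) (xi : 'rV[R]_n) : (0 < n)%N -> (0 < p)%N ->
  (forall i, wiener_chaos X 2 (F i)) ->
  (forall i j, Ex P (fun w => F i w * F j w) = (i == j)%:R) ->
  (forall i, L1 P (fun w => F i w ^+ 4)) ->
  (forall i, Ex P (fun w => F i w ^+ 4) <= 3 + 24 * ((16 * p * n)%:R^-1) ^+ 2) ->
  (Ex P (fun w => cos (\sum_k xi 0 k * F k w)) ^+ 2 +
   Ex P (fun w => sin (\sum_k xi 0 k * F k w)) ^+ 2) * (1 + nsq xi / (4 * p%:R)) ^+ p <= 1.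
Proof.
move=> n0 p0 Fc FF F4 Fk4; set eta : R := _^-1 in Fk4.
have n0R : 0 < n%:R :> R by rewrite ltr0n.
have p0R : 0 < p%:R :> R by rewrite ltr0n.
have etaE : eta = (16 * p%:R * n%:R)^-1 by rewrite /eta !natrM.
have eta0 : 0 < eta by rewrite etaE invr_gt0 !mulr_gt0.
pose A m k := coefmx X m (F k).
pose AX m : 'M[R]_m := \sum_k xi 0 k *: A m k.
pose S w := \sum_k xi 0 k * F k w.
have sA m k : (A m k)^T = A m k by exact: trmx_coefmx.
have sAX m : (AX m)^T = AX m.
  by rewrite /AX linear_sum/=; apply: eq_bigr => k _; rewrite linearZ/= sA.
have LFk k : L2 P (F k) by exact: chaos_L2 (Fc k).
have LS : L2 P S by apply: L2_sum => k _; exact: L2Z.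
have Lu m : L2 P (cquad X (AX m)) by apply: tame_L2; exact: tame_cquad.
have LD m k : L2 P (fun w => F k w - cquad X (A m k) w).
  by apply: L2B => //; apply: tame_L2; exact: tame_cquad.
have SE m w : S w - cquad X (AX m) w = \sum_k xi 0 k * (F k w - cquad X (A m k) w).
  rewrite /S /AX cquad_sum -sumrB; apply: eq_bigr => k _.
  by rewrite [RHS]mulrBr.
pose err m k := Ex P (fun w => (F k w - cquad X (A m k) w) ^+ 2).
have err0 k : err m k @[m --> \oo] --> 0 by exact: chaos_approx_cvg.
have Serr m : Ex P (fun w => (S w - cquad X (AX m) w) ^+ 2) <= nsq xi * \sum_k err m k.
  rewrite -Ex_sum; last by move=> k _; exact: (LD m k).2.
  have Lsum : L1 P (fun w => \sum_k (F k w - cquad X (A m k) w) ^+ 2).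
    by apply: L1_sum => k _; exact: (LD m k).2.
  rewrite -ExZ//; apply: le_Ex; [exact: (L2B LS (Lu m)).2|exact: L1Z|].
  by move=> w; rewrite SE; exact: sum_CauchySchwarz.
have Slim : Ex P (fun w => (S w - cquad X (AX m) w) ^+ 2) @[m --> \oo] --> 0.
  have lim : nsq xi * \sum_k err m k @[m --> \oo] --> 0.
    have lim : \sum_k err m k @[m --> \oo] --> \sum_(k < n) (0 : R).
      by apply: cvg_sumr => k; exact: err0.
    rewrite big1// in lim; rewrite -[X in _ --> X](mulr0 (nsq xi)).
    by apply: cvgM; first exact: cvg_cst.
  apply: (squeeze_cvgr _ (cvg_cst 0) lim); apply: nearW => m.
  by rewrite Serr andbT; apply: Ex_ge0 => w; exact: sqr_ge0.
have ES : Ex P (fun w => S w ^+ 2) = nsq xi.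
  transitivity (Ex P (fun w => \sum_i \sum_j xi 0 i * xi 0 j * (F i w * F j w))).
    apply: eq_Ex => w; rewrite expr2 big_distrlr/=.
    by apply: eq_bigr => i _; apply: eq_bigr => j _; rewrite mulrACA.
  rewrite Ex_sum; last by move=> i _; apply: L1_sum => j _; apply: L1Z; exact: L2M.
  apply: eq_bigr => i _; rewrite Ex_sum; last by move=> j _; apply: L1Z; exact: L2M.
  rewrite (bigD1 i)//= big1 ?addr0; last first.
    by move=> j ji; rewrite ExZ ?FF 1?eq_sym ?(negbTE ji) ?mulr0//; exact: L2M.
  by rewrite ExZ ?FF ?eqxx ?mulr1 ?expr2//; exact: L2M.
have dist_cos (x y : R) : `|cos x - cos y| <= `|x - y| 
  by apply: (@derive_lipschitz cos (fun z => - sin z)) => z; rewrite ?normrN ?sin_max.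
have dist_sin (x y : R) : `|sin x - sin y| <= `|x - y| 
  by apply: (@derive_lipschitz sin cos) => z; rewrite ?cos_max.
have cvg_c := Ex_lipschitz_cvg dist_cos (fun x => cos_max x) (continuous_measurable_fun (@continuous_cos R)) LS Lu Slim.
have cvg_s := Ex_lipschitz_cvg dist_sin (fun x => sin_max x) (continuous_measurable_fun (@continuous_sin R)) LS Lu Slim.
(* Chosen so that 2 p M = |xi|^2 / 8, the lower bound obtained below for tr(A^2). *)
pose M := nsq xi / (16 * p%:R).
have M4 : nsq xi / (4 * p%:R) = 4 * M by rewrite /M; field; exact: lt0r_neq0.
have M0 : 0 <= M by rewrite divr_ge0 ?nsq_ge0// mulr_ge0.
have lim : (Ex P (fun w => cos (cquad X (AX m) w)) ^+ 2 + Ex P (fun w => sin (cquad X (AX m) w)) ^+ 2)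
    * (1 + 4 * M) ^+ p @[m --> \oo] -->
  (Ex P (fun w => cos (S w)) ^+ 2 + Ex P (fun w => sin (S w)) ^+ 2) * (1 + 4 * M) ^+ p.
  apply: cvgM; last exact: cvg_cst.
  by under eq_fun do rewrite !expr2; rewrite !expr2; apply: cvgD; apply: cvgM.
(* M does not depend on m, so it is enough to prove the bound for all large projections and pass to
   the limit. *)
rewrite M4 -(cvg_lim _ lim)//; apply: limr_le; first by apply: cvgP lim.
(* The first threshold serves the operator norm: with e the error, 12 tr(A_k^2)^2 = 3 (1 - e)^2, so
   48 tr(A_k^4) <= 24 eta^2 + 6 e <= 48 eta^2. The second serves the Hilbert-Schmidt norm: the n
   errors add up to at most 1/4. *)
have small k : \forall m \near \oo, err m k <= Num.min (4 * eta ^+ 2) (4 * n%:R)^-1.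
  have b0 : 0 < Num.min (4 * eta ^+ 2) (4 * n%:R)^-1.
    by rewrite lt_min invr_gt0 !mulr_gt0// exprn_gt0.
  move/cvgrPdist_le : (err0 k) => /(_ _ b0); apply: filterS => m; rewrite sub0r normrN.
  exact: le_trans (ler_norm _).
have : \forall m \near \oo, forall k, err m k <= Num.min (4 * eta ^+ 2) (4 * n%:R)^-1.
  by apply: filter_forall.
apply: filterS => m errm.
have errm1 k : err m k <= 4 * eta ^+ 2 by have := errm k; rewrite le_min => /andP[].
have errm2 k : err m k <= (4 * n%:R)^-1 by have := errm k; rewrite le_min => /andP[].
apply: (quadratic_decay X_gauss X_indep (sAX m) M0).
- move=> v; apply: le_trans (nsq_mul_sum_le _ _ _) _.
  suff small_op k : nsq (v *m A m k) <= eta * nsq v.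
    have -> : M * nsq v = nsq xi * (\sum_(k < n) eta * nsq v).
      rewrite sumr_const card_ord -mulr_natl etaE /M; field.
      by rewrite !lt0r_neq0.
    by rewrite ler_wpM2l ?nsq_ge0//; apply: ler_sum => k _.
  rewrite -(ler_pXn2r (n := 2)) ?nnegrE ?nsq_ge0 ?(mulr_ge0 (ltW eta0)) ?nsq_ge0//.
  apply: le_trans (nsq_mul_sqr_le _ (sA m k)) _.
  rewrite exprMn ler_wpM2r ?sqr_ge0//.
  have := chaos_approx_fourth (Fc k) m (F4 k); rewrite Ex_cquad4 ?sA//.
  have := chaos_approx_sqr (Fc k) m; rewrite -/(A m k) -/(err m k).
  have -> : Ex P (fun w => F k w ^+ 2) = 1.
    by transitivity (Ex P (fun w => F k w * F k w)); [apply: eq_Ex => w; rewrite expr2|rewrite FF eqxx].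
  have := Fk4 k; have := errm1 k.
  have : 0 <= err m k by apply: Ex_ge0 => w; exact: sqr_ge0.
  move: (err m k) (\tr (A m k *m A m k)) (\tr (A m k *m A m k *m (A m k *m A m k))) (Ex P _) (eta ^+ 2) => e t t4 E4 h e0 eh E4h te.
  have -> : t = (1 - e) / 2 by lra.
  have := sqr_ge0 e; nra.
- have -> : 2 * p%:R * M = nsq xi / 8 by rewrite /M; field; exact: lt0r_neq0.
  have -> : \tr (AX m *m AX m) = Ex P (fun w => cquad X (AX m) w ^+ 2) / 2.
    rewrite -{1}(sAX m) -[LHS](mulKf (_ : 2 != 0 :> R))// -(Ex_cquad2 X_gauss X_indep) ?sAX//.
    by rewrite mulrC; congr (_ / _); apply: eq_Ex => w; rewrite expr2.
  (* From |xi|^2 <= 2 E(S - q)^2 + 2 E q^2 and E(S - q)^2 <= |xi|^2 / 4 follows E q^2 >= |xi|^2 / 4,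
     that is tr(A^2) >= |xi|^2 / 8. *)
  have S2 := Ex_sqrD_le (L2B LS (Lu m)) (Lu m).
  have {}S2 : nsq xi <= 2 * Ex P (fun w => (S w - cquad X (AX m) w) ^+ 2) +
      2 * Ex P (fun w => cquad X (AX m) w ^+ 2).
    by rewrite -ES; apply: le_trans S2; rewrite le_eqVlt; apply/orP; left; apply/eqP; apply: eq_Ex => w; rewrite subrK.
  have : Ex P (fun w => (S w - cquad X (AX m) w) ^+ 2) <= nsq xi / 4.
    apply: le_trans (Serr m) _; rewrite ler_wpM2l ?nsq_ge0//.
    apply: (@le_trans _ _ (\sum_(k < n) (4 * n%:R)^-1)); first by apply: ler_sum => k _.
    rewrite sumr_const card_ord -[leLHS]mulr_natl (_ : n%:R * _ = 4^-1)//.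
    by field; rewrite lt0r_neq0.
  lra.
Qed.

End chaos_vectors.

(** * From the squared modulus to the stated bound *)

Section conclusion.
Context d (T : measurableType d) (R : realType) (P : probability T R).

Lemma expectationC_expCi (S : T -> R) :
  expectationC P (fun w => expC ('i%C * (S w)%:C%C)) =
  Complex (Ex P (fun w => cos (S w))) (Ex P (fun w => sin (S w))).
Proof.
have E w : expC ('i%C * (S w)%:C%C) = Complex (cos (S w)) (sin (S w)).
  by rewrite /expC /= !mul0r mulr0 subr0 expR0 !mul1r add0r.
rewrite /expectationC unlock /Ex /Rintegral; congr (Complex (fine _) (fine _));
  by apply: eq_integral => w _; rewrite E.
Qed.

Lemma normC_Complex (a b : R) : `|Complex a b| = (Num.sqrt (a ^+ 2 + b ^+ 2))%:C%C.
Proof. by []. Qed.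

Lemma expectation_Ex (f : T -> R) : L1 P f -> ('E_P[f] = (Ex P f)%:E)%E.
Proof. by move=> Lf; rewrite unlock EFin_Ex. Qed.

(** Integrability of the fourth powers is read off the upper bound on the fourth cumulant, which
    stands in for hypercontractivity. *)
Lemma L1_fine_expectation (f : T -> R) (b : R) : measurable_fun setT f -> (forall w, 0 <= f w) ->
  ('E_P[f] <= b%:E)%E -> L1 P f /\ Ex P f <= b.
Proof.
move=> mf f0; rewrite unlock => fb.
have Lf : L1 P f.
  apply/integrableP; split; first exact/measurable_EFinP.
  apply: le_lt_trans (ltry b); apply: le_trans fb.
  by under eq_integral => w _ do rewrite /= ger0_norm//.
by split=> //; rewrite -lee_fin -EFin_Ex.
Qed.

(** With y = 1 + z/(4p), which is at least 1 and at least z/(4p), one has r <= y^(-p/2) <= y^(-q/2)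
    <= (z/(4p))^(-q/2). *)
Lemma powR_decay (q r z : R) (p : nat) : 0 < z -> 0 <= q <= p%:R -> (0 < p)%N -> 0 <= r ->
  r ^+ 2 * (1 + z / (4 * p%:R)) ^+ p <= 1 ->
  r <= (4 * p%:R) `^ (q / 2) / z `^ (q / 2).
Proof.
move=> z0 /andP[q0 qp] p0 r0 H.
have p0R : 0 < p%:R :> R by rewrite ltr0n.
have p4 : 0 < 4 * p%:R :> R by rewrite mulr_gt0.
set y := 1 + _ in H.
have zy : z / (4 * p%:R) <= y by rewrite lerDr.
have y1 : 1 <= y by rewrite lerDl divr_ge0// ltW.
have y0 : 0 < y by exact: lt_le_trans y1.
rewrite ler_pdivlMr ?powR_gt0//.
have zp : 0 <= z / (4 * p%:R) by rewrite divr_ge0 ?ltW.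
have -> : z = (4 * p%:R) * (z / (4 * p%:R)) by rewrite mulrC divfK// gt_eqF.
rewrite (powRM _ (ltW p4) zp) mulrCA ler_piMr ?powR_ge0//.
apply: (@le_trans _ _ (r * y `^ (p%:R / 2))).
  rewrite ler_wpM2l//; apply: (@le_trans _ _ (y `^ (q / 2))).
    by apply: ge0_ler_powR => //; rewrite ?nnegrE ?divr_ge0// ltW.
  by rewrite ler_powR// ler_pM2r.
rewrite -(ler_pXn2r (n := 2)) ?nnegrE ?mulr_ge0 ?powR_ge0// expr1n exprMn.
by rewrite -[X in _ * X]powR_mulrn ?powR_ge0// -powRrM divfK// powR_mulrn// ltW.
Qed.

End conclusion.

Theorem theorem2 (R : realType) (disp : measure_display)
    (T : measurableType disp) (P : probability T R)
    (X : nat -> {RV P >-> R})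
    (X_gauss : forall i, standard_gaussian (X i))
    (X_indep : mutually_independent X)
    (X_gen : (@measurable disp T) =
      <<s \bigcup_i preimage_set_system setT (X i) measurable >>)
    (d : nat) (d_ge1 : (1 <= d)%N)
    (F : nat -> 'I_d -> {RV P >-> R})
    (F_chaos : forall n i, (1 <= n)%N -> wiener_chaos X 2 (F n i))
    (F_cov : forall n i j, (1 <= n)%N ->
      covariance P (F n i) (F n j) = ((i == j)%:R : R)%:E)
    (F_kappa4 : forall i, kappa4 P (F n i) @[n --> \oo] --> 0%E) :
  forall q : R, 1 <= q ->
    exists (C : R) (nq : nat), [/\ 0 < C, (1 <= nq)%N &
      forall n, (nq <= n)%N -> forall xi : 'rV[R]_d, xi != 0 ->
        `| expectationC P
             (fun w => expC ('i%C * (\sum_(k < d) xi 0 k * F n k w)%:C%C)) |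
        <= (C / (\sum_(k < d) xi 0 k ^+ 2) `^ (q / 2))%:C%C].
Proof.
move=> q q1; pose p := (Num.truncn q).+1.
have p0 : (0 < p)%N by [].
have qp : 0 <= q <= p%:R by rewrite (le_trans _ q1)// ltW// truncnS_gt.
(* The excess of the fourth moment over 3 that [chaos_vector_decay] tolerates; it depends only on q
   and d, hence so does the threshold's target. *)
pose b : R := 24 * ((16 * p * d)%:R^-1) ^+ 2.
have b0 : 0 < b by rewrite mulr_gt0// exprn_gt0// invr_gt0 ltr0n !muln_gt0.
have [N _ HN] : \forall n \near \oo, forall i, (kappa4 P (F n i) < b%:E)%E.
  apply: filter_forall => i.
  have : nbhs (0 : \bar R)%E [set x | (x < b%:E)%E].
    by apply: open_nbhs_nbhs; split; [exact: open_ereal_lt_ereal|rewrite /= lte_fin].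
  by move=> /(F_kappa4 i).
(* The constant is the one of [powR_decay]; the successor guarantees n >= 1, where the chaos and
   covariance assumptions hold. *)
exists ((4 * p%:R) `^ (q / 2)), N.+1; split=> //; first by rewrite powR_gt0// mulr_gt0.
move=> n Nn xi xi0; have n1 : (1 <= n)%N by exact: leq_trans Nn.
have L2F i : L2 P (F n i) by exact: chaos_L2 (F_chaos n i n1).
have mF i : measurable_fun setT (F n i) := measurable_funP (F n i).
have EF i : Ex P (F n i) = 0 by exact: chaos_centered (F_chaos n i n1).
have F4 i : L1 P (fun w => F n i w ^+ 4) /\ Ex P (fun w => F n i w ^+ 4) <= 3 + b.
  apply: L1_fine_expectation.
  - exact: measurable_funX.
  - by move=> w; rewrite -[4%N]/(2 * 2)%N exprM sqr_ge0.
  - have := HN n (ltnW Nn) i; rewrite /kappa4 lteBlDr// addrC => /ltW.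
    by rewrite -EFinD.
have FF i j : Ex P (fun w => F n i w * F n j w) = (i == j)%:R.
  have := F_cov n i j n1; rewrite unlock.
  have EF0 k : ('E_P[F n k] = 0)%E by rewrite expectation_Ex ?EF//; exact: L2_L1.
  rewrite !EF0/= => E; apply: EFin_inj.
  rewrite -(expectation_Ex (L2M (L2F i) (L2F j))) -E.
  by congr expectation; apply/funext => w; rewrite -[F n i w]subr0 -[F n j w]subr0.
have := chaos_vector_decay X_gauss X_indep X_gen xi d_ge1 p0 (fun i => F_chaos n i n1) FF
  (fun i => (F4 i).1) (fun i => (F4 i).2).
have z0 : 0 < nsq xi.
  rewrite lt_neqAle nsq_ge0 andbT eq_sym; apply: contra xi0 => /eqP/nsq_eq0 ->.
  exact: eqxx.
rewrite expectationC_expCi normC_Complex lecR => H.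
apply: powR_decay => //; rewrite sqr_sqrtr ?addr_ge0 ?sqr_ge0//.
Qed.
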